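(* Let $n\ge 2$, let $\Gamma<\mathrm{SL}_n(\mathbb{R})$ be a cocompact lattice, $X=\Gamma\backslash\mathrm{SL}_n(\mathbb{R})$, and let $u$ be a $d$-dimensional abelian horospherical flow on $X$. Fix $0<\alpha<b/(9d^2)$ and, for $T>0$, let $P=P(T)$ be the product of all primes less than $T^\alpha$. Then for any $x_0\in X$, any positive $f\in C^\infty(X)$, and all $T$ large enough (depending on $n$, $d$, $\Gamma$, and $f$), we have $$\sum_{\substack{\mathbf k\in B_T\cap\mathbb{Z}^d\\ \gcd(k_1\cdots k_d,P)=1}}f(x_0u(\mathbf k))\ \asymp_\Gamma\ \left(\frac{T}{\log T}\right)^d\int_Xf\,dm_X .$$
   Context: Abelian horospherical flow: for some $1\le m<n$ with $d=m(n-m)$, $U=\left\{\begin{pmatrix}I_m&*\\0&I_{n-m}\end{pmatrix}\right\}$ and $u:\mathbb{R}^d\to U$ is the group isomorphism given by an identification of the coordinates of $\mathbf t$ with the entries of the upper-right block (one per entry), acting on $X$ by right multiplication. $B_T=[0,T]^d$. $m_X$ is the invariant probability measure on $X$. ''Positive'' means $f\ge0$. The constant $b$: put $\ell=n(n-1)/2$; fix a basis $\mathcal{B}$ of the Lie algebra of $\mathrm{SL}_n(\mathbb{R})$ acting by $Yf(x)=\frac{d}{dt}f(x\exp(tY))|_{t=0}$, and let $\mathcal{S}_{\infty,\ell}(f)=\sum_{\deg\mathcal{D}\le\ell}\|\mathcal{D}f\|_{L^\infty(X)}$ over monomials in $\mathcal{B}$ of degree at most $\ell$ (including degree $0$). Then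 $0<b<1$ is a fixed constant depending only on $n$, $d$, $\Gamma$ such that for all $T$ large enough $$\left|\frac1{T^d}\int_{[0,T]^d}\psi(\mathbf t)\Big(f(x_0u(\mathbf t))-\int_Xf\,dm_X\Big)d\mathbf t\right|\ll_\Gamma T^{-b}\mathcal{S}_{\infty,\ell}(f)$$ for all $f\in C^\infty(X)$, $x_0\in X$ and all additive characters $\psi(\mathbf t)=e^{i\mathbf a\cdot\mathbf t}$, $\mathbf a\in\mathbb{R}^d$. (Such a $b$ exists.) $a\asymp_\Gamma a'$ means $c_1a'\le a\le c_2a'$ with constants $c_1,c_2>0$ depending only on $n$, $d$, $\Gamma$ (with $\alpha$ regarded as fixed), and not on $f$, $x_0$ or $T$; $\ll_\Gamma$ has the analogous meaning. *)

(* Defs.v *)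
From HB Require Import structures.
From mathcomp Require Import all_boot all_order all_algebra.
From mathcomp Require Import all_classical all_reals all_analysis.

Set Implicit Arguments.
Unset Strict Implicit.
Unset Printing Implicit Defensive.

Import Order.TTheory GRing.Theory Num.Theory.
Import numFieldNormedType.Exports.

Local Open Scope classical_set_scope.
Local Open Scope ring_scope.
Local Open Scope quotient_scope.

Section SpecialLinear.
Variables (R : realType) (n : nat).

Record SL := MkSL { SLval :> 'M[R]_n; _ : \det SLval == 1 }.

HB.instance Definition _ := [isSub for SLval].
HB.instance Definition _ := [Choice of SL by <:].

Lemma det_SL (g : SL) : \det g = 1.
Proof. exact/eqP/(valP g). Qed.

Lemma SL_unit (g : SL) : SLval g \in unitmx.
Proof. by rewrite unitmxE det_SL unitr1. Qed.

Fact SL1_subproof : \det (1%:M : 'M[R]_n) == 1.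
Proof. by rewrite det1. Qed.
Definition SL1 : SL := MkSL SL1_subproof.

Fact SLmul_subproof (g h : SL) : \det (g *m h) == 1.
Proof. by rewrite det_mulmx !det_SL mulr1. Qed.
Definition SLmul (g h : SL) : SL := MkSL (SLmul_subproof g h).

Fact SLinv_subproof (g : SL) : \det (invmx g) == 1.
Proof. by rewrite det_inv det_SL invr1. Qed.
Definition SLinv (g : SL) : SL := MkSL (SLinv_subproof g).

Fact SLmulA : associative SLmul.
Proof. by move=> f g h; apply: val_inj; rewrite /= mulmxA. Qed.
Fact SLmul1g : left_id SL1 SLmul.
Proof. by move=> g; apply: val_inj; rewrite /= mul1mx. Qed.
Fact SLmulg1 : right_id SL1 SLmul.
Proof. by move=> g; apply: val_inj; rewrite /= mulmx1. Qed.
Fact SLmulVg : left_inverse SL1 SLinv SLmul.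
Proof. by move=> g; apply: val_inj; rewrite /= mulVmx ?SL_unit. Qed.
Fact SLmulgV : right_inverse SL1 SLinv SLmul.
Proof. by move=> g; apply: val_inj; rewrite /= mulmxV ?SL_unit. Qed.

HB.instance Definition _ :=
  isGroup.Build SL SLmulA SLmul1g SLmulg1 SLmulVg SLmulgV.

HB.instance Definition _ := isPointed.Build SL SL1.
HB.instance Definition _ := Topological.copy SL (initial_topology SLval).

End SpecialLinear.

Section HomogeneousSpace.
Variables (R : realType) (n : nat) (Gamma : groupClosed (SL R n)).

(* [g] and [h] are related iff Γg = Γh *)
Definition coset_rel : rel (SL R n) := fun g h => (h / g)%g \in Gamma.

Fact coset_rel_refl : reflexive coset_rel.
Proof. by move=> g; rewrite /coset_rel divgg gpred1. Qed.
Fact coset_rel_sym : symmetric coset_rel.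
Proof. by move=> g h; rewrite /coset_rel -[in RHS]gpredV invgF. Qed.
Fact coset_rel_trans : transitive coset_rel.
Proof.
move=> g f h; rewrite /coset_rel => fg gh.
by rewrite -(divgKA g h f^-1)%g gpredM.
Qed.

Canonical coset_equiv :=
  EquivRel coset_rel coset_rel_refl coset_rel_sym coset_rel_trans.

Definition hspace : Type := quotient_topology {eq_quot coset_equiv}.
HB.instance Definition _ := Quotient.on hspace.
HB.instance Definition _ := PointedTopological.on hspace.

Definition ract (x : hspace) (g : SL R n) : hspace :=
  \pi_hspace (repr x * g)%g.

Lemma ractE (h g : SL R n) : ract (\pi_hspace h) g = \pi_hspace (h * g)%g.
Proof.
apply/eqmodP; rewrite /= /coset_rel mulgKA.
by apply/(@eqmodP _ coset_equiv); rewrite reprK.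
Qed.

Definition borel_hspace := g_sigma_algebraType (@open hspace).

Definition right_invariant (mu : probability borel_hspace R) :=
  forall (g : SL R n) (A : set borel_hspace), measurable A ->
    mu [set x | A (ract x g)] = mu A.

Definition cocompact_lattice :=
  [/\ isolated [set` Gamma] = [set` Gamma],
      exists mu : probability borel_hspace R, right_invariant mu
    & compact [set: hspace]].

End HomogeneousSpace.

Definition iter_derive (R : realType) (V : normedModType R) (w : seq V)
    (F : V -> R) : V -> R :=
  foldr (fun v h => 'D_v h) F w.

Definition smooth_on (R : realType) (V : normedModType R) (U : set V)
    (F : V -> R) :=
  forall (w : seq V) (x : V), U x ->
    {for x, continuous (iter_derive w F)} /\
    forall v : V, derivable (iter_derive w F) x v.

(* SL_n(R) -> X is a local diffeomorphism, so f is smooth iff its lift to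
   SL_n(R) is; SL_n(R) being an embedded submanifold of the space of matrices,
   this means that the lift extends smoothly near every point. *)
Definition smooth (R : realType) (n : nat) (Gamma : groupClosed (SL R n))
    (f : hspace Gamma -> R) :=
  forall g : SL R n, exists (U : set 'M[R]_n) (F : 'M[R]_n -> R),
    [/\ open U, U (val g), smooth_on U F
      & forall h : SL R n, U (val h) -> f (\pi_(hspace Gamma) h) = F (val h)].

Definition expm (R : realType) (n : nat) (A : 'M[R]_n) : 'M[R]_n :=
  limn (series (fun k : nat => (k`!%:R : R)^-1 *: A ^+ k)).

(* The default value 1 is never reached when \tr A = 0, as
   \det (expm A) = expR (\tr A). *)
Definition SLexp (R : realType) (n : nat) (A : 'M[R]_n) : SL R n :=
  insubd (SL1 R n) (expm A).

Definition sl (R : realType) (n : nat) : {vspace 'M[R]_n} :=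
  lker (linfun (@mxtrace R n : 'M[R]_n -> R^o)).

Section SobolevNorm.
Variables (R : realType) (n : nat) (Gamma : groupClosed (SL R n)).

Definition lie_derive (Y : 'M[R]_n) (f : hspace Gamma -> R) : hspace Gamma -> R :=
  fun x => derive1 (fun t : R => f (ract x (SLexp (t *: Y)))) 0.

Definition lie_monomial (w : seq 'M[R]_n) (f : hspace Gamma -> R) :
    hspace Gamma -> R :=
  foldr lie_derive f w.

(* Lie derivatives do not commute: the monomials of degree k in B are the words
   of length k. *)
Definition sobolev_norm (mX : probability (borel_hspace Gamma) R)
    (B : seq 'M[R]_n) (l : nat) (f : hspace Gamma -> R) : \bar R :=
  (\sum_(k < l.+1) \sum_(w : k.-tuple 'I_(size B))
     'N[mX]_+oo[EFin \o lie_monomial [seq B`_(i : 'I_(size B)) | i <- w] f])%E.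

End SobolevNorm.

(* [hf_pos k] is the position of the k-th coordinate: the positions of the
   upper-right block are the (i, j) with i < m <= j. *)
Record horo_flow (n d : nat) := HoroFlow {
  hf_m : nat;
  hf_pos : 'I_d -> 'I_n * 'I_n;
  hf_m_bounds : (1 <= hf_m < n)%N;
  hf_dim : d = (hf_m * (n - hf_m))%N;
  hf_pos_inj : injective hf_pos;
  hf_pos_block : forall ij : 'I_n * 'I_n,
    (ij \in codom hf_pos) = (ij.1 < hf_m <= ij.2)%N
}.

Section HorosphericalFlow.
Variables (R : realType) (n d : nat) (u : horo_flow n d).

Definition horo_mx (t : 'rV[R]_d) : 'M[R]_n :=
  1%:M + \sum_(k < d) t ord0 k *: delta_mx (hf_pos u k).1 (hf_pos u k).2.

Fact det_horo_mx (t : 'rV[R]_d) : \det (horo_mx t) == 1.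
Proof.
have posP k : ((hf_pos u k).1 < hf_m u <= (hf_pos u k).2)%N.
  by rewrite -hf_pos_block codom_f.
rewrite -det_tr det_trig.
  apply/eqP/big1 => i _; rewrite !mxE eqxx summxE big1 ?addr0// => k _.
  rewrite !mxE; have /andP[h1 h2] := posP k.
  case: eqP => [->|]; case: eqP => [e|]; rewrite ?mulr0//.
  by move: (leq_trans h1 h2); rewrite -e e ltnn.
apply/is_trig_mxP => i j ij; rewrite !mxE summxE.
have /negPf -> : j != i by rewrite gt_eqF.
rewrite add0r big1// => k _; rewrite !mxE; have /andP[h1 h2] := posP k.
case: eqP => [e1|]; case: eqP => [e2|]; rewrite ?mulr0//.
by move: (leq_trans h1 h2); rewrite -e1 -e2 ltnNge ltnW.
Qed.

Definition horo (t : 'rV[R]_d) : SL R n := MkSL (det_horo_mx t).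

End HorosphericalFlow.

(* Lebesgue integral over [0,T]^d as an iterated integral; it is only used for
   continuous integrands. *)
Fixpoint box_integral (R : realType) (T : R) (d : nat) :
    ('rV[R]_d -> R) -> R :=
  match d with
  | 0%N => fun F => F 0
  | d'.+1 => fun F =>
      \int[lebesgue_measure]_(s in `[0, T])
        box_integral T (fun t : 'rV[R]_d' => F (row_mx (s%:M : 'rV[R]_1) t))
  end.

Section Equidistribution.
Variables (R : realType) (n d : nat) (Gamma : groupClosed (SL R n)).
Variable mX : probability (borel_hspace Gamma) R.

Definition space_avg (f : hspace Gamma -> R) : R := \int[mX]_x f x.

(* Modulus of the complex number: T^-d times the integral over [0,T]^d of
   exp(i a.t) (f(x0 u(t)) - space_avg f). *)
Definition twisted_discrepancy (u : horo_flow n d) (T : R) (a : 'rV[R]_d)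
    (f : hspace Gamma -> R) (x0 : hspace Gamma) : R :=
  let phase (t : 'rV[R]_d) := \sum_(k < d) a ord0 k * t ord0 k in
  let diff t := f (ract x0 (horo u t)) - space_avg f in
  T ^- d * Num.sqrt (box_integral T (fun t => cos (phase t) * diff t) ^+ 2
                   + box_integral T (fun t => sin (phase t) * diff t) ^+ 2).

Definition equidistribution_exponent (B : seq 'M[R]_n) (b : R) :=
  exists C T0 : R, 0 < C /\
    forall (u : horo_flow n d) (T : R) (f : hspace Gamma -> R)
           (x0 : hspace Gamma) (a : 'rV[R]_d),
      T0 <= T -> smooth f ->
      ((twisted_discrepancy u T a f x0)%:E
         <= (C * T `^ (- b))%:E * sobolev_norm mX B ((n * n.-1) %/ 2) f)%E.

End Equidistribution.

Definition prod_primes_lt (R : realType) (z : R) : nat :=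
  (\prod_(p < (Num.truncn z).+1 | prime p && (p%:R < z)%R) p)%N.

(* The integer points of [0,T]^d are the vectors with entries in
   {0, ..., floor T}. *)
Definition sifted_sum (R : realType) (n d : nat) (Gamma : groupClosed (SL R n))
    (u : horo_flow n d) (f : hspace Gamma -> R) (x0 : hspace Gamma)
    (T : R) (P : nat) : R :=
  \sum_(k : {ffun 'I_d -> 'I_(Num.truncn T).+1} | gcdn (\prod_i k i) P == 1%N)
     f (ract x0 (horo u (\row_i (k i)%:R))).

(* Main.v *)
Require Import Defs.
From mathcomp Require Import finmap.
From mathcomp Require Import all_boot all_order all_algebra.
From mathcomp Require Import all_classical all_reals all_analysis.
From mathcomp Require Import measurable_realfun ess_sup_inf ring lra zify.

(** The sum over the integer points [k] none of whose coordinates has a prime factor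
  below [z = T `^ alpha] is a sieve problem of dimension [d]. A sieve evaluates such
  a sum from the sums over the points whose coordinates are divisible by prescribed
  moduli [q 0], ..., [q (d - 1)], and these are what equidistribution gives.

  Level of distribution ([level_of_distribution]). By compactness [f] is bounded, is
  Lipschitz along orbits and has finite Sobolev norms, since Lie derivatives of smooth
  functions are smooth. The indicator of the multiples of [q i] is replaced by a
  Jackson kernel, a trigonometric polynomial of period [q i] concentrated near the
  midpoints of its periods; the base point is shifted by half a period. Integrating
  [f] against the product of the kernels over the box samples [f] at the wanted
  points, up to a relative error [O(1 / H)] and the contribution [O(T ^ (d - 1))] of
  the boundary. As the kernels are combinations of characters with coefficients of
  total size [O(H ^ d)], equidistribution twisted by arbitrary characters replaces
  [f] by its average with an error [O(H ^ d * T ^ (d - b))], uniformly in the moduli.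

  Sieve ([brun_hooley]). The primes below [z] are cut at the iterated square roots of
  [z]. In each of the [d] coordinates and each range, inclusion-exclusion is truncated
  after [2 * d + 2 * j] primes for the [j]-th range; Bonferroni's inequalities
  ([bonferroni]) tell the sign and the size of what is lost. Upper bounds for the
  ranges can be multiplied; for the lower bound, Hooley's inequality
  ([prod_perturb_le]) corrects one factor at a time. By Mertens' theorems the sum of
  [1 / p] over a range is close to [ln 2]; here at most [21 / 20] is used, and this
  suffices for the losses to stay below the main term ([loss_sum_le]). In the last
  range, below a constant, nothing is truncated. The sieve uses moduli whose product
  is at most a constant times [z ^ (d * (4 * d + 4) + 1)] ([cut_level]), and
  [d * (4 * d + 4) + 1 <= 9 * d ^ 2]. This is where [9 * d ^ 2 * alpha < b] enters:
  it leaves a power of [T] for [H] and for the error term ([error_negligible]).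

  The main term is the average of [f] times [T ^ d] times the [d]-th power of the
  product of [1 - 1 / p] over the primes below [z], and by Mertens this product has
  the order of magnitude of [1 / ln z = 1 / (alpha * ln T)] ([vprod_bounds]). The
  average is positive unless [f] vanishes identically, because open sets have positive
  measure ([space_avg_gt0]), so that the error term, which depends on [f], is smaller
  than the main term for large [T]. *)

Set Implicit Arguments.
Unset Strict Implicit.
Unset Printing Implicit Defensive.

Import Order.TTheory GRing.Theory Num.Theory.
Import numFieldNormedType.Exports.

Local Open Scope classical_set_scope.
Local Open Scope ring_scope.
Local Open Scope quotient_scope.

(** * Differential calculus on open sets *)

(** Smoothness cut down to a finite order, so that closure properties can be
  proved by induction on the order. *)
Fixpoint Ck (R : realType) (V : normedModType R) (k : nat) (U : set V)
    (F : V -> R) : Prop :=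
  if k is k'.+1 then
    (forall x, U x -> {for x, continuous F} /\ forall v, derivable F x v) /\
    forall v, Ck k' U ('D_v F)
  else forall x, U x -> {for x, continuous F}.

Section Ck.
Variables (R : realType) (V : normedModType R) (U : set V).
Hypothesis oU : open U.
Implicit Types F G : V -> R.

Lemma CkW k F : Ck k.+1 U F -> Ck k U F.
Proof.
elim: k F => [|k IH] F [h1 h2]; first by move=> x /h1 [].
by split=> // v; apply: IH.
Qed.

Lemma smooth_onP F : smooth_on U F <-> forall k, Ck k U F.
Proof.
split=> [h k|h].
  elim: k F h => [|k IH] F h; first by move=> x /(h [::]) [].
  split=> [x /(h [::])//|v]; apply: IH => w x Ux.
  by have := h (rcons w v) x Ux; rewrite /iter_derive foldr_rcons.
move=> w; elim/last_ind: w F h => [|w v IH] F h x Ux.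
  by have [+ _] := h 1%N; apply.
rewrite /iter_derive foldr_rcons; apply: IH => // k.
by have [_] := h k.+1; apply.
Qed.

Lemma near_open x F G : {in U, F =1 G} -> U x -> \near x, F x = G x.
Proof.
move=> FG Ux; have := open_nbhs_nbhs (conj oU Ux).
by apply: filterS => y Uy; apply: FG; rewrite inE.
Qed.

Lemma Ck_ext k F G : {in U, F =1 G} -> Ck k U F -> Ck k U G.
Proof.
have cts F' G' x : {in U, F' =1 G'} -> U x -> {for x, continuous F'} ->
    {for x, continuous G'}.
  move=> FG Ux; rewrite /prop_for /continuous_at -(FG x) ?inE// => h.
  apply: cvg_trans h; apply: near_eq_cvg.
  by have := near_open FG Ux; apply: filterS => y ->.
elim: k F G => [|k IH] F G FG; first by move=> h x Ux; apply: cts (h x Ux).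
case=> h1 h2; split=> [x Ux|v].
  have [c d] := h1 x Ux; split; first exact: cts c.
  move=> v; apply: near_eq_derivable (d v); exact: near_open.
apply: (IH _ _ _ (h2 v)) => x; rewrite inE => Ux.
by apply: near_eq_derive; exact: near_open.
Qed.

Lemma Ck_cst k c : Ck k U (cst c).
Proof.
elim: k c => [|k IH] c; first by move=> x _; exact: cvg_cst.
split=> [x _|v]; first by split; [exact: cvg_cst|move=> v; exact: derivable_cst].
rewrite (_ : 'D_v (cst c) = cst 0); first exact: IH.
by apply/funext => x; rewrite derive_cst.
Qed.

Lemma CkD k F G : Ck k U F -> Ck k U G -> Ck k U (F + G).
Proof.
elim: k F G => [|k IH] F G; first by move=> cF cG x Ux; exact: cvgD (cF x Ux) (cG x Ux).
move=> [F1 F2] [G1 G2]; split=> [x Ux|v].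
  have [cF dF] := F1 x Ux; have [cG dG] := G1 x Ux.
  split=> [|w]; first exact: cvgD cF cG.
  exact: derivableD (dF w) (dG w).
apply: (@Ck_ext k ('D_v F + 'D_v G)); last exact: IH (F2 v) (G2 v).
move=> x; rewrite inE => Ux; have [_ dF] := F1 x Ux; have [_ dG] := G1 x Ux.
by rewrite deriveD.
Qed.

Lemma CkM k F G : Ck k U F -> Ck k U G -> Ck k U (F * G).
Proof.
elim: k F G => [|k IH] F G; first by move=> cF cG x Ux; exact: cvgM (cF x Ux) (cG x Ux).
move=> cF cG; have [F1 F2] := cF; have [G1 G2] := cG; split=> [x Ux|v].
  have [cxF dF] := F1 x Ux; have [cxG dG] := G1 x Ux.
  split=> [|w]; first exact: cvgM cxF cxG.
  exact: derivableM (dF w) (dG w).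
apply: (@Ck_ext k (F * 'D_v G + G * 'D_v F)).
  move=> x; rewrite inE => Ux; have [_ dF] := F1 x Ux; have [_ dG] := G1 x Ux.
  by rewrite deriveM.
apply: CkD.
  exact: IH (CkW cF) (G2 v).
exact: IH (CkW cG) (F2 v).
Qed.

Lemma Ck_sum k (I : Type) (r : seq I) (F : I -> V -> R) :
  (forall i, Ck k U (F i)) -> Ck k U (\sum_(i <- r) F i).
Proof.
move=> cF; elim: r => [|i r IH]; first by rewrite big_nil; exact: Ck_cst.
by rewrite big_cons; exact: CkD.
Qed.

Lemma mean_value_segment F x v : Ck 1 U F ->
  (forall s : R, 0 <= s <= 1 -> U (s *: v + x)) ->
  exists2 s : R, 0 <= s <= 1 & F (v + x) - F x = 'D_v F (s *: v + x).
Proof.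
move=> [F1 _] seg; pose f (s : R) := F (s *: v + x).
have df (s : R) : 0 <= s <= 1 -> is_derive s 1 f ('D_v F (s *: v + x)).
  move=> /seg /F1 [_ /(_ v) dF].
  have E : (fun h : R => h^-1 *: ((f \o shift s) (h *: 1) - f s)) =
      (fun h => h^-1 *: ((F \o shift (s *: v + x)) (h *: v) - F (s *: v + x))).
    apply/funext => h; rewrite /f /=; congr (_ *: (F _ - _)).
    by rewrite scalerDl addrA [h%:A]mulr1.
  by apply: DeriveDef; rewrite /derivable ?/derive E.
have [||s s01 E] := @MVT_segment R f (fun s : R => 'D_v F (s *: v + x)) 0 1 ler01.
- by move=> s; rewrite in_itv/= => /andP[s0 s1]; apply: df; rewrite !ltW.
- apply: derivable_within_continuous => s; rewrite in_itv/= => s01.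
  by have [] := df s s01.
exists s; first by move: s01; rewrite in_itv.
by move: E; rewrite /f scale1r scale0r add0r subr0 mulr1.
Qed.

Lemma derive_scale F x (a : R) v : derivable F x v ->
  derivable F x (a *: v) /\ 'D_(a *: v) F x = a * 'D_v F x.
Proof.
move=> dF; have [->|a0] := eqVneq a 0.
  by rewrite scale0r mul0r derive0; split; [exact: derivable0|reflexivity].
suff h : (fun h => h^-1 *: ((F \o shift x) (h *: (a *: v)) - F x)) @ 0^' -->
    a * 'D_v F x.
  by split; [apply/cvg_ex; eexists; exact: h|exact: cvg_lim h].
have dF' : (fun h => h^-1 *: ((F \o shift x) (h *: v) - F x)) @ 0^' -->
    'D_v F x by exact: dF.
have sc : (fun h : R => h * a) @ 0^' --> (0 : R)^'.
  move=> P [e /= e0 eP]; exists (e / `|a|) => /=; first by rewrite divr_gt0 ?normr_gt0.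
  move=> y; rewrite /= sub0r normrN => ye y0; apply: eP => /=; last by rewrite mulf_neq0.
  by rewrite sub0r normrN normrM -ltr_pdivlMr ?normr_gt0.
have lim_h : (fun h : R => a * ((h * a)^-1 *: (F ((h * a) *: v + x) - F x)))
    @ 0^' --> a * 'D_v F x.
  by apply: cvgM; [exact: cvg_cst|exact: cvg_comp sc dF'].
apply: cvg_trans lim_h; apply: near_eq_cvg; near=> h => /=.
have h0 : h != 0 by near: h; exact: nbhs_dnbhs_neq.
by rewrite scalerA /GRing.scale/= invfM mulrA mulrCA mulfV// mulr1.
Unshelve. all: by end_near. Qed.

Lemma nbhs_addP (P : set V) x : nbhs x P ->
  exists2 e : R, 0 < e & forall y, `|y| < e -> P (y + x).
Proof.
move=> /nbhs_normP[e /= e0 eP]; exists e => // y ye; apply: eP => /=.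
by rewrite opprD addrCA subrr addr0 normrN.
Qed.

(** Directional derivatives are additive in the direction as soon as they are
  continuous: the increment along [h *: v] is a derivative at an intermediate
  point, which tends to [x]. *)
Lemma derive_dirD F x v w : Ck 1 U F -> U x ->
  'D_(v + w) F x = 'D_v F x + 'D_w F x.
Proof.
move=> cF Ux; have [F1 F2] := cF.
have [eU eU0 eUP] := nbhs_addP (open_nbhs_nbhs (conj oU Ux)).
apply: cvg_lim => //.
have dw : (fun h : R => h^-1 *: ((F \o shift x) (h *: w) - F x)) @ 0^' -->
    'D_w F x by have [_ /(_ w)] := F1 x Ux.
suff dv : (fun h : R => h^-1 *: (F (h *: v + (h *: w + x)) - F (h *: w + x)))
    @ 0^' --> 'D_v F x.
  rewrite [X in X @ _](_ : _ =
      (fun h : R => h^-1 *: (F (h *: v + (h *: w + x)) - F (h *: w + x))) +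
      (fun h : R => h^-1 *: ((F \o shift x) (h *: w) - F x))).
    exact: cvgD dv dw.
  apply/funext => h; rewrite addrfctE /= -scalerDr subrKA.
  by rewrite [h *: (v + w)]scalerDr addrA.
apply/(@cvgrPdist_le _ R^o) => e e0.
have nd : \forall y \near x, `|'D_v F x - 'D_v F y| <= e.
  exact: (@cvgrPdist_le _ R^o _ _ _ _ _).1 (F2 v x Ux) e e0.
have [d d0 dP] := nbhs_addP nd.
pose m := `|v| + `|w| + 1.
have m0 : 0 < m by rewrite ltr_wpDl// addr_ge0.
have small (h s : R) r : 0 <= s <= 1 -> `|h| < r / m ->
    `|s *: (h *: v) + h *: w| < r.
  move=> /andP[s0 s1]; rewrite ltr_pdivlMr// => hr; apply: le_lt_trans hr.
  rewrite (le_trans (ler_normD _ _))// !normrZ /m -addrA mulrDr lerD//.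
    by rewrite mulrCA ler_wpM2l// ger0_norm// ler_piMl.
  by rewrite ler_wpM2l// lerDl.
near=> h.
have h0 : h != 0 by near: h; exact: nbhs_dnbhs_neq.
have hU : `|h| < eU / m by near: h; apply: dnbhs0_lt; rewrite divr_gt0.
have hd : `|h| < d / m by near: h; apply: dnbhs0_lt; rewrite divr_gt0.
have [|s s01 ->] := @mean_value_segment F (h *: w + x) (h *: v) cF.
  by move=> s s01; rewrite addrA; apply: eUP; exact: small.
have Us : U (s *: (h *: v) + (h *: w + x)).
  by rewrite addrA; apply: eUP; exact: small.
have [_ /(_ v) dvF] := F1 _ Us; have [_ ->] := derive_scale h dvF.
by rewrite /GRing.scale/= mulKf// addrA; apply: dP; exact: small.
Unshelve. all: by end_near. Qed.

Lemma derive_dir_sum F x (I : Type) (r : seq I) (v : I -> V) (a : I -> R) :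
  Ck 1 U F -> U x ->
  'D_(\sum_(i <- r) a i *: v i) F x = \sum_(i <- r) a i * 'D_(v i) F x.
Proof.
move=> cF Ux; have [F1 _] := cF; have [_ dF] := F1 x Ux.
elim: r => [|i r IH]; first by rewrite !big_nil derive0.
by rewrite !big_cons derive_dirD// IH; have [_ ->] := derive_scale (a i) (dF (v i)).
Qed.

End Ck.

Lemma cvg_sumr (R : realType) (T : Type) (F : set_system T) {FF : Filter F}
    (I : Type) (r : seq I) (f : I -> T -> R) (l : I -> R) :
  (forall i, f i t @[t --> F] --> l i) ->
  (\sum_(i <- r) f i t) @[t --> F] --> \sum_(i <- r) l i.
Proof.
move=> fl; elim: r => [|i r IH].
  by rewrite big_nil; under eq_fun do rewrite big_nil; exact: cvg_cst.
by rewrite big_cons; under eq_fun do rewrite big_cons; exact: cvgD.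
Qed.

Section MatrixCalculus.
Variables (R : realType) (m n : nat) (U : set 'M[R]_(m, n)).
Hypothesis oU : open U.
Implicit Types F : 'M[R]_(m, n) -> R.

Lemma derive_dir_mx F (x v : 'M[R]_(m, n)) : Ck 1 U F -> U x ->
  'D_v F x = \sum_i \sum_j v i j * 'D_(delta_mx i j) F x.
Proof.
move=> cF Ux; rewrite [X in 'D_X F x](matrix_sum_delta v) !pair_big/=.
by rewrite (derive_dir_sum oU _ (fun p => delta_mx p.1 p.2) (fun p => v p.1 p.2)).
Qed.

(** The derivative along a curve depends only on the tangent vector: the
  increment is a derivative at an intermediate point, in a direction that tends to
  the tangent vector. *)
Lemma derive_curve F x (w : R -> 'M[R]_(m, n)) (v : 'M[R]_(m, n)) : Ck 1 U F -> U x ->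
  w t @[t --> 0^'] --> v ->
  (fun t : R => t^-1 * (F (t *: w t + x) - F x)) @ 0^' --> 'D_v F x.
Proof.
move=> cF Ux wv; have [F1 F2] := cF.
have [eU eU0 eUP] := nbhs_addP (open_nbhs_nbhs (conj oU Ux)).
have tw : (fun t : R => t *: w t) @ 0^' --> (0 : 'M[R]_(m, n)).
  have h : (fun t : R => t) @ 0^' --> (0 : R) by exact: cvg_within.
  have : (fun t : R => t *: w t) @ 0^' --> 0 *: v by exact: cvgZ h wv.
  by rewrite scale0r.
have tw_small e : 0 < e -> \forall t \near (0 : R)^', `|t *: w t| < e.
  move=> e0; move/cvgrPdist_lt : (tw) => /(_ e e0).
  by apply: filterS => t; rewrite sub0r normrN.
pose P (t s : R) := 0 <= s <= 1 /\
  F (t *: w t + x) - F x = 'D_(t *: w t) F (s *: (t *: w t) + x).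
pose s (t : R) := xget 0 (P t).
have inU (t s0 : R) : `|t *: w t| < eU -> 0 <= s0 <= 1 ->
    U (s0 *: (t *: w t) + x).
  move=> tU /andP[s00 s01]; apply: eUP; apply: le_lt_trans tU.
  by rewrite normrZ ger0_norm// ler_piMl.
have Ps (t : R) : `|t *: w t| < eU -> P t (s t).
  move=> tU; have [|s0 s01 E] := @mean_value_segment _ _ U F x (t *: w t) cF.
    by move=> s0; exact: inU.
  exact: (@xgetPex _ 0 (P t)) (ex_intro _ s0 (conj s01 E)).
pose xi (t : R) := s t *: (t *: w t) + x.
have xix : xi t @[t --> 0^'] --> x.
  apply/cvgrPdist_lt => e e0; near=> t.
  have [/andP[s0 s1] _] : P t (s t) by apply: Ps; near: t; exact: tw_small.
  rewrite /xi opprD addrCA subrr addr0 normrN normrZ ger0_norm//.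
  rewrite (@le_lt_trans _ _ `|t *: w t|)//; first by rewrite ler_piMl.
  by near: t; exact: tw_small.
rewrite (derive_dir_mx v cF Ux).
have : (fun t => \sum_i \sum_j w t i j * 'D_(delta_mx i j) F (xi t)) @ 0^' -->
   \sum_i \sum_j v i j * 'D_(delta_mx i j) F x.
  apply: cvg_sumr => i; apply: cvg_sumr => j; apply: cvgM.
    exact: (cvg_comp _ _ wv (@coord_continuous _ _ _ i j v)).
  exact: (cvg_comp _ _ xix (F2 _ x Ux)).
apply: cvg_trans; apply: near_eq_cvg; near=> t.
have t0 : t != 0 by near: t; exact: nbhs_dnbhs_neq.
have tU : `|t *: w t| < eU by near: t; exact: tw_small.
have [s01 ->] := Ps t tU; have Uxi := inU t (s t) tU s01.
have [_ /(_ (w t)) dF] := F1 _ Uxi; have [_ ->] := derive_scale t dF.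
by rewrite mulKf// (derive_dir_mx (w t) cF Uxi).
Unshelve. all: by end_near. Qed.

Lemma Ck_coord k i j : Ck k U (fun A : 'M[R]_(m, n) => A i j).
Proof.
have dc (x : 'M[R]_(m, n)) v : is_derive x v (fun A : 'M[R]_(m, n) => A i j) (v i j).
  apply: DeriveDef; first exact/diff_derivable/differentiable_coord.
  apply: cvg_lim => //; apply: cvg_near_cst; near=> h.
  have h0 : h != 0 by near: h; exact: nbhs_dnbhs_neq.
  by rewrite /= !mxE addrK /GRing.scale/= mulKf.
case: k => [|k]; first by move=> x _; exact: coord_continuous.
split=> [x _|v]; first by split; [exact: coord_continuous|move=> v; case: (dc x v)].
rewrite (_ : 'D_v _ = cst (v i j)); first exact: Ck_cst.
by apply/funext => x; case: (dc x v).
Unshelve. all: by end_near. Qed.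

End MatrixCalculus.

(** * The exponential of matrices *)

Section Expm.
Variables (R : realType) (n : nat).
Implicit Types A Y : 'M[R]_n.

Lemma mx_entry_le (m p : nat) (A : 'M[R]_(m, p)) i j : `|A i j| <= `|A|.
Proof. by rewrite [leRHS]/Num.Def.normr/= mx_normrE (le_bigmax _ _ (i, j)). Qed.

Lemma cvg_mxP (T : Type) (F : set_system T) {FF : Filter F} (m p : nat)
    (f : T -> 'M[R]_(m, p)) (l : 'M[R]_(m, p)) :
  (forall i j, f t i j @[t --> F] --> l i j) <-> f t @[t --> F] --> l.
Proof.
split=> [fl|fl i j]; last exact: cvg_comp fl (@coord_continuous _ _ _ i j l).
apply/cvgrPdist_le => /= e e0; near=> t.
rewrite [leLHS]/Num.Def.normr/= mx_normrE (bigmax_le _ (ltW e0))//= => -[i j] _.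
rewrite !mxE/=; move: (i) (j); near: t.
apply: filter_forall => {}i; apply: filter_forall => {}j.
by move/cvgrPdist_le : (fl i j); apply.
Unshelve. all: by end_near. Qed.

Let c A := n%:R * `|A|.

(** The norm of a matrix is its largest entry; it is submultiplicative up to the
  factor [n]. *)
Lemma mx_pow_entry_le A k i j : `|(A ^+ k) i j| <= c A ^+ k.
Proof.
elim: k i j => [|k IH] i j; first by rewrite !expr0 mxE; case: eqP; rewrite ?normr1 ?normr0.
rewrite exprSr mxE (le_trans (ler_norm_sum _ _ _))//.
rewrite (@le_trans _ _ (\sum_(l < n) c A ^+ k * `|A|))//.
  by apply: ler_sum => l _; rewrite normrM ler_pM// mx_entry_le.
by rewrite sumr_const card_ord exprSr -mulr_natl mulrCA.
Qed.

Lemma mx_exprZ (t : R) A k : (t *: A) ^+ k = t ^+ k *: A ^+ k.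
Proof.
elim: k => [|k IH]; first by rewrite !expr0 scale1r.
by rewrite !exprS IH -!mulmxE -scalemxAl -scalemxAr scalerA.
Qed.

Let ec A i j (k : nat) := (k`!%:R : R)^-1 * (A ^+ k) i j.

Lemma ec_le A i j k : `|ec A i j k| <= exp_coeff (c A) k.
Proof.
rewrite /ec normrM ger0_norm ?invr_ge0// /exp_coeff mulrC ler_wpM2r ?invr_ge0//.
exact: mx_pow_entry_le.
Qed.

Lemma series_exp_coeff_le (x : R) m : 0 <= x -> series (exp_coeff x) m <= expR x.
Proof.
move=> x0; apply: nondecreasing_cvgn_le; last exact: is_cvg_series_exp_coeff.
by apply/nondecreasing_seqP => k; rewrite seriesSr lerDl exp_coeff_ge0.
Qed.

Lemma cvg_series_ec A i j : cvgn (series (ec A i j)).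
Proof.
apply: normed_cvg; apply: (@series_le_cvg _ _ (exp_coeff (c A))) => [k|k|k|].
- exact: normr_ge0.
- by apply: exp_coeff_ge0; rewrite mulr_ge0.
- exact: ec_le.
- exact: is_cvg_series_exp_coeff.
Qed.

Lemma cvg_expm A i j : series (ec A i j) k @[k --> \oo] --> expm A i j.
Proof.
have h : series (fun k : nat => (k`!%:R : R)^-1 *: A ^+ k) @ \oo -->
    (\matrix_(i, j) limn (series (ec A i j)) : 'M[R]_n).
  apply/cvg_mxP => i' j'; rewrite mxE.
  under eq_fun do rewrite /series/= summxE.
  by under eq_fun do under eq_bigr do rewrite mxE; exact: cvg_series_ec.
rewrite /expm (cvg_lim _ h) ?mxE; last exact: norm_hausdorff.
exact: cvg_series_ec.
Qed.

(** The entries of the exponential series are dominated by the series of a real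
  exponential, whose tail from the second term on absorbs [t ^+ 2]. *)
Lemma expm_approx1 Y : exists2 K : R, 0 <= K & forall t : R, `|t| <= 1 -> forall i j,
  `|expm (t *: Y) i j - (1%:M + t *: Y) i j| <= K * t ^+ 2.
Proof.
exists (expR (c Y)); first exact: expR_ge0.
move=> t t1 i j.
have h : series (ec (t *: Y) i j) k - (1%:M + t *: Y) i j @[k --> \oo] -->
    expm (t *: Y) i j - (1%:M + t *: Y) i j.
  by apply: cvgB; [exact: cvg_expm|exact: cvg_cst].
apply: (@cvgr_to_le _ _ _ _ _ _ _ (cvg_norm h)).
near=> k; have [k' ->] : exists k', k = k'.+2.
  have : (2 <= k)%N by near: k; exact: nbhs_infty_ge.
  by case: (k) => [|[|k']]// _; exists k'.
rewrite /series/= 2?big_nat_recl// {1 2}/ec fact0 expr0 (_ : 1`! = 1%N)// expr1 invr1 !mul1r.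
have cancel (x y s : R) : x + (y + s) - (x + y) = s by ring.
rewrite [(1%:M + _) i j]mxE cancel.
rewrite (le_trans (ler_norm_sum _ _ _))//.
rewrite (@le_trans _ _ (\sum_(0 <= l < k') exp_coeff (c Y) l.+2 * t ^+ 2))//.
  apply: ler_sum => l _; rewrite /ec mx_exprZ mxE mulrCA normrM mulrC ler_pM//.
    exact: ec_le.
  by rewrite normrX -[t ^+ 2]ger0_norm ?sqr_ge0// normrX -addn2 exprD ler_piMl// exprn_ile1.
rewrite -mulr_suml ler_wpM2r ?sqr_ge0//.
apply: le_trans (series_exp_coeff_le k'.+2 _); last by rewrite mulr_ge0.
rewrite /series/= 2?big_nat_recl// addrA lerDr addr_ge0// exp_coeff_ge0//.
  by rewrite mulr_ge0.
by rewrite mulr_ge0.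
Unshelve. all: by end_near. Qed.

Lemma cvg_expm_dir Y :
  (fun t : R => t^-1 *: (expm (t *: Y) - 1%:M)) @ 0^' --> Y.
Proof.
have [K K0 hK] := expm_approx1 Y.
apply/cvg_mxP => i j; apply/cvgrPdist_le => e e0; near=> t.
have t0 : t != 0 by near: t; exact: nbhs_dnbhs_neq.
have t1 : `|t| <= 1 by near: t; apply: dnbhs0_le.
rewrite distrC !mxE -(@ler_pM2l _ `|t|) ?normr_gt0// -normrM mulrBr mulVKf//.
have := hK t t1 i j; rewrite !mxE opprD addrA => /le_trans; apply.
rewrite -[t ^+ 2]ger0_norm ?sqr_ge0// normrX expr2 mulrCA ler_wpM2l//.
rewrite (@le_trans _ _ ((K + 1) * `|t|)) ?ler_wpM2r ?lerDl//.
rewrite -ler_pdivlMl ?ltr_wpDl//; near: t; apply: dnbhs0_le.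
by rewrite mulr_gt0// invr_gt0 ltr_wpDl.
Unshelve. all: by end_near. Qed.

Lemma ffact_ratio_le1 (N k : nat) : (0 < N)%N -> (N ^_ k)%:R / N%:R ^+ k <= 1 :> R.
Proof.
move=> N0; rewrite ler_pdivrMr ?exprn_gt0 ?ltr0n// mul1r -natrX ler_nat.
by elim: k => // k IH; rewrite ffactnSr expnSr leq_mul// leq_subr.
Qed.

Lemma ffact_ratio_ge (N k : nat) : (0 < N)%N ->
  1 - k%:R ^+ 2 / N%:R <= (N ^_ k)%:R / N%:R ^+ k :> R.
Proof.
move=> N0; have N0' : 0 < N%:R :> R by rewrite ltr0n.
elim: k => [|k IH]; first by rewrite expr0n/= mul0r subr0 ffactn0 expr0 divr1.
have a1 := ffact_ratio_le1 k N0.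
rewrite ffactnSr natrM [N%:R ^+ _]exprSr invfM mulrACA.
have a0 : 0 <= (N ^_ k)%:R / N%:R ^+ k :> R by rewrite divr_ge0// exprn_ge0.
have : 1 - k%:R / N%:R <= (N - k)%:R / N%:R :> R.
  rewrite ler_pdivlMr// mulrBl mul1r divfK ?lt0r_neq0// lerBlDr -natrD.
  by rewrite ler_nat; lia.
set a := (N ^_ k)%:R / _ in a1 a0 IH *; set b := (N - k)%:R / _ => hb.
rewrite (@le_trans _ _ (a * (1 - k%:R / N%:R)))// ?ler_wpM2l//.
have x0 : 0 <= k%:R / N%:R :> R by rewrite divr_ge0.
rewrite (@le_trans _ _ (a - k%:R / N%:R))//; last first.
  by rewrite mulrBr mulr1 lerB// ler_piMl.
apply: le_trans (lerB IH (lexx (k%:R / N%:R))).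
rewrite -addrA lerD2l -opprD lerN2 -mulrDl ler_wpM2r ?invr_ge0//.
rewrite -natr1 sqrrD1 -addrA lerD2l mulr2n -addrA lerDl addr_ge0//.
Qed.

(** The term of degree [l] of [(1 + A / k) ^ k] is that of the exponential series
  times a factor within [l ^ 2 / k] of 1. *)
Lemma cvg_expm_euler A i j :
  ((1%:M + k%:R^-1 *: A) ^+ k) i j @[k --> \oo] --> expm A i j.
Proof.
have cS : series (ec A i j) k.+1 @[k --> \oo] --> expm A i j.
  by rewrite cvg_shiftS; exact: cvg_expm.
rewrite -[expm A i j]addr0.
have -> : (fun k => ((1%:M + k%:R^-1 *: A) ^+ k) i j) = (fun k =>
    series (ec A i j) k.+1 + (((1%:M + k%:R^-1 *: A) ^+ k) i j - series (ec A i j) k.+1)).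
  by apply/funext => k; rewrite addrCA subrr addr0.
apply: cvgD cS _; apply/cvgr0Pnorm_le => e e0; near=> k.
have k0 : (0 < k)%N by near: k; exact: nbhs_infty_gt.
have k0' : 0 < k%:R :> R by rewrite ltr0n.
rewrite -normrN opprB exprDn_comm; last exact: commr_sym (commr1 _).
rewrite summxE /series/= big_mkord -sumrB (le_trans (ler_norm_sum _ _ _))//.
rewrite (@le_trans _ _ (\sum_(l < k.+1) k%:R^-1 * exp_coeff (4 * c A) l))//.
  apply: ler_sum => l _.
  have -> : ec A i j l - ((1 ^+ (k - l) * (k%:R^-1 *: A) ^+ l) *+ 'C(k, l)) i j =
      (1 - (k ^_ l)%:R / k%:R ^+ l) * ec A i j l.
    rewrite expr1n mul1r mx_exprZ -scaler_nat scalerA mxE mulrBl mul1r; congr (_ - _).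
    rewrite -bin_ffact natrM /ec exprVn; field.
    by rewrite expf_neq0 ?lt0r_neq0//= pnatr_eq0 -lt0n fact_gt0.
  have := ffact_ratio_ge l k0; set r := (k ^_ l)%:R / _ => hr.
  have r1 : r <= 1 by exact: ffact_ratio_le1.
  rewrite normrM ger0_norm ?subr_ge0// (@le_trans _ _ ((l%:R ^+ 2 / k%:R) * exp_coeff (c A) l))//.
    by rewrite ler_pM ?subr_ge0//; [rewrite lerBlDr -lerBlDl|exact: ec_le].
  rewrite mulrAC [leRHS]mulrC ler_wpM2r ?invr_ge0//.
  rewrite /exp_coeff/= [(4 * c A) ^+ l]exprMn !mulrA ler_wpM2r ?invr_ge0// ler_wpM2r ?exprn_ge0 ?mulr_ge0//.
  by rewrite -!natrX ler_nat (_ : 4 = 2 ^ 2)%N// -expnM mulnC expnM leq_exp2r// ltnW// ltn_expl.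
rewrite -mulr_sumr.
rewrite (@le_trans _ _ (k%:R^-1 * expR (4 * c A)))// ?ler_wpM2l ?invr_ge0//.
  have := @series_exp_coeff_le (4 * c A) k.+1; rewrite /series/= big_mkord; apply.
  by rewrite !mulr_ge0.
rewrite ler_pdivrMl// -ler_pdivrMr//; near: k; exact: nbhs_infty_ger.
Unshelve. all: by end_near. Qed.

(** The determinant is [h ^ n * p(1 / h)] where [p] is the characteristic polynomial
  of [- A]; [p] is monic and its next coefficient, a trace, vanishes. *)
Lemma det_near1 A : \tr A = 0 ->
  exists2 K : R, 0 <= K & forall h : R, 0 < h <= 1 ->
    `|\det (1%:M + h *: A) - 1| <= K * h ^+ 2.
Proof.
move=> trA; pose p := char_poly (- A).
exists (\sum_(0 <= i < n.-1) `|p`_i|) => [|h /andP[h0 h1]]; first exact: sumr_ge0.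
have -> : \det (1%:M + h *: A) = h ^+ n * p.[h^-1].
  have -> : p.[h^-1] = \det (h^-1%:M + A).
    rewrite horner_sum; apply: eq_bigr => s _.
    rewrite hornerM horner_exp !hornerE; congr (_ * _).
    rewrite (big_morph _ (fun p q => hornerM p q h^-1) (hornerC 1 h^-1)).
    by apply: eq_bigr => i _; rewrite !mxE !(hornerE, hornerMn) opprK.
  by rewrite -detZ scalerDr scale_scalar_mx mulfV ?lt0r_neq0.
have last_term (m : nat) (F : nat -> R) : (0 < m)%N ->
    \sum_(0 <= i < m) F i = \sum_(0 <= i < m.-1) F i + F m.-1.
  by move=> m0; rewrite -[in LHS](prednK m0) big_nat_recr.
rewrite horner_coef size_char_poly mulr_sumr -(big_mkord xpredT (fun i => h ^+ n * (p`_i * h^-1 ^+ i))).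
have p_n : p`_n = 1 by have /monicP := char_poly_monic (- A); rewrite lead_coefE size_char_poly.
have [n0|n0] := posnP n.
  rewrite last_term//= p_n big_geq ?n0// add0r.
  by rewrite !expr0 !mul1r subrr normr0 mulr_ge0 ?sumr_ge0 ?sqr_ge0.
rewrite last_term// last_term//= char_poly_trace// linearN/= trA oppr0 oppr0 mul0r mulr0 addr0.
rewrite p_n mul1r -exprMn mulfV ?lt0r_neq0// expr1n addrK.
rewrite (le_trans (ler_norm_sum _ _ _))// mulr_suml big_nat_cond [leRHS]big_nat_cond.
apply: ler_sum => i /andP[/andP[_ ilt] _].
rewrite mulrCA normrM ler_wpM2l// -(subnK (ltnW (leq_trans ilt (leq_pred n)))).
rewrite exprD -mulrA exprVn mulfV ?expf_neq0 ?lt0r_neq0// mulr1.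
rewrite ger0_norm ?exprn_ge0 ?(ltW h0)// -(@subnK 2 (n - i)) ?exprD; last by lia.
have h0' := ltW h0; by rewrite ler_piMl ?exprn_ge0// exprn_ile1.
Qed.

Lemma cvg_prodr (T : Type) (F : set_system T) {FF : Filter F}
    (I : Type) (r : seq I) (f : I -> T -> R) (l : I -> R) :
  (forall i, f i t @[t --> F] --> l i) ->
  (\prod_(i <- r) f i t) @[t --> F] --> \prod_(i <- r) l i.
Proof.
move=> fl; elim: r => [|i r IH].
  by rewrite big_nil; under eq_fun do rewrite big_nil; exact: cvg_cst.
by rewrite big_cons; under eq_fun do rewrite big_cons; exact: cvgM.
Qed.

(** [\det (1 + A / k)] is [1 + O(k ^ -2)] when the trace vanishes, so that its
  [k]-th power tends to 1; but it also tends to the determinant of [expm A]. *)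
Lemma det_expm A : \tr A = 0 -> \det (expm A) = 1.
Proof.
move=> /det_near1[K K0 hK].
pose E k := (1%:M + k%:R^-1 *: A) ^+ k.
have l1 : \det (E k) @[k --> \oo] --> \det (expm A).
  apply: cvg_sumr => s; apply: cvgM; first exact: cvg_cst.
  by apply: cvg_prodr => i; exact: cvg_expm_euler.
suff l2 : \det (E k) @[k --> \oo] --> (1 : R) by exact: cvg_unique l1 l2.
have detX (M : 'M[R]_n) k : \det (M ^+ k) = \det M ^+ k.
  by elim: k => [|k IH]; rewrite ?expr0 ?det1// !exprS -mulmxE det_mulmx IH.
apply/cvgrPdist_le => e e0; near=> k.
have k0 : (0 < k)%N by near: k; exact: nbhs_infty_gt.
have k0' : 0 < k%:R :> R by rewrite ltr0n.
rewrite /E detX; set x := \det _.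
have xk : `|x - 1| <= K * k%:R^-1 ^+ 2.
  by apply: hK; rewrite invr_gt0 k0' invf_le1// ler1n.
have x1 : `|x| <= 1 + K * k%:R^-1.
  have -> : x = (x - 1) + 1 by rewrite subrK.
  rewrite (le_trans (ler_normD _ _))// normr1 addrC lerD2l (le_trans xk)//.
  by rewrite ler_wpM2l// expr2 ler_piMl ?invr_ge0// invf_le1// ler1n.
have bk l : (l <= k)%N -> `|x| ^+ l <= expR K.
  move=> lk; rewrite (@le_trans _ _ (expR (K / k%:R) ^+ l))//.
    by rewrite lerXn2r ?nnegrE ?expR_ge0// (le_trans x1)// expR_ge1Dx.
  rewrite -expRM_natl ler_expR mulrCA ler_piMr//.
  by rewrite ler_pdivrMr// mul1r ler_nat.
rewrite distrC subrX1 normrM (@le_trans _ _ ((K * k%:R^-1 ^+ 2) * (k%:R * expR K)))//.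
  apply: ler_pM => //; rewrite (le_trans (ler_norm_sum _ _ _))//.
  rewrite (@le_trans _ _ (\sum_(i < k) expR K))//.
    by apply: ler_sum => i _; rewrite normrX bk// ltnW.
  by rewrite sumr_const card_ord mulr_natl.
rewrite expr2 -mulrA [X in _ * X]mulrA mulrVK ?unitfE ?lt0r_neq0//.
rewrite [_^-1 * _]mulrC mulrA ler_pdivrMr// -ler_pdivrMl//.
near: k; exact: nbhs_infty_ger.
Unshelve. all: by end_near. Qed.

End Expm.

(** * Smooth functions on the homogeneous space *)

Section Smooth.
Variables (R : realType) (n : nat) (Gamma : groupClosed (SL R n)).
Implicit Types (f : hspace Gamma -> R) (x : hspace Gamma) (g h : SL R n).

Definition tangent_to (e : R -> SL R n) (Y : 'M[R]_n) :=
  e 0 = SL1 R n /\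
  (t^-1 *: (SLval (e t) - 1%:M)) @[t --> (0 : R)^'] --> Y.

Lemma ract1 x : ract x (SL1 R n) = x.
Proof.
rewrite -[x]reprK ractE; congr (\pi_(hspace Gamma) _).
by apply: val_inj; rewrite /= mulmx1.
Qed.

Lemma ractM x g h : ract (ract x g) h = ract x (g * h)%g.
Proof.
have -> : x = \pi_(hspace Gamma) (repr x) by rewrite reprK.
by rewrite !ractE mulgA.
Qed.

(** The derivative along [e] at 0 depends on [e] through [Y] only. This lets the
  matrix [1 + t Y] of the horospherical flow stand for the exponential in the Lie
  derivatives. *)
Lemma is_derive_curve f (U : set 'M[R]_n) (F : 'M[R]_n -> R) e Y h :
  open U -> smooth_on U F ->
  (forall g, U (SLval g) -> f (\pi_(hspace Gamma) g) = F (SLval g)) ->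
  tangent_to e Y -> U (SLval h) ->
  is_derive (0 : R) 1 (fun t => f (ract (\pi_(hspace Gamma) h) (e t)))
    ('D_(SLval h *m Y) F (SLval h)).
Proof.
move=> oU /(smooth_onP U F) sF fF [e0 eY] Uh.
pose w (t : R) := SLval h *m (t^-1 *: (SLval (e t) - 1%:M)).
have wY : w t @[t --> 0^'] --> SLval h *m Y.
  apply/cvg_mxP => i j; rewrite mxE.
  under eq_fun do rewrite mxE.
  apply: cvg_sumr => k; apply: cvgM; first exact: cvg_cst.
  exact: (cvg_mxP _ _).2 eY k j.
have we (t : R) : t != 0 -> t *: w t + SLval h = SLval (h * e t)%g.
  move=> t0; rewrite /w -scalemxAr scalerA mulfV// scale1r mulmxBr mulmx1.
  by rewrite subrK.
have lim := derive_curve oU (sF 1%N) Uh wY.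
suff H : (fun t => t^-1 *: (((fun t => f (ract (\pi_(hspace Gamma) h) (e t))) \o
    shift 0) (t *: 1) - f (ract (\pi_(hspace Gamma) h) (e 0)))) @ 0^' -->
    'D_(SLval h *m Y) F (SLval h).
  by apply: DeriveDef; [apply/cvg_ex; eexists; exact: H|exact: cvg_lim H].
have twh : (fun t : R => t *: w t + SLval h) @ 0^' --> SLval h.
  have h0 : (fun t : R => t) @ 0^' --> (0 : R) by exact: cvg_within.
  have : (fun t : R => t *: w t + SLval h) @ 0^' --> 0 *: (SLval h *m Y) + SLval h.
    by apply: cvgD; [exact: cvgZ h0 wY|exact: cvg_cst].
  by rewrite scale0r add0r.
have nU : \forall t \near (0 : R)^', U (t *: w t + SLval h).
  by apply: twh; exact: open_nbhs_nbhs (conj oU Uh).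
apply: cvg_trans lim; apply: near_eq_cvg; near=> t.
have t0 : t != 0 by near: t; exact: nbhs_dnbhs_neq.
rewrite /= addr0 [t%:A]mulr1 e0 ract1 ractE (fF h Uh).
have Uw : U (t *: w t + SLval h) by near: t; exact: nU.
by rewrite (we t t0) in Uw *; rewrite (fF _ Uw).
Unshelve. all: by end_near. Qed.

Lemma SLval_SLexp (Y : 'M[R]_n) : \tr Y = 0 -> SLval (SLexp Y) = expm Y.
Proof. by move=> trY; rewrite /SLexp -[LHS]/(val _) val_insubd det_expm// eqxx. Qed.

Lemma tangent_SLexp (Y : 'M[R]_n) : \tr Y = 0 -> tangent_to (fun t => SLexp (t *: Y)) Y.
Proof.
move=> trY; have trtY (t : R) : \tr (t *: Y) = 0 by rewrite linearZ/= trY mulr0.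
split; last first.
  by under eq_fun do rewrite SLval_SLexp//; exact: cvg_expm_dir.
apply: val_inj; rewrite /= SLval_SLexp// scale0r.
have [K K0 hK] := expm_approx1 (0 : 'M[R]_n).
apply/matrixP => i j; have := hK 0; rewrite normr0 scale0r addr0 expr0n/= mulr0.
by move=> /(_ ler01 i j); rewrite normr_le0 subr_eq0 => /eqP.
Qed.

(** In a chart, a Lie derivative is a first order operator whose coefficients are
  linear in the entries of the matrix. *)
Lemma smooth_lie_derive f Y : \tr Y = 0 -> smooth f -> smooth (lie_derive Y f).
Proof.
move=> trY sf g; have [U [F [oU Ug sF fF]]] := sf g.
pose G (M : 'M[R]_n) := \sum_i \sum_j (M *m Y) i j * 'D_(delta_mx i j) F M.
exists U, G; split=> //; last first.
  move=> h Uh; rewrite /lie_derive derive1E.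
  have [_ ->] := is_derive_curve oU sF fF (tangent_SLexp trY) Uh.
  by rewrite (derive_dir_mx oU) //; exact: (smooth_onP U F).1 sF 1%N.
apply/smooth_onP => k.
have -> : G = \sum_i \sum_j (\sum_l (fun M : 'M[R]_n => M i l) * cst (Y l j)) *
    'D_(delta_mx i j) F.
  apply/funext => M; rewrite fct_sumE; apply: eq_bigr => i _.
  rewrite fct_sumE; apply: eq_bigr => j _; rewrite mulrfctE; congr (_ * _).
  by rewrite fct_sumE mxE.
apply: Ck_sum => // i; apply: Ck_sum => // j; apply: CkM => //.
  apply: Ck_sum => // l; apply: CkM => //; [exact: Ck_coord|exact: Ck_cst].
by have [_] := (smooth_onP U F).1 sF k.+1; apply.
Qed.

Lemma smooth_lie_monomial f (w : seq 'M[R]_n) :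
  (forall Y, Y \in w -> \tr Y = 0) -> smooth f -> smooth (lie_monomial w f).
Proof.
elim: w => //= Y w IH trw sf; apply: smooth_lie_derive.
  by apply: trw; rewrite mem_head.
by apply: IH => // Z Zw; apply: trw; rewrite inE Zw orbT.
Qed.

Lemma smooth_continuous f : smooth f -> continuous f.
Proof.
move=> sf; apply/(@quotient_continuous _ {eq_quot coset_equiv Gamma}).
move=> g; have [U [F [oU Ug sF fF]]] := sf g.
have cv : continuous (@SLval R n) by exact: initial_continuous.
have cF : {for SLval g, continuous F} by exact: (smooth_onP U F).1 sF 0%N _ Ug.
have nU : \forall h \near g, U (SLval h).
  by apply: cv; exact: open_nbhs_nbhs (conj oU Ug).
rewrite /continuous_at /= fF//.
have lim : F (SLval h) @[h --> g] --> F (SLval g) by exact: cvg_comp (cv g) cF.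
apply: cvg_trans lim; apply: (@near_eq_cvg _ _ _ (nbhs_filter g)).
by move: nU; apply: (@filterS _ _ (nbhs_filter g)) => h Uh /=; rewrite fF.
Qed.

Hypothesis cX : compact [set: hspace Gamma].

Lemma smooth_bounded f : smooth f -> exists2 M : R, 0 < M & forall x, `|f x| <= M.
Proof.
move=> /smooth_continuous cf.
have /compact_bounded : compact (f @` [set: hspace Gamma]).
  by apply: continuous_compact => //; exact: continuous_subspaceT.
move=> [M [_ hM]]; exists (`|M| + 1); first by rewrite ltr_wpDl.
move=> x; apply: (hM (`|M| + 1)); last by exists x.
by rewrite (le_lt_trans (ler_norm M))// ltrDl.
Qed.

Lemma Lnorm_pinfty_le (mX : probability (borel_hspace Gamma) R)
    (f : hspace Gamma -> R) (M : R) :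
  0 <= M -> (forall x, `|f x| <= M) -> ('N[mX]_+oo[EFin \o f] <= M%:E)%E.
Proof.
move=> M0 fM; rewrite unlock; case: ifPn => // _.
by apply/ess_supP; apply: nearW => x /=; rewrite lee_fin.
Qed.

Lemma sobolev_norm_fin (mX : probability (borel_hspace Gamma) R)
    (B : seq 'M[R]_n) l f : (forall Y, Y \in B -> \tr Y = 0) -> smooth f ->
  exists2 S : R, 0 <= S & (sobolev_norm mX B l f <= S%:E)%E.
Proof.
move=> trB sf; pose P (x : \bar R) := exists2 S : R, 0 <= S & (x <= S%:E)%E.
have P0 : P 0%E by exists 0.
have PD (a c : \bar R) : P a -> P c -> P (a + c)%E.
  move=> [S S0 aS] [S' S'0 cS]; exists (S + S'); first exact: addr_ge0.
  by rewrite EFinD leeD.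
rewrite -/(P _) /sobolev_norm; apply: (big_ind P) => // k _.
apply: (big_ind P) => // w _.
have /smooth_bounded[M M0 hM] :
    smooth (lie_monomial [seq B`_(i : 'I_(size B)) | i <- w] f).
  apply: smooth_lie_monomial => // Y /mapP[i _ ->].
  by apply: trB; exact: mem_nth.
by exists M; [exact: ltW|exact: Lnorm_pinfty_le (ltW M0) hM].
Qed.

(** The one-parameter group law brings the derivative at time [t] back to time 0,
  at another base point. *)
Lemma is_derive_flow f (e : R -> SL R n) Y x (t : R) :
  \tr Y = 0 -> smooth f -> tangent_to e Y ->
  (forall s t, e (s + t) = (e s * e t)%g) ->
  is_derive t 1 (fun s : R => f (ract x (e s))) (lie_derive Y f (ract x (e t))).
Proof.
move=> trY sf eY eD; set y := ract x (e t).
have [U [F [oU Uy sF fF]]] := sf (repr y).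
have := is_derive_curve oU sF fF eY Uy.
have [_ E] := is_derive_curve oU sF fF (tangent_SLexp trY) Uy.
rewrite /lie_derive derive1E -E !reprK => -[dF vF].
have G : (fun h : R => h^-1 *: (((fun s : R => f (ract x (e s))) \o shift t) (h *: 1)
       - f (ract x (e t)))) =
    (fun h : R => h^-1 *: (((fun s : R => f (ract y (e s))) \o shift 0) (h *: 1)
       - f (ract y (e 0)))).
  apply/funext => h; rewrite /= addr0 [h%:A]mulr1 [h + t]addrC eD -ractM -/y.
  by case: eY => -> _; rewrite ract1.
apply: DeriveDef; first by rewrite /derivable G.
by rewrite -vF /derive G.
Qed.

(** The constant is the supremum of the Lie derivative along [Y], which is finite
  by compactness. *)
Lemma smooth_lipschitz f Y : \tr Y = 0 -> smooth f ->
  exists2 L : R, 0 < L & forall (e : R -> SL R n) x (s t : R), tangent_to e Y ->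
    (forall s t, e (s + t) = (e s * e t)%g) ->
    `|f (ract x (e s)) - f (ract x (e t))| <= L * `|s - t|.
Proof.
move=> trY sf; have [L L0 hL] := smooth_bounded (smooth_lie_derive trY sf).
exists L => // e x s t eY eD.
wlog st : s t / s <= t => [H|].
  by have [/H//|/ltW/H] := leP s t; rewrite distrC (distrC s t).
have d (r : R) := is_derive_flow x r trY sf eY eD.
have [|c _ E] := @MVT_segment R (fun s : R => f (ract x (e s)))
    (fun s : R => lie_derive Y f (ract x (e s))) s t st.
- by apply: derivable_within_continuous => r _; case: (d r).
- by rewrite distrC (distrC s t) E normrM ler_wpM2r.
Qed.

End Smooth.

(** * Positivity of the space average *)

Section Positivity.
Variables (R : realType) (n : nat) (Gamma : groupClosed (SL R n)).
Variable mX : probability (borel_hspace Gamma) R.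
Hypothesis cX : compact [set: hspace Gamma].
Hypothesis invX : right_invariant mX.
Implicit Types (f : hspace Gamma -> R) (x : hspace Gamma) (g h : SL R n).

Lemma ract_continuous g : continuous (fun x : hspace Gamma => ract x g).
Proof.
apply/(@quotient_continuous _ {eq_quot coset_equiv Gamma}).
have -> : (fun x : hspace Gamma => ract x g) \o \pi_(hspace Gamma) =
    \pi_(hspace Gamma) \o (fun h => h * g)%g.
  by apply/funext => h; rewrite /= ractE.
have cmul : continuous (fun h : SL R n => (h * g)%g : SL R n).
  have cv : continuous (@SLval R n) by exact: initial_continuous.
  have cm : continuous (fun M : 'M[R]_n => M *m SLval g).
    move=> M; apply/(@cvg_mxP _ _ _ (nbhs_filter M)) => i j; under eq_fun do rewrite mxE; rewrite mxE.
    apply: (@cvg_sumr _ _ _ (nbhs_filter M)) => k.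
    by apply: cvgM; [exact: coord_continuous|exact: cvg_cst].
  by apply: continuous_comp_initial => h; exact: cvg_comp (cv h) (cm _).
move=> h; apply: cvg_comp (cmul h) _.
exact: (@pi_continuous _ {eq_quot coset_equiv Gamma}).
Qed.

Lemma ract_transitive x y : exists g, ract x g = y.
Proof.
have [h ->] : exists h, x = \pi_(hspace Gamma) h by exists (repr x); rewrite reprK.
have [k ->] : exists k, y = \pi_(hspace Gamma) k by exists (repr y); rewrite reprK.
by exists (h^-1 * k)%g; rewrite ractE mulVKg.
Qed.

Lemma open_measurable_hspace (U : set (hspace Gamma)) :
  open U -> measurable (U : set (borel_hspace Gamma)).
Proof. by move=> oU; exact: sub_sigma_algebra. Qed.

(** Finitely many translates of a nonempty open set cover the compact space, and
  they all have the same measure. *)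
Lemma open_measure_gt0 (U : set (hspace Gamma)) x :
  open U -> U x -> (0 < mX U)%E.
Proof.
move=> oU Ux; rewrite lt0e measure_ge0 andbT; apply/negP => /eqP U0.
pose V g := [set y : hspace Gamma | U (ract y g)].
have oV g : open (V g) by have /continuousP := @ract_continuous g; apply.
have := cX; rewrite compact_cover => /(_ _ setT V) [|y _|D _ cov] //.
  by have [g yg] := ract_transitive y x; exists g => //; rewrite /V/= yg.
have VU g : mX (V g) = 0%E by rewrite -[RHS]U0; apply: invX; exact: open_measurable_hspace.
have : (mX [set: hspace Gamma] <= \sum_(g \in [set` D]) mX (V g))%E.
  apply: (@content_sub_fsum _ _ _ mX _ [set` D] setT V) => //.
  by move=> g _; exact: open_measurable_hspace.
rewrite probability_setT fsbig1//.
by rewrite lee_fin ler10.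
Qed.

Lemma smooth_measurable f : smooth f ->
  measurable_fun [set: borel_hspace Gamma] (f : borel_hspace Gamma -> R).
Proof.
move=> /smooth_continuous cf.
apply: (measurability _ (measurable_realfun.RGenOpens.measurableE R)).
move=> _ [_ [a [c ->] <-]]; rewrite setTI; apply: open_measurable_hspace.
by move/continuousP : cf; apply; exact: interval_open.
Qed.

Lemma space_avg_ge0 f : (forall x, 0 <= f x) -> 0 <= space_avg mX f.
Proof. by move=> f0; apply: fine_ge0; apply: integral_ge0 => x _; rewrite lee_fin. Qed.

Lemma space_avg_gt0 f x : smooth f -> (forall x, 0 <= f x) -> 0 < f x ->
  0 < space_avg mX f.
Proof.
move=> sf f0 fx; pose U := [set y : hspace Gamma | f x / 2 < f y].
have oU : open U.
  rewrite (_ : U = f @^-1` [set r | f x / 2 < r]); last by [].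
  by have /continuousP := smooth_continuous sf; apply; exact: open_gt.
have mU := open_measurable_hspace oU.
have Ux : U x by rewrite /U/=; lra.
have mf : @measurable_fun _ _ (borel_hspace Gamma) (\bar R) setT
    (fun y => (f y)%:E).
  by apply/measurable_EFinP; exact: smooth_measurable.
have [M M0 hM] := smooth_bounded cX sf.
have f0' y : (0 <= (f y)%:E)%E by rewrite lee_fin.
have intU : (((f x / 2)%:E * mX U)%E <= \int[mX]_y (f y)%:E)%E.
  rewrite -(integral_cst mX (D := U))//.
  apply: (@le_trans _ _ (\int[mX]_(y in U) (f y)%:E)%E); last first.
    exact: ge0_subset_integral.
  apply: ge0_le_integral => //.
  - by move=> y _; rewrite lee_fin divr_ge0// ltW.
  - exact: measurable_funTS.
  - by move=> y Uy; rewrite lee_fin ltW.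
have intM : (\int[mX]_y (f y)%:E <= M%:E)%E.
  apply: (@le_trans _ _ (\int[mX]_y (cst M%:E y))%E).
    apply: ge0_le_integral => //.
    by move=> y _; rewrite lee_fin (le_trans (ler_norm _)).
  by rewrite integral_cst//= probability_setT mule1.
apply: fine_gt0; rewrite (le_lt_trans intM) ?ltry// andbT.
apply: lt_le_trans intU; rewrite mule_gt0// ?lte_fin ?divr_gt0//.
exact: open_measure_gt0 oU Ux.
Qed.

End Positivity.

(** * Integrals of continuous functions over intervals *)

Section Interval.
Variable R : realType.
Implicit Types (f g F : R -> R) (a b c : R).

Notation I a b g := (\int[lebesgue_measure]_(s in `[a, b]) g s).

Lemma cint_integrable a b g : continuous g ->
  (@lebesgue_measure R).-integrable `[a, b] (EFin \o g).
Proof.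
move=> cg; apply: continuous_compact_integrable; first exact: segment_compact.
exact: continuous_subspaceT.
Qed.

Lemma cintD a b f g : continuous f -> continuous g ->
  I a b (fun s => f s + g s) = I a b f + I a b g.
Proof. by move=> cf cg; rewrite RintegralD//; exact: cint_integrable. Qed.

Lemma cintB a b f g : continuous f -> continuous g ->
  I a b (fun s => f s - g s) = I a b f - I a b g.
Proof. by move=> cf cg; rewrite RintegralB//; exact: cint_integrable. Qed.

Lemma cintZ a b r g : continuous g -> I a b (fun s => r * g s) = r * I a b g.
Proof. by move=> cg; rewrite RintegralZl//; exact: cint_integrable. Qed.

Lemma cint_le a b f g : continuous f -> continuous g ->
  (forall s, a <= s <= b -> f s <= g s) -> I a b f <= I a b g.
Proof.
by move=> cf cg fg; apply: le_Rintegral => //; exact: cint_integrable.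
Qed.

Lemma cint_cst a b r : a <= b -> I a b (fun _ => r) = r * (b - a).
Proof.
move=> ab; rewrite Rintegral_cst//= lebesgue_measure_itv/= lte_fin.
by case: ltP => // ba; rewrite (le_anti (introT andP (conj ab ba))) subrr.
Qed.

Lemma cint_norm_le a b f g : continuous f -> continuous g ->
  (forall s, a <= s <= b -> `|f s| <= g s) -> `|I a b f| <= I a b g.
Proof.
move=> cf cg fg.
apply: le_trans.
  by apply: le_normr_Rintegral; [exact: measurable_itv|exact: cint_integrable].
by apply: cint_le => // s; apply: cvg_norm; exact: cf.
Qed.

Lemma cint_split a b c g : continuous g -> a <= b -> b <= c ->
  I a c g = I a b g + I b c g.
Proof.
move=> cg ab bc; have ig := @cint_integrable a c g cg.
have := @Rintegral_itvB R g (BLeft a) (BRight c) b ig.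
rewrite !bnd_simp => /(_ ab bc) E.
have -> : I b c g = \int[lebesgue_measure]_(s in `]b, c]) g s.
  rewrite -Rintegral_itv_obnd_cbnd//.
  apply: integrableS ig => // s; rewrite /= !in_itv/= => /andP[bs ->].
  by rewrite andbT (le_trans ab)// ltW.
by rewrite -E addrC subrK.
Qed.

Lemma cint_sum (J : Type) (r : seq J) a b (f : J -> R -> R) :
  (forall j, continuous (f j)) ->
  continuous (fun s => \sum_(j <- r) f j s) /\
  I a b (fun s => \sum_(j <- r) f j s) = \sum_(j <- r) I a b (f j).
Proof.
move=> cf; elim: r => [|j r [c IH]].
  split; first by under eq_fun do rewrite big_nil; move=> s; exact: cvg_cst.
  rewrite big_nil; under eq_Rintegral do rewrite big_nil.
  by rewrite /Rintegral integral0.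
have E : (fun s => \sum_(i <- j :: r) f i s) =
    (fun s => f j s + \sum_(i <- r) f i s).
  by apply/funext => s; rewrite big_cons.
rewrite E; split; first by move=> s; apply: cvgD; [exact: cf|exact: c].
by rewrite big_cons -IH -cintD.
Qed.

Lemma cint_FTC a b g (G : R -> R) : a <= b -> continuous g ->
  (forall x : R, is_derive x 1 G (g x)) -> I a b g = G b - G a.
Proof.
rewrite le_eqVlt => /predU1P[<- _ _|ab cg dG].
  by rewrite set_itv1 Rintegral_set1 subrr.
have cG : continuous G.
  by move=> x; apply/differentiable_continuous/derivable1_diffP; case: (dG x).
rewrite /Rintegral (@continuous_FTC2 _ g G)//.
- exact: continuous_subspaceT.
- split => [x _||].
  + by case: (dG x).
  + exact: cvg_at_right_filter (cG a).
  + exact: cvg_at_left_filter (cG b).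
- by move=> x _; rewrite derive1E; case: (dG x).
Qed.

Lemma cint_point a g : I a a g = 0.
Proof. by rewrite set_itv1 Rintegral_set1. Qed.

Lemma lipschitz_cont g (L : R) :
  (forall s t, `|g s - g t| <= L * `|s - t|) -> continuous g.
Proof.
move=> gL x; apply/cvgrPdist_le => e e0.
have L0 : 0 < `|L| + 1 by rewrite ltr_wpDl.
near=> t; rewrite (le_trans (gL x t))// (@le_trans _ _ ((`|L| + 1) * `|x - t|))//.
  by rewrite ler_wpM2r// (le_trans (ler_norm L))// lerDl.
rewrite -ler_pdivlMl//; near: t; apply: cvgr_dist_le; first exact: cvg_id.
by rewrite mulr_gt0// invr_gt0.
Unshelve. all: by end_near. Qed.

End Interval.

(** * A Jackson kernel of period q *)

Section Kernel.
Variable R : realType.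

Notation I a b g := (\int[lebesgue_measure]_(s in `[a, b]) g s).

Lemma continuous_cos_affine (a c : R) : continuous (fun t : R => cos (a * t + c)).
Proof.
move=> t; apply: (@continuous_comp _ _ _ (fun t : R => a * t + c) cos).
  by apply: cvgD; [apply: cvgM; [exact: cvg_cst|exact: cvg_id]|exact: cvg_cst].
exact: continuous_cos.
Qed.

(** A weak form of Jordan's inequality, from [sin z = 2 * sin (z / 2) * cos (z / 2)], the
  mean value theorem and [cos (pi / 4) ^+ 2 = 1 / 2]. *)
Lemma half_le_sin (z : R) : `|z| <= pi / 2 -> `|z| / 2 <= `|sin z|.
Proof.
wlog z0 : z / 0 <= z => [H|].
  have [/H//|/ltW z0] := leP 0 z.
  by have := H (- z); rewrite sinN !normrN; apply; rewrite oppr_ge0.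
rewrite (ger0_norm z0) => zpi; have p2 := @pi_ge2 R.
have cq : (cos (pi / 4) : R) ^+ 2 = 1 / 2.
  have := cos_mulr2n (pi / 4 : R).
  have -> : pi / 4 *+ 2 = pi / 2 :> R by rewrite mulr2n; lra.
  by rewrite cos_pihalf mulr2n; lra.
have z2 : 0 <= z / 2 <= pi / 4 by apply/andP; split; lra.
have cz (y : R) : 0 <= y <= pi / 4 -> cos (pi / 4) <= cos y.
  move=> /andP[y0 y1]; rewrite leNgt ltr_cos ?in_itv/=; first by rewrite -leNgt.
    by apply/andP; split; lra.
  by apply/andP; split; lra.
have cq0 : 0 <= cos (pi / 4) :> R.
  by apply: cos_ge0_pihalf; apply/andP; split; lra.
have sz : z / 2 * cos (pi / 4) <= sin (z / 2).
  have [||y yz E] := @MVT_segment R sin cos 0 (z / 2) _.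
  - by case/andP: z2.
  - by apply: continuous_subspaceT; exact: continuous_sin.
  move: E; rewrite sin0 !subr0 => ->; rewrite mulrC ler_wpM2r; first by [].
    by case/andP: z2.
  apply: cz; move: yz; rewrite in_itv/= => /andP[-> yz]; move: z2 => /andP[_]; lra.
have zz : sin z = cos (z / 2) * sin (z / 2) *+ 2.
  by rewrite -sin_mulr2n; congr sin; rewrite mulr2n; lra.
have /andP[z20 _] := z2.
have : cos (pi / 4) * (z / 2 * cos (pi / 4)) <= cos (z / 2) * sin (z / 2).
  by apply: ler_pM => //; [exact: mulr_ge0|exact: cz].
rewrite mulrCA -expr2 cq zz; set p := cos (z / 2) * _ => hz.
apply: le_trans (ler_norm _); rewrite [p *+ 2]mulr2n; lra.
Qed.

Variables (q h : nat).
Hypotheses (q0 : (0 < q)%N) (h0 : (0 < h)%N).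
Let M := h.*2.

(** The phase vanishes modulo [pi] at the midpoints [q * k + q / 2], so that every
  period [q * k, q * k + q] contains one whole peak of the kernel. *)
Definition kphase (t : R) : R := pi * (t - q%:R / 2) / q%:R.

(** The Fejer kernel, the square modulus of a geometric sum of [M] characters: see
  [fejerE]. *)
Definition fejer (t : R) : R :=
  \sum_(m < M) \sum_(l < M) cos (2 * (m%:R - l%:R) * kphase t).

Let q0' : 0 < q%:R :> R. Proof. by rewrite ltr0n. Qed.
Let h0' : 0 < h%:R :> R. Proof. by rewrite ltr0n. Qed.

Lemma kphaseE (c t : R) : c * kphase t = (c * pi / q%:R) * t + (- (c * pi / 2)).
Proof. by rewrite /kphase; field; rewrite ?lt0r_neq0. Qed.

Lemma fejerE t : fejer t =
  (\sum_(m < M) cos (2 * m%:R * kphase t)) ^+ 2 +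
  (\sum_(m < M) sin (2 * m%:R * kphase t)) ^+ 2.
Proof.
rewrite !expr2 !mulr_suml -big_split; apply: eq_bigr => m _ /=.
rewrite !mulr_sumr -big_split; apply: eq_bigr => l _ /=.
by rewrite mulrBr mulrBl cosB.
Qed.

Lemma fejer_ge0 t : 0 <= fejer t.
Proof. by rewrite fejerE addr_ge0 ?sqr_ge0. Qed.

(** Multiplied by [2 * sin x] the sums of cosines and sines telescope. *)
Lemma sin2_fejer_le1 t : sin (kphase t) ^+ 2 * fejer t <= 1.
Proof.
set x := kphase t; pose A := (2 * M%:R - 1) * x.
have sC (m : nat) : 2 * sin x * \sum_(i < m) cos (2 * i%:R * x) =
    sin ((2 * m%:R - 1) * x) + sin x.
  elim: m => [|m IH]; first by rewrite big_ord0 !mulr0 mulrBl mul0r mul1r sub0r sinN addNr.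
  rewrite big_ord_recr/= mulrDr IH -[m.+1%:R]natr1.
  rewrite (_ : (2 * (m%:R + 1) - 1) * x = 2 * m%:R * x + x); last by ring.
  rewrite (_ : (2 * m%:R - 1) * x = 2 * m%:R * x - x); last by ring.
  by rewrite sinB sinD; ring.
have sS (m : nat) : 2 * sin x * \sum_(i < m) sin (2 * i%:R * x) =
    cos x - cos ((2 * m%:R - 1) * x).
  elim: m => [|m IH]; first by rewrite big_ord0 !mulr0 mulrBl mul0r mul1r sub0r cosN subrr.
  rewrite big_ord_recr/= mulrDr IH -[m.+1%:R]natr1.
  rewrite (_ : (2 * (m%:R + 1) - 1) * x = 2 * m%:R * x + x); last by ring.
  rewrite (_ : (2 * m%:R - 1) * x = 2 * m%:R * x - x); last by ring.
  by rewrite cosB cosD; ring.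
have E : 4 * (sin x ^+ 2 * fejer t) = 2 - 2 * cos (A + x).
  transitivity ((2 * sin x * \sum_(i < M) cos (2 * i%:R * x)) ^+ 2 +
                (2 * sin x * \sum_(i < M) sin (2 * i%:R * x)) ^+ 2).
    by rewrite fejerE -/x; ring.
  rewrite sC sS -/A cosD.
  have := cos2Dsin2 A; have := cos2Dsin2 x; nra.
have := cos_geN1 (A + x); lra.
Qed.

Lemma fejer_continuous : continuous fejer.
Proof.
have c (m l : 'I_M) : continuous (fun t => cos (2 * (m%:R - l%:R) * kphase t)).
  by under eq_fun do rewrite kphaseE; exact: continuous_cos_affine.
have c1 (m : 'I_M) : continuous (fun t =>
    \sum_(l < M) cos (2 * (m%:R - l%:R) * kphase t)).
  exact: (cint_sum _ 0 0 (c m)).1.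
exact: (cint_sum _ 0 0 c1).1.
Qed.

(** Orthogonality of the characters over a period. *)
Lemma int_cos_period (a : R) (i j : nat) :
  I a (a + q%:R) (fun t => cos (2 * (i%:R - j%:R) * kphase t)) =
  q%:R * (i == j)%:R.
Proof.
wlog ji : i j / (j <= i)%N => [H|].
  have [/H//|ij] := leqP j i.
  have := H j i (ltnW ij); rewrite eq_sym => <-; apply: eq_Rintegral => t _.
  by rewrite -[in RHS]cosN; congr cos; ring.
have aq : a <= a + q%:R by rewrite lerDl ltW.
have [->|ij] := eqVneq i j.
  rewrite (_ : (fun t => _) = cst 1) ?cint_cst//; last first.
    by apply/funext => t; rewrite subrr mulr0 mul0r cos0.
  by rewrite mul1r mulr1 addrAC subrr add0r.
rewrite mulr0; pose k := (i - j)%N.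
have k0 : (0 < k)%N by rewrite subn_gt0 ltn_neqAle eq_sym ij ji.
have k0' : 0 < k%:R :> R by rewrite ltr0n.
have kE : i%:R - j%:R = k%:R :> R by rewrite -natrB.
pose w : R := 2 * k%:R * pi / q%:R.
have w0 : w != 0 by rewrite lt0r_neq0// !mulr_gt0// ?invr_gt0// pi_gt0.
pose G (t : R) := w^-1 * sin (w * t + (- (2 * k%:R * pi / 2))).
under eq_Rintegral do rewrite kE kphaseE -/w.
have dG (t : R) : is_derive t 1 G (cos (w * t + (- (2 * k%:R * pi / 2)))).
  have d1 : is_derive t 1 (fun t : R => w * t + (- (2 * k%:R * pi / 2))) w.
    have dz := is_deriveZ (f := id) w (is_derive_id t (1 : R)).
    have da := is_deriveD dz (is_derive_cst (- (2 * k%:R * pi / 2)) t (1 : R)).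
    by apply: (is_derive_eq da); rewrite addr0 [w *: 1]mulr1.
  have d2 := @is_derive1_comp R (@sin R) _ t _ _ (is_derive_sin _) d1.
  have d3 := is_deriveZ w^-1 d2.
  by apply: (is_derive_eq d3); rewrite /GRing.scale/= mulrC mulfK.
rewrite (cint_FTC aq (@continuous_cos_affine _ _) dG).
rewrite /G -mulrBr (_ : w * (a + q%:R) + _ =
    (w * a - 2 * k%:R * pi / 2) + (pi *+ 2) *+ k).
  by rewrite (periodicn (@sinD2pi R)) subrr mulr0.
rewrite /w -mulrnA -[(pi *+ _)]mulr_natr natrM; field; exact: lt0r_neq0.
Qed.

(** The number of solutions of [i + k = j + l], in the symmetric form that comes
  from the square of the kernel: a product of two cosines contributes both the
  sum and the difference of their frequencies. *)
Definition energy : R := 1/2 * \sum_(i < M) \sum_(j < M) \sum_(k < M) \sum_(l < M)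
  (((i + k == j + l)%N)%:R + ((i + l == j + k)%N)%:R).

Lemma int_fejer (a : R) : I a (a + q%:R) fejer = q%:R * M%:R.
Proof.
have c (m l : 'I_M) : continuous (fun t => cos (2 * (m%:R - l%:R) * kphase t)).
  by under eq_fun do rewrite kphaseE; exact: continuous_cos_affine.
have c1 (m : 'I_M) : continuous (fun t =>
    \sum_(l < M) cos (2 * (m%:R - l%:R) * kphase t)).
  exact: (cint_sum _ 0 0 (c m)).1.
rewrite (cint_sum _ _ _ c1).2 (eq_bigr (fun=> q%:R)); last first.
  move=> m _; rewrite (cint_sum _ _ _ (c m)).2 (bigD1 m)//= int_cos_period eqxx mulr1.
  rewrite big1 ?addr0// => l lm.
  by rewrite int_cos_period [(m == l :> nat)]eq_sym (negbTE lm : (l == m :> nat) = _) mulr0.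
by rewrite sumr_const card_ord mulr_natr.
Qed.

Lemma int_fejer2 (a : R) : I a (a + q%:R) (fun t => fejer t ^+ 2) = q%:R * energy.
Proof.
pose F (i j k l : 'I_M) (t : R) : R :=
  1/2 * (cos (2 * ((i + k)%N%:R - (j + l)%N%:R) * kphase t) +
         cos (2 * ((i + l)%N%:R - (j + k)%N%:R) * kphase t)).
have c0 (n m : nat) : continuous (fun t => cos (2 * (n%:R - m%:R) * kphase t)).
  by under eq_fun do rewrite kphaseE; exact: continuous_cos_affine.
have cp n m n' m' : continuous (fun t => cos (2 * (n%:R - m%:R) * kphase t) +
    cos (2 * (n'%:R - m'%:R) * kphase t)).
  by move=> t; apply: cvgD; exact: c0.
have c i j k l : continuous (F i j k l).
  by move=> t; apply: cvgM; [exact: cvg_cst|exact: cp].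
have c1 i j k := (cint_sum (index_enum 'I_M) a (a + q%:R) (c i j k)).1.
have c2 i j := (cint_sum (index_enum 'I_M) a (a + q%:R) (c1 i j)).1.
have c3 i := (cint_sum (index_enum 'I_M) a (a + q%:R) (c2 i)).1.
have -> : (fun t => fejer t ^+ 2) =
    (fun t => \sum_(i < M) \sum_(j < M) \sum_(k < M) \sum_(l < M) F i j k l t).
  apply/funext => t; rewrite expr2 [in LHS]/fejer mulr_suml; apply: eq_bigr => i _.
  rewrite mulr_suml; apply: eq_bigr => j _; rewrite mulr_sumr; apply: eq_bigr => k _.
  rewrite mulr_sumr; apply: eq_bigr => l _; rewrite /F !natrD.
  set x := kphase t.
  rewrite (_ : 2 * (i%:R + k%:R - (j%:R + l%:R)) * x =
    2 * (i%:R - j%:R) * x + 2 * (k%:R - l%:R) * x); last by ring.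
  rewrite (_ : 2 * (i%:R + l%:R - (j%:R + k%:R)) * x =
    2 * (i%:R - j%:R) * x - 2 * (k%:R - l%:R) * x); last by ring.
  by rewrite cosD cosB; field.
rewrite (cint_sum _ _ _ c3).2 /energy mulrA mulr_sumr; apply: eq_bigr => i _.
rewrite (cint_sum _ _ _ (c2 i)).2 mulr_sumr; apply: eq_bigr => j _.
rewrite (cint_sum _ _ _ (c1 i j)).2 mulr_sumr; apply: eq_bigr => k _.
rewrite (cint_sum _ _ _ (c i j k)).2 mulr_sumr; apply: eq_bigr => l _.
rewrite /F cintZ ?cintD//; rewrite !int_cos_period; ring.
Qed.

(** The solutions [(a + c) + b = a + (b + c)] with [a], [b], [c] below [h]. *)
Lemma energy_ge : h%:R ^+ 3 <= energy.
Proof.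
clear q0' q0.
pose A (i j k l : 'I_M) : R := ((i + k == j + l)%N)%:R.
have -> : energy = \sum_(i < M) \sum_(j < M) \sum_(k < M) \sum_(l < M) A i j k l.
  rewrite /energy mulr_sumr; apply: eq_bigr => i _; rewrite mulr_sumr.
  apply: eq_bigr => j _.
  under eq_bigr do rewrite big_split/=.
  by rewrite big_split/= [X in _ + X]exchange_big/= /A; field.
pose T := [set p : 'I_M * 'I_M * 'I_M * 'I_M |
  (p.1.1.1 + p.1.2 == p.1.1.2 + p.2)%N]%SET.
have -> : \sum_(i < M) \sum_(j < M) \sum_(k < M) \sum_(l < M) A i j k l = #|T|%:R.
  rewrite -sum1_card natr_sum !pair_big/= [RHS]big_mkcond/=.
  by apply: eq_bigr => -[[[i j] k] l] _; rewrite inE /A/=; case: eqP.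
rewrite -natrX ler_nat.
have lt1 (x z : 'I_h) : (x + z < M)%N.
  by have := ltn_ord x; have := ltn_ord z; rewrite /M; lia.
have lt0 (x : 'I_h) : (x < M)%N by have := ltn_ord x; rewrite /M; lia.
pose f (p : 'I_h * 'I_h * 'I_h) : 'I_M * 'I_M * 'I_M * 'I_M :=
  (Ordinal (lt1 p.1.1 p.2), Ordinal (lt0 p.1.1), Ordinal (lt0 p.1.2),
   Ordinal (lt1 p.1.2 p.2)).
have inj_f : injective f.
  move=> [[x y] z] [[x' y'] z'] [/= e1 e2 e3 e4].
  congr (_, _, _); apply: val_inj => //=; lia.
have -> : (h ^ 3 = #|f @: [set: 'I_h * 'I_h * 'I_h]%SET|)%N.
  by rewrite card_imset// cardsT !card_prod card_ord; lia.
apply: subset_leq_card; apply/fintype.subsetP => _ /imsetP[[[x y] z] _ ->].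
by rewrite inE /=; apply/eqP; lia.
Qed.

(** The square of the Fejer kernel, normalised to have mass 1 on a period. Squaring
  makes the mean distance to the peak of order [q / h]; for the Fejer kernel itself
  a logarithm would be lost. *)
Definition jackson (t : R) : R := fejer t ^+ 2 / (q%:R * energy).

Let en0 : 0 < energy. Proof. by apply: lt_le_trans energy_ge; rewrite exprn_gt0. Qed.
Let qe0 : 0 < q%:R * energy. Proof. exact: mulr_gt0. Qed.

Lemma jackson_ge0 t : 0 <= jackson t.
Proof. by rewrite /jackson divr_ge0 ?sqr_ge0// ltW. Qed.

Let fejer2_continuous : continuous (fun t => fejer t ^+ 2).
Proof.
by under eq_fun do rewrite expr2; move=> t; apply: cvgM; exact: fejer_continuous.
Qed.

Lemma jackson_continuous : continuous jackson.
Proof. by move=> t; apply: cvgM; [exact: fejer2_continuous|exact: cvg_cst]. Qed.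

Lemma int_jackson (a : R) : I a (a + q%:R) jackson = 1.
Proof.
rewrite /jackson; under eq_Rintegral do rewrite mulrC.
by rewrite cintZ// int_fejer2 mulVf// lt0r_neq0.
Qed.

(** The distance to the peak is at most [q * `|sin (kphase t)|], and one factor
  [fejer t] is traded for this sine by [sin2_fejer_le1]. *)
Lemma jackson_dist (k : nat) (t : R) :
  (q * k)%:R <= t <= (q * k)%:R + q%:R ->
  `|t - ((q * k)%:R + q%:R / 2)| * jackson t <=
    (fejer t ^+ 2 / (4 * h%:R) + h%:R * fejer t) / energy.
Proof.
move=> /andP[tl tr]; pose z : R := pi * (t - ((q * k)%:R + q%:R / 2)) / q%:R.
have p2 := @pi_ge2 R.
have pz : kphase t = z + pi *+ k.
  by rewrite /z /kphase -[pi *+ k]mulr_natr natrM; field; exact: lt0r_neq0.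
have sz : `|sin (kphase t)| = `|sin z|.
  rewrite pz; elim: (k) => [|k' IH]; first by rewrite mulr0n addr0.
  by rewrite mulrSr addrA sinDpi normrN.
have zE : `|z| = pi * `|t - ((q * k)%:R + q%:R / 2)| / q%:R.
  by rewrite /z !normrM (ger0_norm (pi_ge0 R)) normfV (ger0_norm (ltW q0')).
have hz : `|z| <= pi / 2.
  rewrite zE ler_pdivrMr// mulrAC -mulrA ler_wpM2l ?pi_ge0//.
  rewrite ler_distlC; apply/andP; split; lra.
have dist : `|t - ((q * k)%:R + q%:R / 2)| <= q%:R * `|sin (kphase t)|.
  rewrite sz -ler_pdivrMl// (le_trans _ (half_le_sin hz))// zE mulrC.
  rewrite [leRHS]mulrAC ler_wpM2r ?invr_ge0 ?ler0n//.
  rewrite mulrAC ler_peMl//; lra.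
have amgm : `|sin (kphase t)| * fejer t ^+ 2 <=
    fejer t ^+ 2 / (4 * h%:R) + h%:R * fejer t.
  have f0 := fejer_ge0 t; have := sin2_fejer_le1 t.
  rewrite -(real_normK (num_real (sin _))); set s := `|_| => sf.
  (* the weight [h] is the one that balances the two integrals below *)
  have s2 : s <= 1 / (4 * h%:R) + h%:R * s ^+ 2.
    rewrite -subr_ge0 (_ : _ - _ = (2 * h%:R * s - 1) ^+ 2 / (4 * h%:R)).
      by rewrite divr_ge0 ?sqr_ge0// mulr_ge0.
    by field; exact: lt0r_neq0.
  apply: (@le_trans _ _ ((1 / (4 * h%:R) + h%:R * s ^+ 2) * fejer t ^+ 2)).
    by rewrite ler_wpM2r ?sqr_ge0.
  rewrite mulrDl mul1r [_^-1 * _]mulrC lerD2l -mulrA ler_wpM2l//.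
  by rewrite expr2 mulrA ler_piMl.
set X := _ + h%:R * fejer t in amgm *.
rewrite /jackson mulrA ler_pdivrMr//.
rewrite [leRHS](_ : _ = q%:R * X); last by field; exact: lt0r_neq0.
apply: (@le_trans _ _ (q%:R * `|sin (kphase t)| * fejer t ^+ 2)).
  by rewrite ler_wpM2r ?sqr_ge0.
by rewrite -mulrA ler_wpM2l// ler0n.
Qed.

Lemma int_jackson_dist (k : nat) :
  I (q * k)%:R ((q * k)%:R + q%:R)
    (fun t => (fejer t ^+ 2 / (4 * h%:R) + h%:R * fejer t) / energy) <=
  3 * q%:R / h%:R.
Proof.
set a := (q * k)%:R.
have -> : (fun t => (fejer t ^+ 2 / (4 * h%:R) + h%:R * fejer t) / energy) =
  (fun t => (4 * h%:R * energy)^-1 * fejer t ^+ 2 + h%:R / energy * fejer t).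
  by apply/funext => t; field; rewrite !lt0r_neq0.
have cf := fejer_continuous.
have c1 : continuous (fun t => h%:R / energy * fejer t).
  by move=> t; apply: cvgM; [exact: cvg_cst|exact: cf].
have c2 : continuous (fun t => (4 * h%:R * energy)^-1 * fejer t ^+ 2).
  by move=> t; apply: cvgM; [exact: cvg_cst|exact: fejer2_continuous].
rewrite cintD// cintZ// cintZ// int_fejer2 int_fejer.
rewrite (_ : (4 * h%:R * energy)^-1 * _ = q%:R / h%:R * (1/4)); last first.
  by field; rewrite !lt0r_neq0.
rewrite (_ : h%:R / energy * _ = q%:R / h%:R * (2 * (h%:R ^+ 3 / energy))); last first.
  by rewrite /M -mul2n natrM; field; rewrite !lt0r_neq0.
rewrite -mulrDr -mulrA [leRHS]mulrC ler_wpM2l ?divr_ge0 ?ler0n//.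
have : h%:R ^+ 3 / energy <= 1 by rewrite ler_pdivrMr// mul1r energy_ge.
lra.
Qed.

Lemma jackson_period_sample (g : R -> R) (L : R) (k : nat) :
  (forall s t, `|g s - g t| <= L * `|s - t|) ->
  `|I (q * k)%:R ((q * k)%:R + q%:R) (fun t => g t * jackson t) -
    g ((q * k)%:R + q%:R / 2)| <= L * (3 * q%:R / h%:R).
Proof.
move=> gL; have cg := lipschitz_cont gL.
have L0 : 0 <= L.
  by have := le_trans (normr_ge0 _) (gL 1 0); rewrite subr0 normr1 mulr1.
set a := (q * k)%:R; set c := a + _ / 2.
have cgJ : continuous (fun t => g t * jackson t).
  by move=> t; apply: cvgM; [exact: cg|exact: jackson_continuous].
have ccJ : continuous (fun t => g c * jackson t).
  by move=> t; apply: cvgM; [exact: cvg_cst|exact: jackson_continuous].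
have gc : g c = I a (a + q%:R) (fun t => g c * jackson t).
  by rewrite cintZ ?int_jackson ?mulr1//; exact: jackson_continuous.
rewrite [X in _ - X]gc -cintB//.
pose bnd t := (fejer t ^+ 2 / (4 * h%:R) + h%:R * fejer t) / energy.
have cbnd : continuous bnd.
  move=> t; apply: cvgM; last exact: cvg_cst.
  apply: cvgD; first by apply: cvgM; [exact: fejer2_continuous|exact: cvg_cst].
  by apply: cvgM; [exact: cvg_cst|exact: fejer_continuous].
apply: (@le_trans _ _ (I a (a + q%:R) (fun t => L * bnd t))).
  apply: cint_norm_le.
  - by move=> t; apply: cvgB; [exact: cgJ|exact: ccJ].
  - by move=> t; apply: cvgM; [exact: cvg_cst|exact: cbnd].
  - move=> t ht; rewrite -mulrBl normrM (ger0_norm (jackson_ge0 t)).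
    apply: (@le_trans _ _ (L * (`|t - c| * jackson t))).
      by rewrite [leRHS]mulrA ler_wpM2r// jackson_ge0.
    by rewrite ler_wpM2l//; exact: jackson_dist ht.
by rewrite cintZ// ler_wpM2l//; exact: int_jackson_dist.
Qed.

Lemma int_jackson_periods (K : nat) : I 0 (q * K)%:R jackson = K%:R.
Proof.
have cJ := jackson_continuous.
elim: K => [|K IH]; first by rewrite muln0 cint_point.
rewrite mulnS addnC natrD (@cint_split _ 0 (q * K)%:R)//.
  by rewrite IH int_jackson natr1.
by rewrite lerDl ler0n.
Qed.

Lemma int_jackson_le (T : R) : 0 <= T -> I 0 T jackson <= T / q%:R + 1.
Proof.
move=> T0; set K := Num.truncn (T / q%:R).
have Tq0 : 0 <= T / q%:R by rewrite divr_ge0.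
have /andP[K1 K2] := truncn_itv Tq0.
have cJ := jackson_continuous.
have TK : T <= (q * K.+1)%:R by rewrite natrM mulrC -ler_pdivrMr// ltW.
apply: (@le_trans _ _ K.+1%:R); last by rewrite -natr1 lerD2r.
rewrite -(int_jackson_periods K.+1) (@cint_split _ 0 T (q * K.+1)%:R)// lerDl.
by apply: Rintegral_ge0 => t _; exact: jackson_ge0.
Qed.

(** The last period may be incomplete; it costs [2 * B]. *)
Lemma jackson_sample (g : R -> R) (B L T : R) :
  0 <= T -> (forall t, `|g t| <= B) ->
  (forall s t, `|g s - g t| <= L * `|s - t|) ->
  `|I 0 T (fun t => g t * jackson t) -
    \sum_(k < (Num.truncn (T / q%:R)).+1) g ((q * k)%:R + q%:R / 2)|
  <= L * (3 * T / h%:R) + 2 * B.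
Proof.
move=> T0 gB gL; have cg := lipschitz_cont gL.
have cJ := jackson_continuous.
have L0 : 0 <= L.
  by have := le_trans (normr_ge0 _) (gL 1 0); rewrite subr0 normr1 mulr1.
have B0 : 0 <= B := le_trans (normr_ge0 _) (gB 0).
have cgJ : continuous (fun t => g t * jackson t).
  by move=> t; apply: cvgM; [exact: cg|exact: cJ].
set K := Num.truncn (T / q%:R).
have Tq0 : 0 <= T / q%:R by rewrite divr_ge0.
have /andP[K1 K2] := truncn_itv Tq0.
have qKT : (q * K)%:R <= T by rewrite natrM mulrC -ler_pdivlMr.
have TqK : T <= (q * K)%:R + q%:R.
  by rewrite -natrD -mulnSr natrM mulrC -ler_pdivrMr// ltW.
have per (n : nat) : `|I 0 (q * n)%:R (fun t => g t * jackson t) -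
    \sum_(k < n) g ((q * k)%:R + q%:R / 2)| <= n%:R * (L * (3 * q%:R / h%:R)).
  elim: n => [|n IH].
    by rewrite muln0 cint_point big_ord0 subrr normr0 mul0r.
  rewrite mulnS addnC natrD (@cint_split _ 0 (q * n)%:R)//; last by rewrite lerDl ler0n.
  rewrite big_ord_recr/= -[n.+1%:R]natr1 [leRHS]mulrDl mul1r.
  rewrite opprD addrACA (le_trans (ler_normD _ _))// lerD//.
  exact: jackson_period_sample.
rewrite (@cint_split _ 0 (q * K)%:R)// big_ord_recr/=.
rewrite opprD addrACA (le_trans (ler_normD _ _))// lerD//.
  apply: le_trans (per K) _; rewrite mulrCA ler_wpM2l//.
  rewrite !mulrA ler_wpM2r ?invr_ge0 ?ler0n//.
  by rewrite (_ : _ * _ = 3 * (q * K)%:R) ?ler_wpM2l// natrM; ring.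
rewrite (le_trans (ler_normB _ _))// mulrDl mul1r lerD//.
apply: (@le_trans _ _ (I (q * K)%:R T (fun t => B * jackson t))).
  apply: cint_norm_le => //.
    by move=> t; apply: cvgM; [exact: cvg_cst|exact: cJ].
  by move=> t _; rewrite normrM (ger0_norm (jackson_ge0 t)) ler_wpM2r// jackson_ge0.
rewrite cintZ// ler_piMr//.
apply: (@le_trans _ _ (I (q * K)%:R ((q * K)%:R + q%:R) jackson)); last first.
  by rewrite int_jackson.
rewrite (@cint_split _ _ T ((q * K)%:R + q%:R))// lerDl.
by apply: Rintegral_ge0 => t _; exact: jackson_ge0.
Qed.

End Kernel.

(** * Iterated integrals of bounded Lipschitz functions *)

Section Box.
Variable R : realType.

Notation I a b g := (\int[lebesgue_measure]_(s in `[a, b]) g s).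

Definition bl (V : normedModType R) (B L : R) (F : V -> R) :=
  (forall t, `|F t| <= B) /\ (forall s t, `|F s - F t| <= L * `|s - t|).

Definition slice d (F : 'rV[R]_d.+1 -> R) (s : R) : 'rV[R]_d -> R :=
  fun t => F (row_mx (s%:M : 'rV[R]_1) t).

Lemma norm_row_mxB_le d (a a' : R) (t t' : 'rV[R]_d) (e : R) :
  `|a - a'| <= e -> `|t - t'| <= e ->
  `|(row_mx (a%:M : 'rV[R]_1) t : 'rV[R]_d.+1) - row_mx (a'%:M : 'rV[R]_1) t'| <= e.
Proof.
move=> ae te; rewrite [leLHS]/Num.Def.normr/= mx_normrE bigmax_le//.
  exact: le_trans ae.
move=> [i j] _ /=; rewrite 4!mxE; case: splitP => k _.
  by rewrite ord1 !mxE ord1 eqxx !mulr1n.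
by have := mx_entry_le (t - t') i k; rewrite !mxE => /le_trans; apply.
Qed.

Lemma bl_ge0 (V : normedModType R) B L (F : V -> R) : bl B L F -> 0 <= B.
Proof. by case=> FB _; exact: le_trans (normr_ge0 _) (FB 0). Qed.

Lemma bl_slice d B L (F : 'rV[R]_d.+1 -> R) s : 0 <= L -> bl B L F -> bl B L (slice F s).
Proof.
move=> L0 [FB FL]; split=> [t|t t']; first exact: FB.
apply: le_trans (FL _ _) _; rewrite ler_wpM2l//.
by apply: norm_row_mxB_le; rewrite // subrr normr0.
Qed.

Lemma slice_lip d B L (F : 'rV[R]_d.+1 -> R) s s' t : 0 <= L -> bl B L F ->
  `|slice F s t - slice F s' t| <= L * `|s - s'|.
Proof.
move=> L0 [_ FL]; apply: le_trans (FL _ _) _.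
rewrite ler_wpM2l//.
by apply: norm_row_mxB_le; rewrite // subrr normr0.
Qed.

(** The weights are kept apart from the integrand because their Lipschitz constants
  are large and must not enter the estimates. *)
Fixpoint wbox (T : R) d : ('I_d -> R -> R) -> ('rV[R]_d -> R) -> R :=
  if d is d'.+1 then fun w F =>
    I 0 T (fun s => wbox T (fun i => w (lift ord0 i)) (slice F s) * w ord0 s)
  else fun _ F => F 0.

Fixpoint wsum (N : nat) d : ('I_d -> nat -> R) -> ('I_d -> R) -> ('rV[R]_d -> R) -> R :=
  if d is d'.+1 then fun e c F =>
    \sum_(k < N.+1) wsum N (fun i => e (lift ord0 i)) (fun i => c (lift ord0 i))
       (slice F (k%:R + c ord0)) * e ord0 k
  else fun _ _ F => F 0.

Section Weights.
Variable T : R.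
Hypothesis T0 : 0 <= T.

Definition weight (w : R -> R) (m : R) :=
  [/\ continuous w, forall t, 0 <= w t, I 0 T w <= m & 0 < m].

Lemma wbox_dist d (w : 'I_d -> R -> R) (m : 'I_d -> R) (delta : R) B1 L1 B2 L2
    (F1 F2 : 'rV[R]_d -> R) :
  (forall i, weight (w i) (m i)) -> 0 <= L1 -> 0 <= L2 ->
  bl B1 L1 F1 -> bl B2 L2 F2 -> (forall t, `|F1 t - F2 t| <= delta) ->
  `|wbox T w F1 - wbox T w F2| <= delta * \prod_i m i.
Proof.
elim: d w m delta B1 L1 B2 L2 F1 F2 => [|d IH] w m delta B1 L1 B2 L2 F1 F2 hw L10 L20 b1 b2 hd /=.
  by rewrite big_ord0 mulr1.
have hw' i : weight (w (lift ord0 i)) (m (lift ord0 i)) by exact: hw.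
have P0 : 0 <= \prod_i m (lift ord0 i).
  by apply: prodr_ge0 => i _; case: (hw' i) => _ _ _ /ltW.
have [cw w0 wm m0] := hw ord0.
have lip (B L : R) (F : 'rV[R]_d.+1 -> R) : 0 <= L -> bl B L F ->
    continuous (fun s => wbox T (fun i => w (lift ord0 i)) (slice F s)).
  move=> L0 bF; apply: (@lipschitz_cont _ _ (L * \prod_i m (lift ord0 i))) => s s'.
  rewrite mulrAC; apply: (IH _ _ _ _ _ _ _ _ _ hw' L0 L0 (bl_slice s L0 bF) (bl_slice s' L0 bF)).
  by move=> t; exact: slice_lip L0 bF.
have c1 := lip _ _ _ L10 b1; have c2 := lip _ _ _ L20 b2.
have cM (f : R -> R) : continuous f -> continuous (fun s => f s * w ord0 s).
  by move=> cf s; apply: cvgM; [exact: cf|exact: cw].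
rewrite -cintB; [|exact: cM|exact: cM].
rewrite big_ord_recl mulrA mulrAC.
have d0 : 0 <= delta := le_trans (normr_ge0 _) (hd 0).
apply: (@le_trans _ _ (I 0 T (fun s => delta * (\prod_i m (lift ord0 i)) * w ord0 s))).
  apply: cint_norm_le.
  - by move=> s; apply: cvgB; [exact: (cM _ c1)|exact: (cM _ c2)].
  - by move=> s; apply: cvgM; [exact: cvg_cst|exact: cw].
  - move=> s _; rewrite -mulrBl normrM (ger0_norm (w0 s)) ler_wpM2r//.
    apply: (IH _ _ _ _ _ _ _ _ _ hw' L10 L20 (bl_slice s L10 b1) (bl_slice s L20 b2)) => t.
    exact: hd.
by rewrite cintZ// ler_wpM2l// mulr_ge0.
Qed.

Lemma wbox_slice_continuous d (w : 'I_d -> R -> R) (m : 'I_d -> R) B L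
    (F : 'rV[R]_d.+1 -> R) :
  (forall i, weight (w i) (m i)) -> 0 <= L -> bl B L F ->
  continuous (fun s => wbox T w (slice F s)).
Proof.
move=> hw L0 bF; apply: (@lipschitz_cont _ _ (L * \prod_i m i)) => s s'.
rewrite mulrAC; apply: (wbox_dist hw L0 L0 (bl_slice s L0 bF) (bl_slice s' L0 bF)).
by move=> t; exact: slice_lip L0 bF.
Qed.

Lemma wsum_dist N d (e : 'I_d -> nat -> R) c (m : 'I_d -> R) (delta : R)
    (F1 F2 : 'rV[R]_d -> R) :
  (forall i k, 0 <= e i k) -> (forall i, \sum_(k < N.+1) e i k <= m i) ->
  0 <= delta -> (forall t, `|F1 t - F2 t| <= delta) ->
  `|wsum N e c F1 - wsum N e c F2| <= delta * \prod_i m i.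
Proof.
elim: d e c m F1 F2 => [|d IH] e c m F1 F2 e0 em d0 hd /=; first by rewrite big_ord0 mulr1.
have P0 : 0 <= \prod_i m (lift ord0 i).
  by apply: prodr_ge0 => i _; apply: le_trans (em _); exact: sumr_ge0.
rewrite [\prod_i m i]big_ord_recl mulrA mulrAC -sumrB (le_trans (ler_norm_sum _ _ _))//.
apply: (@le_trans _ _ (\sum_(k < N.+1) delta * (\prod_i m (lift ord0 i)) * e ord0 k)).
  apply: ler_sum => k _; rewrite -mulrBl normrM (ger0_norm (e0 _ _)) ler_wpM2r//.
  by apply: IH => // i; exact: hd.
by rewrite -mulr_sumr ler_wpM2l// mulr_ge0.
Qed.

Lemma wsum_bound N d (e : 'I_d -> nat -> R) c (m : 'I_d -> R) (B : R)
    (F : 'rV[R]_d -> R) :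
  (forall i k, 0 <= e i k) -> (forall i, \sum_(k < N.+1) e i k <= m i) ->
  0 <= B -> (forall t, `|F t| <= B) ->
  `|wsum N e c F| <= B * \prod_i m i.
Proof.
move=> e0 em B0 FB.
have z : wsum N e c (fun _ => 0) = 0.
  elim: d e c {m F e0 em FB} => //= d IH e c.
  by rewrite big1// => k _; rewrite /slice IH mul0r.
rewrite -[wsum _ _ _ _]subr0 -z; apply: wsum_dist => // t.
by rewrite subr0.
Qed.

(** Sampling by each weight in one variable gives sampling by their product: one
  variable is replaced at a time, while the others contribute their total mass. *)
Lemma wbox_sample N d (w : 'I_d -> R -> R) (e : 'I_d -> nat -> R) (c : 'I_d -> R)
    (m err : 'I_d -> R) (B L : R) (F : 'rV[R]_d -> R) :
  (forall i, weight (w i) (m i)) ->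
  (forall i k, 0 <= e i k) -> (forall i, \sum_(k < N.+1) e i k <= m i) ->
  (forall i (g : R -> R) (B L : R), (forall t, `|g t| <= B) ->
     (forall s t, `|g s - g t| <= L * `|s - t|) ->
     `|I 0 T (fun t => g t * w i t) - \sum_(k < N.+1) g (k%:R + c i) * e i k|
       <= L * err i + 2 * B) ->
  0 <= L -> bl B L F ->
  `|wbox T w F - wsum N e c F| <=
    (\prod_i m i) * \sum_i (L * err i + 2 * B) / m i.
Proof.
elim: d w e c m err F => [|d IH] w e c m err F hw e0 em samp L0 bF /=.
  by rewrite !big_ord0 mulr0 subrr normr0.
have hw' i : weight (w (lift ord0 i)) (m (lift ord0 i)) by exact: hw.
have em' i : \sum_(k < N.+1) e (lift ord0 i) k <= m (lift ord0 i) by exact: em.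
have e0' (i : 'I_d) k : 0 <= e (lift ord0 i) k by exact: e0.
have B0 := bl_ge0 bF.
set P := \prod_i m (lift ord0 i).
have P0 : 0 <= P by apply: prodr_ge0 => i _; case: (hw' i) => _ _ _ /ltW.
have [cw w0 wm m0] := hw ord0.
pose w' := fun i : 'I_d => w (lift ord0 i).
pose e' := fun i : 'I_d => e (lift ord0 i).
pose c' := fun i : 'I_d => c (lift ord0 i).
pose G (s : R) := wsum N e' c' (slice F s).
have GB (s : R) : `|G s| <= P * B.
  rewrite mulrC; apply: wsum_bound => // t; exact: bF.1.
have GL (s s' : R) : `|G s - G s'| <= P * L * `|s - s'|.
  rewrite [P * L]mulrC mulrAC; apply: wsum_dist => //; first exact: mulr_ge0.
  by move=> t; exact: slice_lip L0 bF.
have cG := lipschitz_cont GL.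
have cW := wbox_slice_continuous hw' L0 bF.
have cM (f : R -> R) : continuous f -> continuous (fun s => f s * w ord0 s).
  by move=> cf s; apply: cvgM; [exact: cf|exact: cw].
have s1 := samp ord0 G _ _ GB GL.
rewrite -/w' -/e' -/c' -/G.
rewrite -(subrKA (I 0 T (fun s => G s * w ord0 s))) (le_trans (ler_normD _ _))//.
rewrite [\prod_i m i]big_ord_recl [\sum_i _ / m i]big_ord_recl -/P mulrDr addrC lerD//.
  apply: le_trans s1 _; rewrite le_eqVlt; apply/orP; left; apply/eqP.
  by field; exact: lt0r_neq0.
set Err := \sum_i _.
rewrite -cintB; [|exact: cM|exact: cM].
apply: (@le_trans _ _ (I 0 T (fun s => P * Err * w ord0 s))).
  apply: cint_norm_le.
  - by move=> s; apply: cvgB; [exact: (cM _ cW)|exact: (cM _ cG)].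
  - by move=> s; apply: cvgM; [exact: cvg_cst|exact: cw].
  - move=> s _; rewrite -mulrBl normrM (ger0_norm (w0 s)) ler_wpM2r//.
    apply: IH => //; last exact: bl_slice.
    by move=> i; exact: samp.
have Err0 : 0 <= P * Err.
  apply: le_trans (normr_ge0 _) (IH w' e' c' _ _ (slice F 0) hw' e0' em' _ L0 (bl_slice 0 L0 bF)).
  by move=> i; exact: samp.
by rewrite cintZ// mulrC -[leRHS]mulrA ler_wpM2r.
Qed.

Definition BL (V : normedModType R) (F : V -> R) :=
  exists B L : R, 0 <= L /\ bl B L F.

Lemma BL_cst (V : normedModType R) c : BL (fun _ : V => c).
Proof. by exists `|c|, 0; do 2!split=> //; move=> s t; rewrite subrr normr0 mul0r. Qed.

Lemma BLD (V : normedModType R) (F G : V -> R) : BL F -> BL G -> BL (fun t => F t + G t).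
Proof.
move=> [B1 [L1 [L10 [b1 l1]]]] [B2 [L2 [L20 [b2 l2]]]].
exists (B1 + B2), (L1 + L2); split; first exact: addr_ge0.
split=> [t|s t]; first by rewrite (le_trans (ler_normD _ _))// lerD.
by rewrite opprD addrACA mulrDl (le_trans (ler_normD _ _))// lerD.
Qed.

Lemma BLM (V : normedModType R) (F G : V -> R) : BL F -> BL G -> BL (fun t => F t * G t).
Proof.
move=> [B1 [L1 [L10 [b1 l1]]]] [B2 [L2 [L20 [b2 l2]]]].
have B10 := le_trans (normr_ge0 _) (b1 0); have B20 := le_trans (normr_ge0 _) (b2 0).
exists (B1 * B2), (B1 * L2 + B2 * L1); split; first by rewrite addr_ge0// mulr_ge0.
split=> [t|s t]; first by rewrite normrM ler_pM.
have -> : F s * G s - F t * G t = F s * (G s - G t) + G t * (F s - F t) by ring.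
rewrite (le_trans (ler_normD _ _))// !normrM mulrDl -!mulrA.
by rewrite lerD// ler_pM.
Qed.

Lemma BL_sum (V : normedModType R) (J : Type) (r : seq J) (F : J -> V -> R) :
  (forall j, BL (F j)) -> BL (fun t => \sum_(j <- r) F j t).
Proof.
move=> bF; elim: r => [|j r IH].
  by under eq_fun do rewrite big_nil; exact: BL_cst.
by under eq_fun do rewrite big_cons; exact: BLD.
Qed.

Lemma BL_prod (V : normedModType R) (J : Type) (r : seq J) (F : J -> V -> R) :
  (forall j, BL (F j)) -> BL (fun t => \prod_(j <- r) F j t).
Proof.
move=> bF; elim: r => [|j r IH].
  by under eq_fun do rewrite big_nil; exact: BL_cst.
by under eq_fun do rewrite big_cons; exact: BLM.
Qed.

Lemma cos_lip (x y : R) : `|cos x - cos y| <= `|x - y|.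
Proof.
wlog xy : x y / y <= x => [H|].
  by have [/H//|/ltW/H] := leP y x; rewrite distrC [leRHS]distrC.
have [|z _ ->] := @MVT_segment R cos (fun z => - sin z) y x xy.
- by apply: continuous_subspaceT; exact: continuous_cos.
- by rewrite normrM normrN ler_piMl// sin_max.
Qed.

Definition dotp d (a t : 'rV[R]_d) : R := \sum_(k < d) a ord0 k * t ord0 k.

Lemma BL_cos_dotp d (a : 'rV[R]_d) (c : R) : BL (fun t => cos (dotp a t + c)).
Proof.
exists 1, (\sum_k `|a ord0 k|); split; first exact: sumr_ge0.
split=> [t|s t]; first exact: cos_max.
apply: le_trans (cos_lip _ _) _; rewrite opprD addrACA subrr addr0 /dotp -sumrB.
rewrite (le_trans (ler_norm_sum _ _ _))// mulr_suml; apply: ler_sum => k _.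
rewrite -mulrBr normrM ler_wpM2l//.
by have := mx_entry_le (s - t) ord0 k; rewrite !mxE.
Qed.

Lemma BL_slice d (F : 'rV[R]_d.+1 -> R) s : BL F -> BL (slice F s).
Proof. by move=> [B [L [L0 bF]]]; exists B, L; split=> //; exact: bl_slice. Qed.

Lemma BL_coord d (g : R -> R) i : BL g -> BL (fun t : 'rV[R]_d => g (t ord0 i)).
Proof.
move=> [B [L [L0 [b l]]]]; exists B, L; split=> //; split=> [t|s t]; first exact: b.
apply: le_trans (l _ _) _; rewrite ler_wpM2l//.
by have := mx_entry_le (s - t) ord0 i; rewrite !mxE.
Qed.

Section Linearity.
Variables (d : nat) (w : 'I_d.+1 -> R -> R) (m : 'I_d.+1 -> R).
Hypothesis hw : forall i, weight (w i) (m i).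

Lemma wbox_integrand_continuous (F : 'rV[R]_d.+1 -> R) : BL F -> continuous (fun s =>
  wbox T (fun i => w (lift ord0 i)) (slice F s) * w ord0 s).
Proof.
move=> [B [L [L0 bF]]] s; have [cw _ _ _] := hw ord0.
have hw' i : weight (w (lift ord0 i)) (m (lift ord0 i)) by exact: hw.
by apply: cvgM; [exact: (wbox_slice_continuous hw' L0 bF)|exact: cw].
Qed.

End Linearity.

Lemma wboxZ d (w : 'I_d -> R -> R) (m : 'I_d -> R) c (F : 'rV[R]_d -> R) :
  (forall i, weight (w i) (m i)) -> BL F ->
  wbox T w (fun t => c * F t) = c * wbox T w F.
Proof.
elim: d w m F => [|d IH] w m F hw bF //=.
rewrite -cintZ; last exact: (wbox_integrand_continuous hw).
apply: eq_Rintegral => s _; rewrite mulrA; congr (_ * _).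
by apply: (IH _ (fun i => m (lift ord0 i))); [move=> i; exact: hw|exact: BL_slice].
Qed.

Lemma wboxD d (w : 'I_d -> R -> R) (m : 'I_d -> R) (F G : 'rV[R]_d -> R) :
  (forall i, weight (w i) (m i)) -> BL F -> BL G ->
  wbox T w (fun t => F t + G t) = wbox T w F + wbox T w G.
Proof.
elim: d w m F G => [|d IH] w m F G hw bF bG //=.
rewrite -cintD; try exact: (wbox_integrand_continuous hw).
apply: eq_Rintegral => s _; rewrite -mulrDl; congr (_ * _).
by apply: (IH _ (fun i => m (lift ord0 i))); [move=> i; exact: hw|exact: BL_slice|exact: BL_slice].
Qed.

Lemma wbox_sum d (w : 'I_d -> R -> R) (m : 'I_d -> R) (J : Type) (r : seq J)
    (F : J -> 'rV[R]_d -> R) :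
  (forall i, weight (w i) (m i)) -> (forall j, BL (F j)) ->
  wbox T w (fun t => \sum_(j <- r) F j t) = \sum_(j <- r) wbox T w (F j).
Proof.
move=> hw bF; elim: r => [|j r IH].
  have -> : (fun t => \sum_(j <- [::]) F j t) = (fun t => 0 * 0).
    by apply/funext => t; rewrite big_nil mul0r.
  by rewrite big_nil (wboxZ 0 hw (BL_cst _ 0)) mul0r.
rewrite big_cons -IH -(wboxD hw)//; last exact: BL_sum.
by congr wbox; apply/funext => t; rewrite big_cons.
Qed.

Lemma weight1 : weight (fun _ : R => 1) (T + 1).
Proof.
split=> //; [by move=> s; exact: cvg_cst|by rewrite cint_cst// subr0 mul1r lerDl|].
by rewrite ltr_wpDl.
Qed.

Lemma box_integralE d (F : 'rV[R]_d -> R) :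
  box_integral T F = wbox T (fun _ _ => 1) F.
Proof.
elim: d F => [|d IH] F //=; apply: eq_Rintegral => s _.
by rewrite mulr1 -IH.
Qed.

Lemma slice_ord0 d (t : 'rV[R]_d) (s : R) :
  (row_mx (s%:M : 'rV[R]_1) t : 'rV[R]_d.+1) ord0 ord0 = s.
Proof.
by rewrite mxE; case: splitP => // k _; rewrite (ord1 k) mxE mulr1n.
Qed.

Lemma slice_lift d (t : 'rV[R]_d) (s : R) i :
  (row_mx (s%:M : 'rV[R]_1) t : 'rV[R]_d.+1) ord0 (lift ord0 i) = t ord0 i.
Proof.
rewrite mxE; case: splitP => k; first by rewrite ord1.
by rewrite lift0 add1n => -[/val_inj ->].
Qed.

(** This moves the kernels into the integrand, where they can be expanded into
  characters. *)
Lemma wbox_absorb d (w : 'I_d -> R -> R) (m : 'I_d -> R) (F : 'rV[R]_d -> R) :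
  (forall i, weight (w i) (m i)) -> (forall i, BL (w i)) -> BL F ->
  wbox T w F = box_integral T (fun t => F t * \prod_i w i (t ord0 i)).
Proof.
move=> hw bw bF; rewrite box_integralE.
elim: d w m F hw bw bF => [|d IH] w m F hw bw bF /=.
  by rewrite big_ord0 mulr1.
apply: eq_Rintegral => s _; rewrite mulr1.
have hw' i : weight (w (lift ord0 i)) (m (lift ord0 i)) by exact: hw.
have bw' (i : 'I_d) : BL (w (lift ord0 i)) by exact: bw.
rewrite (IH _ _ _ hw' bw' (BL_slice s bF)).
rewrite mulrC -(wboxZ _ (fun=> weight1)); last first.
  by apply: BLM; [exact: BL_slice|apply: BL_prod => i; exact: BL_coord].
congr wbox; apply/funext => t; rewrite /slice big_ord_recl slice_ord0.
under [in RHS]eq_bigr do rewrite slice_lift.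
ring.
Qed.

(** Only the sum of the coefficients matters: every character satisfies the same
  bound, uniformly in the frequency. *)
Definition trigpoly d (C : R) (g : 'rV[R]_d -> R) :=
  exists2 s : seq (R * ('rV[R]_d * R)),
    forall t, g t = \sum_(p <- s) p.1 * cos (dotp p.2.1 t + p.2.2) &
    \sum_(p <- s) `|p.1| <= C.

Lemma dotpDl d (a b t : 'rV[R]_d) : dotp (a + b) t = dotp a t + dotp b t.
Proof. by rewrite /dotp -big_split; apply: eq_bigr => k _; rewrite mxE mulrDl. Qed.

Lemma dotpNl d (a t : 'rV[R]_d) : dotp (- a) t = - dotp a t.
Proof. by rewrite /dotp -sumrN; apply: eq_bigr => k _; rewrite mxE mulNr. Qed.

Lemma trigpolyM d C C' (g g' : 'rV[R]_d -> R) : trigpoly C g -> trigpoly C' g' ->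
  trigpoly (C * C') (fun t => g t * g' t).
Proof.
move=> [s gs sC] [s' gs' sC'].
exists ([seq (p.1 * p'.1 / 2, (p.2.1 + p'.2.1, p.2.2 + p'.2.2)) | p <- s, p' <- s'] ++
        [seq (p.1 * p'.1 / 2, (p.2.1 - p'.2.1, p.2.2 - p'.2.2)) | p <- s, p' <- s']).
  move=> t; rewrite gs gs' big_cat !big_allpairs_dep /= -big_split /= mulr_suml.
  apply: eq_bigr => p _ /=; rewrite -big_split mulr_sumr; apply: eq_bigr => p' _ /=.
  rewrite !dotpDl dotpNl.
  set x := dotp _ t; set y := dotp _ t; set x' := p.2.2; set y' := p'.2.2.
  rewrite (_ : x + y + (x' + y') = (x + x') + (y + y')); last by ring.
  rewrite (_ : x - y + (x' - y') = (x + x') - (y + y')); last by ring.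
  by rewrite (cosD (x + x') (y + y')) cosB; field.
rewrite big_cat !big_allpairs_dep /= -big_split/=.
have -> : \sum_(p <- s) (\sum_(p' <- s') `|p.1 * p'.1 / 2| + \sum_(p' <- s') `|p.1 * p'.1 / 2|)
   = (\sum_(p <- s) `|p.1|) * (\sum_(p <- s') `|p.1|).
  rewrite mulr_suml; apply: eq_bigr => p _; rewrite -big_split mulr_sumr/=.
  apply: eq_bigr => p' _; by rewrite !normrM normfV (ger0_norm (ler0n _ 2)); field.
by apply: ler_pM => //; exact: sumr_ge0.
Qed.

Lemma trigpolyZ d C (c : R) (g : 'rV[R]_d -> R) : trigpoly C g ->
  trigpoly (`|c| * C) (fun t => c * g t).
Proof.
move=> [s gs sC]; exists [seq (c * p.1, p.2) | p <- s] => [t|].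
  by rewrite gs big_map mulr_sumr; apply: eq_bigr => p _; rewrite mulrA.
rewrite big_map/= (le_trans _ (ler_wpM2l (normr_ge0 c) sC))// mulr_sumr.
by apply: ler_sum => p _; rewrite normrM.
Qed.

Lemma trigpolyD d C C' (g g' : 'rV[R]_d -> R) : trigpoly C g -> trigpoly C' g' ->
  trigpoly (C + C') (fun t => g t + g' t).
Proof.
move=> [s gs sC] [s' gs' sC']; exists (s ++ s') => [t|].
  by rewrite gs gs' big_cat.
by rewrite big_cat lerD.
Qed.

Lemma trigpoly_cos d (a : 'rV[R]_d) c : trigpoly 1 (fun t => cos (dotp a t + c)).
Proof.
exists [:: (1, (a, c))] => [t|]; first by rewrite big_seq1 mul1r.
by rewrite big_seq1 normr1.
Qed.

Lemma trigpoly_sum d N C (g : 'I_N -> 'rV[R]_d -> R) : (forall i, trigpoly C (g i)) ->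
  trigpoly (N%:R * C) (fun t => \sum_(i < N) g i t).
Proof.
elim: N g => [|N IH] g hg.
  exists [::] => [t|]; first by rewrite big_ord0 big_nil.
  by rewrite big_nil mul0r.
under eq_fun do rewrite big_ord_recr/=.
by rewrite -natr1 mulrDl mul1r; apply: trigpolyD => //; apply: IH => i; exact: hg.
Qed.

Lemma trigpoly_prod d N C (g : 'I_N -> 'rV[R]_d -> R) : (forall i, trigpoly C (g i)) ->
  trigpoly (C ^+ N) (fun t => \prod_(i < N) g i t).
Proof.
elim: N g => [|N IH] g hg.
  exists [:: (1, (0, 0))] => [t|]; last by rewrite big_seq1 normr1.
  rewrite big_ord0 big_seq1 mul1r addr0 /dotp big1 ?cos0// => k _.
  by rewrite mxE mul0r.
under eq_fun do rewrite big_ord_recr/=.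
by rewrite exprSr; apply: trigpolyM => //; apply: IH => i; exact: hg.
Qed.

Lemma box_trigpoly d C (delta : R) (F g : 'rV[R]_d -> R) :
  BL F -> trigpoly C g -> 0 <= delta ->
  (forall a c, `|box_integral T (fun t => F t * cos (dotp a t + c))| <= delta) ->
  `|box_integral T (fun t => F t * g t)| <= C * delta.
Proof.
move=> bF [s gs sC] d0 hF; rewrite box_integralE.
have bc (p : R * ('rV[R]_d * R)) :
    BL (fun t => F t * cos (dotp p.2.1 t + p.2.2)).
  by apply: BLM => //; exact: BL_cos_dotp.
have -> : (fun t => F t * g t) =
    (fun t => \sum_(p <- s) p.1 * (F t * cos (dotp p.2.1 t + p.2.2))).
  apply/funext => t; rewrite gs mulr_sumr; apply: eq_bigr => p _.
  by rewrite mulrCA.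
rewrite (wbox_sum _ (fun=> weight1)); last first.
  by move=> p; apply: BLM => //; exact: BL_cst.
apply: le_trans (ler_wpM2r d0 sC); rewrite mulr_suml.
rewrite (le_trans (ler_norm_sum _ _ _))//; apply: ler_sum => p _.
rewrite (wboxZ _ (fun=> weight1))// normrM ler_wpM2l//.
by rewrite -box_integralE.
Qed.

End Weights.
End Box.

(** * Level of distribution *)

Section JacksonWeight.
Variables (R : realType) (q h : nat).
Hypotheses (q0 : (0 < q)%N) (h0 : (0 < h)%N).

Lemma trigpolyW d (C C' : R) (g : 'rV[R]_d -> R) : C <= C' -> trigpoly C g -> trigpoly C' g.
Proof. by move=> CC' [s gs sC]; exists s => //; exact: le_trans CC'. Qed.

(** The square of the Fejer kernel has [16 * h ^ 4] coefficients and [energy] is at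
  least [h ^ 3]. For [h = q * H] the resulting bound does not depend on [q]. *)
Lemma jackson_trigpoly d (i : 'I_d) :
  trigpoly (16 * h%:R / q%:R) (fun t : 'rV[R]_d => jackson q h (t ord0 i)).
Proof.
have h3 : h%:R ^+ 3 <= energy R h by exact: energy_ge h0.
have en0 : 0 < energy R h by rewrite (lt_le_trans _ h3)// exprn_gt0// ltr0n.
have q0' : 0 < q%:R :> R by rewrite ltr0n.
have tf : trigpoly ((h.*2)%:R * ((h.*2)%:R * 1)) (fun t : 'rV[R]_d => fejer q h (t ord0 i)).
  apply: trigpoly_sum => m; apply: trigpoly_sum => l.
  have -> : (fun t : 'rV[R]_d => cos (2 * (m%:R - l%:R) * kphase q (t ord0 i))) =
    (fun t => cos (dotp (\row_k (if k == i then 2 * (m%:R - l%:R) * pi / q%:R else 0)) t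
                   + - (2 * (m%:R - l%:R) * pi / 2))).
    apply/funext => t; rewrite kphaseE//; congr (cos (_ + _)).
    rewrite /dotp (bigD1 i)//= mxE eqxx big1 ?addr0// => k /negbTE ki.
    by rewrite mxE ki mul0r.
  exact: trigpoly_cos.
have tp := trigpolyZ (q%:R * energy R h)^-1 (trigpolyM tf tf).
have -> : (fun t : 'rV[R]_d => jackson q h (t ord0 i)) = (fun t =>
    (q%:R * energy R h)^-1 * (fejer q h (t ord0 i) * fejer q h (t ord0 i))).
  by apply/funext => t; rewrite /jackson mulrC expr2.
have qe0 : 0 < q%:R * energy R h by exact: mulr_gt0.
apply: trigpolyW tp; rewrite ger0_norm; last by rewrite invr_ge0 ltW.
rewrite mulrC ler_pdivrMr//.
rewrite mulr1 [leRHS](_ : _ = 16 * h%:R * energy R h); last by field; exact: lt0r_neq0.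
rewrite -mul2n natrM [leLHS](_ : _ = 16 * h%:R * h%:R ^+ 3); last by ring.
by rewrite ler_wpM2l// mulr_ge0.
Qed.

Lemma BL_cos_affine (a c : R) : BL (fun t : R => cos (a * t + c)).
Proof.
exists 1, `|a|; split=> //; split=> [t|s t]; first exact: cos_max.
by rewrite (le_trans (cos_lip _ _))// opprD addrACA subrr addr0 -mulrBr normrM.
Qed.

Lemma jackson_BL : BL (@jackson R q h).
Proof.
have bf : BL (@fejer R q h).
  apply: BL_sum => m; apply: BL_sum => l.
  by under eq_fun do rewrite kphaseE//; exact: BL_cos_affine.
by apply: BLM; [under eq_fun do rewrite expr2; exact: BLM|exact: BL_cst].
Qed.

Lemma jackson_weight (T : R) : 0 <= T -> weight T (@jackson R q h) (T / q%:R + 1).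
Proof.
move=> T0; split.
- exact: jackson_continuous.
- by move=> t; exact: jackson_ge0.
- exact: int_jackson_le.
- by rewrite ltr_wpDl// divr_ge0.
Qed.

Lemma sum_multiples (g : nat -> R) (N : nat) :
  \sum_(k < N.+1) g k * (q %| k)%:R = \sum_(j < (N %/ q).+1) g (q * j)%N.
Proof.
elim: N => [|N IH].
  by rewrite div0n !big_ord_recr !big_ord0/= !add0r dvdn0 mulr1 muln0.
rewrite big_ord_recr/= IH divnS//; case: (boolP (q %| N.+1)%N) => [qN|_].
  have e : (q * (N %/ q).+1 = N.+1)%N.
    by rewrite -[RHS](divnK qN) divnS// qN add1n mulnC.
  by rewrite add1n [RHS]big_ord_recr/= mulr1 e.
by rewrite add0n mulr0 addr0.
Qed.

Lemma truncn_divn (T : R) : 0 <= T -> Num.truncn (T / q%:R) = (Num.truncn T %/ q)%N.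
Proof.
move=> T0; have q0' : 0 < q%:R :> R by rewrite ltr0n.
have /andP[N1 N2] := truncn_itv T0; set N := Num.truncn T in N1 N2 *.
apply/truncn_def/andP; split.
  rewrite ler_pdivlMr// -natrM (le_trans _ N1)// ler_nat; exact: leq_divM.
rewrite ltr_pdivrMr// -natrM (lt_le_trans N2)// ler_nat; exact: ltn_ceil.
Qed.

Lemma jackson_sample_multiples (g : R -> R) (B L T : R) :
  0 <= T -> (forall t, `|g t| <= B) ->
  (forall s t, `|g s - g t| <= L * `|s - t|) ->
  `|\int[lebesgue_measure]_(t in `[0, T]) (g t * jackson q h t) -
    \sum_(k < (Num.truncn T).+1) g (k%:R + q%:R / 2) * (q %| k)%:R|
  <= L * (3 * T / h%:R) + 2 * B.
Proof.
move=> T0 gB gL; rewrite (sum_multiples (fun k => g (k%:R + q%:R / 2))) -truncn_divn//.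
exact: jackson_sample.
Qed.

End JacksonWeight.

Lemma wsumE (R : realType) N d (e : 'I_d -> nat -> R) c (F : 'rV[R]_d -> R) :
  wsum N e c F = \sum_(k : {ffun 'I_d -> 'I_N.+1})
    F (\row_i ((k i)%:R + c i)) * \prod_i e i (k i).
Proof.
elim: d e c F => [|d IH] e c F /=.
  rewrite (big_pred1 [ffun=> ord0]); last by move=> k; apply/esym/eqP/ffunP => -[].
  by rewrite big_ord0 mulr1; congr F; apply/rowP => -[].
pose G (p : 'I_N.+1 * {ffun 'I_d -> 'I_N.+1}) : {ffun 'I_d.+1 -> 'I_N.+1} :=
  [ffun i => if unlift ord0 i is Some j then p.2 j else p.1].
have bijG : bijective G.
  exists (fun k : {ffun 'I_d.+1 -> 'I_N.+1} => (k ord0, [ffun j => k (lift ord0 j)])).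
    move=> [a g]; congr pair; first by rewrite ffunE unlift_none.
    by apply/ffunP => j; rewrite !ffunE liftK.
  move=> k; apply/ffunP => i; rewrite ffunE; case: unliftP => [j ->|->] //=.
  by rewrite ffunE.
rewrite (reindex G)/=; last by apply: onW_bij.
rewrite -(pair_big xpredT xpredT (fun a g => F (\row_i ((G (a, g) i)%:R + c i)) *
   \prod_i e i (G (a, g) i)))/=.
apply: eq_bigr => a _; rewrite IH mulr_suml; apply: eq_bigr => g _.
have G0 : G (a, g) ord0 = a by rewrite ffunE unlift_none.
have GS j : G (a, g) (lift ord0 j) = g j by rewrite ffunE liftK.
rewrite big_ord_recl G0; under [in RHS]eq_bigr do rewrite GS.
rewrite [e _ _ * _]mulrC mulrA; congr (_ * _ * _); rewrite /slice; congr F.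
apply/rowP => i; rewrite mxE.
case: (unliftP ord0 i) => [j|] ->; first by rewrite slice_lift mxE GS.
by rewrite slice_ord0 G0.
Qed.

(** For [x i = T / q i] this bounds the contribution of incomplete periods, by
  [O(T ^ (d - 1))] whatever the moduli. *)
Lemma prod_shift_le (R : realType) d (x : 'I_d -> R) (T : R) : 1 <= T ->
  (forall i, 0 <= x i <= T) ->
  \prod_i (x i + 1) <= \prod_i x i + (2 * T) ^+ d / T.
Proof.
move=> T1; have T0 : 0 < T by exact: lt_le_trans T1.
elim: d x => [|d IH] x hx.
  by rewrite !big_ord0 expr0 lerDl divr_ge0// ltW.
rewrite !big_ord_recl; have {}IH := IH _ (fun i => hx (lift ord0 i)).
have /andP[x0 xT] := hx ord0.
have P0 : 0 <= \prod_i x (lift ord0 i) by apply: prodr_ge0 => i _; have /andP[] := hx (lift ord0 i).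
have PT : \prod_(i < d) (x (lift ord0 i) + 1) <= (2 * T) ^+ d.
  rewrite -[d in _ ^+ d]card_ord -prodr_const; apply: ler_prod => i _.
  by have /andP[y0 yT] := hx (lift ord0 i); apply/andP; split; lra.
rewrite mulrDl mul1r exprS.
have E : 2 * T * (2 * T) ^+ d / T = T * ((2 * T) ^+ d / T) + (2 * T) ^+ d.
  by field; exact: lt0r_neq0.
rewrite E addrA lerD//.
apply: (@le_trans _ _ (x ord0 * (\prod_i x (lift ord0 i) + (2 * T) ^+ d / T))).
  by rewrite ler_wpM2l.
have T0' := ltW T0.
have D0 : 0 <= (2 * T) ^+ d / T by rewrite divr_ge0// exprn_ge0// mulr_ge0.
by rewrite mulrDr lerD2l ler_wpM2r.
Qed.

Section HoroFlow.
Variables (R : realType) (n d : nat) (u : horo_flow n d).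

Lemma horoD (s t : 'rV[R]_d) : horo u (s + t) = (horo u s * horo u t)%g.
Proof.
apply: val_inj; rewrite /= /horo_mx mulmxDl mul1mx mulmxDr mulmx1.
set A := \sum_(k < d) s ord0 k *: _; set B := \sum_(k < d) t ord0 k *: _.
have -> : A *m B = 0.
  rewrite mulmx_suml big1// => k _; rewrite mulmx_sumr big1// => l _.
  rewrite -scalemxAl -scalemxAr mul_delta_mx_0 ?scaler0//.
  have := codom_f (hf_pos u) k; rewrite hf_pos_block => /andP[_ h1].
  have := codom_f (hf_pos u) l; rewrite hf_pos_block => /andP[h2 _].
  by apply/eqP => e; move: (leq_trans h2 h1); rewrite e ltnn.
rewrite addr0 -addrA [B + A]addrC; congr (_ + _); rewrite -big_split.
by apply: eq_bigr => k _; rewrite mxE scalerDl.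
Qed.

Lemma horo0 : horo u (0 : 'rV[R]_d) = SL1 R n.
Proof.
apply: val_inj; rewrite /= /horo_mx big1 ?addr0// => k _.
by rewrite mxE scale0r.
Qed.

Lemma tangent_horo (k : 'I_d) :
  tangent_to (fun t : R => horo u (t *: delta_mx ord0 k))
    (delta_mx (hf_pos u k).1 (hf_pos u k).2).
Proof.
split; first by rewrite scale0r horo0.
apply: cvg_near_cst; near=> t.
have t0 : t != 0 by near: t; exact: nbhs_dnbhs_neq.
rewrite /= /horo_mx addrAC subrr add0r (bigD1 k)//= big1 ?addr0 => [|l lk].
  by rewrite !mxE !eqxx mulr1 scalerA mulVf// scale1r.
by rewrite !mxE (negbTE lk) andbF mulr0 scale0r.
Unshelve. all: by end_near. Qed.

Lemma tr_pos (k : 'I_d) : \tr (delta_mx (hf_pos u k).1 (hf_pos u k).2 : 'M[R]_n) = 0.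
Proof.
have := codom_f (hf_pos u) k; rewrite hf_pos_block => /andP[h1 h2].
rewrite /mxtrace big1// => i _; rewrite mxE.
by case: eqP => // ->; case: eqP => // e; move: (leq_trans h1 h2); rewrite e ltnn.
Qed.

End HoroFlow.

Section Orbit.
Variables (R : realType) (n d : nat) (Gamma : groupClosed (SL R n)).
Hypothesis cX : compact [set: hspace Gamma].

(** Changing one coordinate at a time moves along one-parameter groups. There are
  finitely many elementary matrices, so the constant depends neither on the base
  point nor on the identification of the coordinates. *)
Lemma orbit_lipschitz (f : hspace Gamma -> R) : smooth f ->
  exists2 L : R, 0 <= L & forall (u : horo_flow n d) x (s t : 'rV[R]_d),
    `|f (ract x (horo u s)) - f (ract x (horo u t))| <= L * `|s - t|.
Proof.
move=> sf.
have hL (ij : 'I_n * 'I_n) : exists L : R, 0 <= L /\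
    (\tr (delta_mx ij.1 ij.2 : 'M[R]_n) = 0 -> forall (e : R -> SL R n) x (s t : R),
      tangent_to e (delta_mx ij.1 ij.2) -> (forall s t, e (s + t) = (e s * e t)%g) ->
      `|f (ract x (e s)) - f (ract x (e t))| <= L * `|s - t|).
  have [tr0|tr0] := eqVneq (\tr (delta_mx ij.1 ij.2 : 'M[R]_n)) 0.
    have [L L0 hL] := smooth_lipschitz cX tr0 sf.
    by exists L; split; [exact: ltW|move=> _; exact: hL].
  by exists 0; split=> // /eqP; rewrite (negbTE tr0).
have [L /all_and2[L0 LP]] := choice hL.
pose Ls := \sum_ij L ij; exists (d%:R * Ls) => [|u x s t].
  by rewrite mulr_ge0// sumr_ge0.
pose v (m : nat) : 'rV[R]_d := \row_k (if (k < m)%N then s ord0 k else t ord0 k).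
have step (m : 'I_d) : `|f (ract x (horo u (v m.+1))) - f (ract x (horo u (v m)))|
    <= Ls * `|s - t|.
  pose e (r : R) := horo u (r *: delta_mx ord0 m : 'rV[R]_d).
  have eD r r' : e (r + r') = (e r * e r')%g by rewrite /e scalerDl horoD.
  have vS : v m.+1 = v m + (s ord0 m - t ord0 m) *: delta_mx ord0 m.
    apply/rowP => k; rewrite !mxE eqxx /= ltnS leq_eqVlt.
    have [->|km] := eqVneq k m; first by rewrite eqxx ltnn /= mulr1 addrC subrK.
    by rewrite (negbTE km : (k == m :> nat) = false) /= mulr0 addr0.
  have := LP (hf_pos u m) (tr_pos R u m) e (ract x (horo u (v m)))
    (s ord0 m - t ord0 m) 0 (tangent_horo R u m) eD.
  rewrite {2}/e scale0r horo0 ract1 ractM -horoD -vS subr0 => /le_trans; apply.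
  apply: ler_pM => //.
    by rewrite /Ls (bigD1 (hf_pos u m))//= lerDl sumr_ge0.
  by have := mx_entry_le (s - t) ord0 m; rewrite !mxE.
have tele (m : nat) : (m <= d)%N ->
    `|f (ract x (horo u (v m))) - f (ract x (horo u (v 0%N)))| <= m%:R * (Ls * `|s - t|).
  elim: m => [|m IH] md; first by rewrite subrr normr0 mul0r.
  rewrite -(subrKA (f (ract x (horo u (v m))))) (le_trans (ler_normD _ _))//.
  by rewrite -natr1 mulrDl mul1r addrC lerD ?IH 1?ltnW//; exact: (step (Ordinal md)).
have := tele d (leqnn d).
have -> : v d = s by apply/rowP => k; rewrite mxE ltn_ord.
have -> : v 0%N = t by apply/rowP => k; rewrite mxE.
by rewrite mulrA.
Qed.

Variable mX : probability (borel_hspace Gamma) R.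

(** [cos (p + c)] is a combination of [cos p] and [sin p] with coefficients at most 1,
  and the discrepancy bounds the integrals against both. *)
Lemma box_twisted (u : horo_flow n d) (T : R) (f : hspace Gamma -> R) x0
    (a : 'rV[R]_d) (c : R) :
  0 < T -> BL (fun t => f (ract x0 (horo u t)) - space_avg mX f) ->
  `|box_integral T (fun t => (f (ract x0 (horo u t)) - space_avg mX f) *
      cos (dotp a t + c))| <= 2 * T ^+ d * twisted_discrepancy mX u T a f x0.
Proof.
move=> T0; set F := fun t => _ => bF.
pose C := box_integral T (fun t => cos (dotp a t) * F t).
pose S := box_integral T (fun t => sin (dotp a t) * F t).
have -> : twisted_discrepancy mX u T a f x0 = T ^- d * Num.sqrt (C ^+ 2 + S ^+ 2) by [].
have bC : BL (fun t => cos (dotp a t) * F t).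
  apply: BLM => //; have := BL_cos_dotp a 0.
  by under eq_fun do rewrite addr0.
have bS : BL (fun t => sin (dotp a t) * F t).
  apply: BLM => //; have := BL_cos_dotp a (- (pi / 2)).
  by under eq_fun do rewrite cosBpihalf.
have T0' := ltW T0.
have -> : box_integral T (fun t => F t * cos (dotp a t + c)) = cos c * C + (- sin c) * S.
  rewrite /C /S !box_integralE.
  rewrite -(wboxZ _ (fun=> weight1 T0') bC) -(wboxZ _ (fun=> weight1 T0') bS).
  rewrite -(wboxD (fun=> weight1 T0')); try by apply: BLM => //; exact: BL_cst.
  by congr wbox; apply/funext => t; rewrite cosD; ring.
have T0d : 0 < T ^+ d by rewrite exprn_gt0.
rewrite mulrA -[2 * _ * _]mulrA mulfV ?lt0r_neq0// mulr1.
have sC : `|C| <= Num.sqrt (C ^+ 2 + S ^+ 2).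
  by rewrite -sqrtr_sqr ler_sqrt ?addr_ge0 ?sqr_ge0// lerDl sqr_ge0.
have sS : `|S| <= Num.sqrt (C ^+ 2 + S ^+ 2).
  by rewrite -(sqrtr_sqr S) ler_sqrt ?addr_ge0 ?sqr_ge0// lerDr sqr_ge0.
rewrite (le_trans (ler_normD _ _))// mulr_natl mulr2n !normrM normrN lerD//.
  by rewrite (le_trans _ sC)// ler_piMl// cos_max.
by rewrite (le_trans _ sS)// ler_piMl// sin_max.
Qed.

End Orbit.

Section Level.
Variables (R : realType) (n d : nat) (Gamma : groupClosed (SL R n)).
Variables (mX : probability (borel_hspace Gamma) R) (B : seq 'M[R]_n) (b : R).
Hypothesis cX : compact [set: hspace Gamma].
Hypothesis trB : forall Y, Y \in B -> \tr Y = 0.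
Hypothesis eqd : equidistribution_exponent d mX B b.

Lemma prod_drop_le (m : 'I_d -> R) (T : R) i : 1 <= T ->
  (forall j, 0 < m j <= 2 * T) -> \prod_j m j / m i <= (2 * T) ^+ d / T.
Proof.
move=> T1 hm; have T0 : 0 < T by exact: lt_le_trans T1.
have /andP[mi0 _] := hm i.
rewrite (bigD1 i)//= mulrAC mulfV ?lt0r_neq0// mul1r ler_pdivlMr//.
rewrite -[d in _ ^+ d]card_ord -prodr_const [leRHS](bigD1 i)//= mulrC.
apply: ler_pM; first exact: ltW.
- by apply: prodr_ge0 => j _; have /andP[/ltW] := hm j.
- lra.
- by apply: ler_prod => j _; have /andP[/ltW-> ->] := hm j.
Qed.

(** The points whose coordinates are multiples of [q i] are sampled by the product of
  Jackson kernels of period [q i], which is a combination of characters with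
  coefficients of total size [O(H ^ d)]: equidistribution twisted by characters
  bounds the integral of the centred function. The larger [H] is, the more precise
  is the sampling and the more expensive is the expansion. *)
Lemma level_of_distribution (f : hspace Gamma -> R) :
  smooth f -> (forall x, 0 <= f x) ->
  exists Cf T1 : R, [/\ 0 < Cf, 1 <= T1 &
    forall (u : horo_flow n d) T x0 (q : 'I_d -> nat) (H : nat),
      T1 <= T -> (forall i, (0 < q i)%N) -> (0 < H)%N ->
      `|\sum_(k : {ffun 'I_d -> 'I_(Num.truncn T).+1} | [forall i, (q i %| k i)%N])
           f (ract x0 (horo u (\row_i (k i)%:R)))
        - space_avg mX f * \prod_i (T / (q i)%:R)|
      <= Cf * (H%:R ^+ d * (T ^+ d * T `^ (- b)) + (\prod_i (T / (q i)%:R)) / H%:R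
               + T ^+ d / T)].
Proof.
move=> sf f0; have [C [T0 [C0 hE]]] := eqd.
have [M M0 hM] := smooth_bounded cX sf.
have [L L0 hL] := orbit_lipschitz d cX sf.
have [S S0 hS] := sobolev_norm_fin cX mX ((n * n.-1) %/ 2) trB sf.
set a := space_avg mX f; have a0 : 0 <= a by exact: space_avg_ge0.
pose K1 : R := 16 ^+ d * (2 * (C * S)); pose K2 : R := d%:R * (3 * L).
pose K3 : R := 2 ^+ d * (d%:R * (3 * L) + d%:R * (2 * (M + a)) + a).
have M0' := ltW M0; have C0' := ltW C0.
have K10 : 0 <= K1 by rewrite !mulr_ge0// exprn_ge0.
have K20 : 0 <= K2 by rewrite !mulr_ge0.
have K30 : 0 <= K3 by rewrite mulr_ge0 ?exprn_ge0// !addr_ge0// !mulr_ge0// addr_ge0.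
exists (K1 + K2 + K3 + 1), (Num.max 1 T0); split.
- by rewrite ltr_wpDl// !addr_ge0.
- by rewrite le_max lexx.
move=> u T x0 q H; rewrite ge_max => /andP[T1 TT0] q0 H0.
have Tp : 0 < T by exact: lt_le_trans T1.
have Tp' := ltW Tp.
have q0' i : 0 < (q i)%:R :> R by rewrite ltr0n.
have q1 i : 1 <= (q i)%:R :> R by rewrite ler1n.
have H0' : 0 < H%:R :> R by rewrite ltr0n.
(* the kernels have their peaks at midpoints of periods, hence the shift by [c] *)
pose c (i : 'I_d) : R := (q i)%:R / 2.
pose x1 := ract x0 (horo u (- \row_i c i)).
pose F (t : 'rV[R]_d) := f (ract x1 (horo u t)) - a.
have bF : bl (M + a) L F.
  split=> [t|s t]; first by rewrite (le_trans (ler_normB _ _))// lerD ?hM// ger0_norm.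
  by rewrite /F opprB addrA subrK; exact: hL.
have BF : BL F by exists (M + a), L.
pose h i := (q i * H)%N.
have h0 i : (0 < h i)%N by rewrite muln_gt0 q0.
pose X i : R := T / (q i)%:R.
pose m i : R := X i + 1.
have X0 i : 0 <= X i by rewrite divr_ge0// ltW.
have XT i : X i <= T by rewrite ler_pdivrMr// ler_peMr.
have m0 i : 0 < m i by rewrite ltr_wpDl.
have m2T i : m i <= 2 * T by have := XT i; rewrite /m; lra.
have hw i : weight T (@jackson R (q i) (h i)) (m i) by exact: jackson_weight.
pose e (i : 'I_d) (k : nat) : R := (q i %| k)%N%:R.
have tr i : Num.truncn (X i) = (Num.truncn T %/ q i)%N by exact: truncn_divn.
have eE i : \sum_(k < (Num.truncn T).+1) e i k = (Num.truncn (X i)).+1%:R.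
  rewrite (eq_bigr (fun k : 'I_ _ => 1 * e i k)); last by move=> k _; rewrite mul1r.
  by rewrite (sum_multiples (q0 i) (fun=> 1)) sumr_const card_ord tr.
have em i : \sum_(k < (Num.truncn T).+1) e i k <= m i.
  by rewrite eE -natr1 lerD2r; have /andP[] := truncn_itv (X0 i).
have e0 i k : 0 <= e i k by exact: ler0n.
have samp := wbox_sample (T := T) (N := Num.truncn T) (c := c) hw e0 em
  (fun i g B L gB gL => jackson_sample_multiples (q0 i) (h0 i) Tp' gB gL) L0 bF.
set A := \sum_(k | _) _.
pose cnt : R := \prod_i (Num.truncn (X i)).+1%:R.
have wsumF : wsum (Num.truncn T) e c F = A - a * cnt.
  rewrite wsumE /cnt; under [X in _ - _ * X]eq_bigr do rewrite -eE.
  rewrite bigA_distr_bigA/= mulr_sumr {1}/A [X in X - _]big_mkcond/= -sumrB.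
  apply: eq_bigr => k _.
  have -> : \prod_i e i (k i) = [forall i, (q i %| k i)%N]%:R.
    case: forallP => [hk|hk].
      by rewrite big1// => i _; rewrite /e hk.
    have [i hi] : exists i, ~~ (q i %| k i)%N.
      by apply/existsP; rewrite -negb_forall; apply/negP => /forallP.
    by rewrite (bigD1 i)//= /e (negbTE hi) mul0r.
  rewrite /F /x1 ractM -horoD.
  have -> : - (\row_i c i) + \row_i ((k i)%:R + c i) = \row_i (k i)%:R :> 'rV[R]_d.
    by apply/rowP => i; rewrite !mxE addrC addrK.
  by case: forallP => _ /=; rewrite ?mulr1 // !mulr0 subrr.
have wboxF : `|wbox T (fun i => @jackson R (q i) (h i)) F| <=
    K1 * (H%:R ^+ d * (T ^+ d * T `^ (- b))).
  rewrite (wbox_absorb Tp' hw) //; last by move=> i; exact: jackson_BL.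
  have tp : trigpoly ((16 * H%:R) ^+ d)
      (fun t : 'rV[R]_d => \prod_i jackson (q i) (h i) (t ord0 i)).
    apply: trigpoly_prod => i; have := @jackson_trigpoly R _ _ (q0 i) (h0 i) d i.
    by rewrite /h natrM mulrCA mulrAC mulfV ?lt0r_neq0// mul1r.
  have d0 : 0 <= 2 * T ^+ d * (C * T `^ (- b) * S).
    by rewrite !mulr_ge0 ?exprn_ge0 ?powR_ge0.
  apply: (le_trans (box_trigpoly Tp' BF tp d0 _)).
    move=> a' c'; apply: le_trans (box_twisted _ _ Tp BF) _.
    rewrite ler_wpM2l ?mulr_ge0 ?exprn_ge0// -lee_fin.
    apply: (le_trans (hE u T f x1 a' TT0 sf)); rewrite EFinM.
    by apply: lee_wpmul2l hS; rewrite lee_fin mulr_ge0// powR_ge0.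
  rewrite le_eqVlt; apply/orP; left; apply/eqP.
  by rewrite /K1 exprMn; ring.
have PmX : \prod_i m i <= \prod_i X i + (2 * T) ^+ d / T.
  by apply: prod_shift_le => // i; rewrite X0 XT.
have err : (\prod_i m i) * \sum_i (L * (3 * T / (h i)%:R) + 2 * (M + a)) / m i <=
    K2 * ((\prod_i X i) / H%:R) +
    (d%:R * (3 * L) + d%:R * (2 * (M + a))) * ((2 * T) ^+ d / T).
  have D0 : 0 <= (2 * T) ^+ d / T by rewrite divr_ge0// exprn_ge0// mulr_ge0.
  have Pm0 : 0 <= \prod_i m i by apply: prodr_ge0 => i _; exact: ltW.
  apply: (@le_trans _ _ (\sum_(i < d) (3 * L / H%:R * (\prod_i m i) +
     2 * (M + a) * ((2 * T) ^+ d / T)))).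
    rewrite mulr_sumr; apply: ler_sum => i _.
    rewrite (_ : _ * _ = 3 * L / H%:R * (\prod_i m i) * (X i / m i) +
        2 * (M + a) * ((\prod_i m i) / m i)); last first.
      by rewrite /X /h natrM; field; rewrite !lt0r_neq0.
    rewrite lerD//.
      rewrite ler_piMr//; first by rewrite mulr_ge0// divr_ge0 ?ler0n// mulr_ge0.
      by rewrite ler_pdivrMr// mul1r /m lerDl.
    rewrite ler_wpM2l//; first by rewrite mulr_ge0// addr_ge0.
    by apply: prod_drop_le => // j; rewrite m0 m2T.
  rewrite sumr_const card_ord -[_ *+ d]mulr_natl mulrDr.
  apply: (@le_trans _ _ (d%:R * (3 * L / H%:R * (\prod_i X i + (2 * T) ^+ d / T)) +
     d%:R * (2 * (M + a) * ((2 * T) ^+ d / T)))).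
    rewrite lerD2r ler_wpM2l// ler_wpM2l//.
    by rewrite divr_ge0 ?ler0n// mulr_ge0.
  rewrite (_ : d%:R * (3 * L / H%:R * _) = K2 * ((\prod_i X i) / H%:R) +
    d%:R * (3 * L) * (((2 * T) ^+ d / T) / H%:R)); last by rewrite /K2; ring.
  rewrite -addrA lerD2l; set Y := _ / T in D0 *.
  have YH : Y / H%:R <= Y by rewrite ler_pdivrMr// ler_peMr// ler1n.
  have k0 : 0 <= d%:R * (3 * L) by rewrite !mulr_ge0.
  have := ler_wpM2l k0 YH; lra.
have cntX : `|cnt - \prod_i X i| <= (2 * T) ^+ d / T.
  have c1 : \prod_i X i <= cnt.
    apply: ler_prod => i _; rewrite X0/=.
    by have /andP[_ /ltW] := truncn_itv (X0 i).
  rewrite ger0_norm ?subr_ge0// lerBlDl (le_trans _ PmX)//.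
  apply: ler_prod => i _; rewrite ler0n/= -natr1 lerD2r.
  by have /andP[] := truncn_itv (X0 i).
have -> : A - a * \prod_i X i = (A - a * cnt) + a * (cnt - \prod_i X i) by ring.
have E1 : `|A - a * cnt| <= K1 * (H%:R ^+ d * (T ^+ d * T `^ (- b))) +
    (K2 * ((\prod_i X i) / H%:R) +
    (d%:R * (3 * L) + d%:R * (2 * (M + a))) * ((2 * T) ^+ d / T)).
  rewrite -wsumF -[X in `|X|](subrK (wbox T (fun i => @jackson R (q i) (h i)) F)).
  rewrite addrC (le_trans (ler_normD _ _))// lerD// distrC.
  exact: le_trans samp err.
have E2 : `|a * (cnt - \prod_i X i)| <= a * ((2 * T) ^+ d / T).
  by rewrite normrM (ger0_norm a0) ler_wpM2l.
rewrite (le_trans (ler_normD _ _))// (le_trans (lerD E1 E2))//.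
pose P1 := H%:R ^+ d * (T ^+ d * T `^ (- b)).
pose P2 := (\prod_i X i) / H%:R; pose P3 := T ^+ d / T.
have P10 : 0 <= P1 by rewrite /P1 !mulr_ge0 ?exprn_ge0 ?powR_ge0.
have P20 : 0 <= P2 by rewrite /P2 divr_ge0// prodr_ge0.
have P30 : 0 <= P3 by rewrite /P3 divr_ge0// exprn_ge0.
rewrite -[leRHS]/((K1 + K2 + K3 + 1) * (P1 + P2 + P3)).
apply: (@le_trans _ _ (K1 * P1 + K2 * P2 + K3 * P3)).
  rewrite le_eqVlt; apply/orP; left; apply/eqP.
  by rewrite exprMn /K3 /P1 /P2 /P3; ring.
rewrite -subr_ge0 (_ : _ - _ = K1 * (P2 + P3) + K2 * (P1 + P3) + K3 * (P1 + P2) +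
  (P1 + P2 + P3)); last by ring.
by repeat first [assumption | apply: addr_ge0 | apply: mulr_ge0].
Qed.

End Level.

(** * Mertens' theorems *)

Section Mertens.
Variable R : realType.
Implicit Types (N p n : nat).

Notation lnn n := (ln (n%:R : R)).

Lemma lnn_ge0 n : 0 <= lnn n.
Proof. by case: n => [|n]; [rewrite ln0|rewrite ln_ge0// ler1n]. Qed.

Lemma lnn_le m n : (m <= n)%N -> lnn m <= lnn n.
Proof.
case: m => [|m] mn; first by rewrite (ln0 (lexx 0)) lnn_ge0.
by rewrite ler_ln ?posrE ?ltr0n ?ler_nat// (leq_trans _ mn).
Qed.

Lemma ln_prodn (I : Type) (r : seq I) (P : pred I) (F : I -> nat) :
  (forall i, (0 < F i)%N) ->
  lnn (\prod_(i <- r | P i) F i)%N = \sum_(i <- r | P i) lnn (F i).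
Proof.
move=> F0; pose Q (x : nat) (y : R) := (0 < x)%N /\ lnn x = y.
suff : Q (\prod_(i <- r | P i) F i)%N (\sum_(i <- r | P i) lnn (F i)) by case.
apply: (big_ind2 Q); first by split=> //; rewrite ln1.
  move=> x1 y1 x2 y2 [x10 <-] [x20 <-]; split; first by rewrite muln_gt0 x10.
  by rewrite natrM lnM// posrE ltr0n.
by move=> i _; split.
Qed.

Lemma lnn_logn n M : (0 < n <= M)%N ->
  lnn n = \sum_(0 <= p < M.+1 | prime p) (logn p n)%:R * lnn p.
Proof.
move=> /andP[n0 nM]; rewrite -{1}(partnT n0) (widen_partn _ nM) ln_prodn => [|p].
  rewrite [LHS]big_mkcond [RHS]big_mkcond; apply: eq_bigr => p _ /=.
  case: ifPn => pp; first by rewrite natrX lnXn ?ltr0n ?prime_gt0// mulr_natl.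
  by rewrite lognE (negbTE pp) expn0 ln1.
have [->|p0] := posnP p; first by rewrite lognE.
by rewrite expn_gt0 p0.
Qed.

Lemma sumr_nat_widen (F : nat -> R) m n : (m <= n)%N -> (forall p, 0 <= F p) ->
  \sum_(0 <= p < m) F p <= \sum_(0 <= p < n) F p.
Proof.
move=> mn F0; rewrite [leRHS](big_cat_nat (n := m))//= lerDl.
by apply: sumr_ge0.
Qed.

Definition theta N : R := \sum_(0 <= p < N.+1 | prime p) lnn p.

Lemma bin_half_le N : ('C(N, N./2) <= 4 ^ N./2)%N.
Proof.
have E : (\sum_(i < N.+1) 'C(N, i) = 2 ^ N)%N.
  by rewrite (expnDn 1 1); apply: eq_bigr => i _; rewrite !exp1n !muln1.
have h1 : (N./2 < N.+1)%N by rewrite ltnS; lia.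
have hN := odd_double_half N.
have e4 : (4 ^ N./2 = 2 ^ (N./2).*2)%N by rewrite -mul2n expnM.
case oN : (odd N) in hN.
  have h2 : ((N./2).+1 < N.+1)%N by lia.
  have : ('C(N, N./2) + 'C(N, (N./2).+1) <= 2 ^ N)%N.
    rewrite -E (bigD1 (Ordinal h1))//= (bigD1 (Ordinal h2))/=; last first.
      by rewrite -val_eqE /=; lia.
    by rewrite addnA leq_addr.
  have -> : 'C(N, (N./2).+1) = 'C(N, N./2).
    by rewrite -bin_sub; [congr 'C(_, _); lia|lia].
  by rewrite e4 -[in (2 ^ N)%N]hN add1n expnS; lia.
rewrite e4 -[X in (_ <= 2 ^ X)%N](add0n) (_ : (0 + _ = N)%N); last by lia.
by rewrite -E (bigD1 (Ordinal h1))//= leq_addr.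
Qed.

(** Chebyshev's bound: the primes between [N / 2] and [N] divide a central binomial
  coefficient, which is at most [4 ^ (N / 2)]. *)
Lemma theta_le N : theta N <= N%:R * ln 4.
Proof.
have l4 : 0 <= ln (4 : R) by rewrite ln_ge0// ler1n.
elim/ltn_ind: N => N IH; have [N1|N1] := leqP N 1.
  rewrite /theta big1_seq ?mulr_ge0// => p; rewrite mem_index_iota => /and3P[pp _].
  by have := prime_gt1 pp; lia.
set m := N./2; have hm : (0 < m)%N by rewrite /m; lia.
have hmN : (m <= N - m)%N by rewrite /m; lia.
have mN : (m <= N)%N by lia.
have IHm := IH (N - m)%N (ltac:(lia)).
set C := 'C(N, m); have C0 : (0 < C)%N by rewrite bin_gt0.
have dv p : prime p -> (N - m < p <= N)%N -> (0 < logn p C)%N.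
  move=> pp /andP[p1 p2]; rewrite logn_gt0 mem_primes pp C0/=.
  have : (p %| C * (m`! * (N - m)`!))%N by rewrite bin_fact// dvdn_fact// prime_gt0.
  have ndiv k : (k < p)%N -> (p %| k`!)%N = false.
    move=> kp; apply/negbTE; rewrite fact_prod Euclid_dvd_prod//.
    rewrite big_nat_cond; elim/big_ind: _ => //; first by move=> x y /negbTE-> /negbTE->.
    move=> i /andP[/andP[i1 ik] _]; apply/negP => /dvdn_leq; lia.
  by rewrite !Euclid_dvdM// !ndiv ?orbF//; lia.
have tC : \sum_((N - m).+1 <= p < N.+1 | prime p) lnn p <= m%:R * ln 4.
  apply: (@le_trans _ _ (lnn C)); last first.
    apply: le_trans (lnn_le (bin_half_le N)) _.
    by rewrite natrX lnXn ?ltr0n// mulr_natl.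
  have CM : (0 < C <= maxn N C)%N by rewrite C0 leq_maxr.
  rewrite (lnn_logn CM) big_mkcond/= [leRHS]big_mkcond/=.
  apply: (@le_trans _ _ (\sum_(0 <= p < N.+1) if prime p then (logn p C)%:R * lnn p else 0)).
    rewrite [leRHS](big_cat_nat (n := (N - m).+1))//=; last by lia.
    rewrite -[leLHS]add0r lerD//.
      by apply: sumr_ge0 => p _; case: ifP => // _; rewrite mulr_ge0// lnn_ge0.
    rewrite big_nat_cond [leRHS]big_nat_cond; apply: ler_sum => p /andP[hp _].
    case: ifP => // pp; rewrite ler_peMl ?lnn_ge0// ler1n; exact: dv.
  apply: sumr_nat_widen; first by rewrite ltnS leq_maxl.
  by move=> p; case: ifP => // _; rewrite mulr_ge0// lnn_ge0.
rewrite /theta (big_cat_nat (n := (N - m).+1))//=; last by lia.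
rewrite (_ : N%:R = (N - m)%:R + m%:R :> R); last by rewrite -natrD subnK.
by rewrite mulrDl lerD.
Qed.

Definition mert N : R := \sum_(0 <= p < N.+1 | prime p) lnn p / p%:R.

Lemma lnn_fact N : lnn N`! = \sum_(0 <= p < N.+1 | prime p) (logn p N`!)%:R * lnn p.
Proof.
suff H M : (N <= M)%N -> lnn N`! = \sum_(0 <= p < M.+1 | prime p) (logn p N`!)%:R * lnn p.
  exact: H.
elim: N => [|N IH] NM.
  by rewrite fact0 ln1 big1// => p _; rewrite logn1 mul0r.
rewrite factS natrM lnM ?posrE ?ltr0n ?fact_gt0// (@lnn_logn _ M)//.
rewrite IH; last exact: ltnW.
rewrite -big_split; apply: eq_bigr => p _ /=.
by rewrite lognM ?fact_gt0// natrD mulrDl.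
Qed.

(** The first theorem of Mertens, upper half: in Legendre's formula for [N!] the
  exponent of [p] is at least [N / p - 1], and [theta_le] bounds the rounding. *)
Lemma mert_le N : mert N <= lnn N + 3.
Proof.
case: N => [|N0].
  rewrite /mert big1_seq ?addr_ge0 ?lnn_ge0// => p.
  by rewrite mem_index_iota => /and3P[pp _]; have := prime_gt1 pp; lia.
set N := N0.+1; have N0' : 0 < N%:R :> R by rewrite ltr0n.
have l4 : ln (4 : R) <= 3.
  have -> : 4 = 1 + 3 :> R by lra.
  apply: le_ln1Dx; lra.
have fl : lnn N`! <= N%:R * lnn N.
  have fk k : (k <= N)%N -> (k`! <= N ^ k)%N.
    by elim: k => // k IH kN; rewrite factS expnS leq_mul// IH// ltnW.
  by rewrite mulr_natl -lnXn// -natrX lnn_le// fk.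
have le1 : N%:R * mert N - theta N <= lnn N`!.
  rewrite lnn_fact /mert /theta mulr_sumr -sumrB.
  apply: ler_sum => p pp; have p0 := prime_gt0 pp.
  have p0' : 0 < p%:R :> R by rewrite ltr0n.
  rewrite (_ : _ - _ = (N%:R / p%:R - 1) * lnn p); last by field; exact: lt0r_neq0.
  rewrite ler_wpM2r ?lnn_ge0// logn_fact// big_ltn// expn1 natrD.
  rewrite lerBlDr (@le_trans _ _ ((N %/ p)%:R + 1))//; last by rewrite lerD2r lerDl.
  by rewrite ler_pdivrMr// natr1 -natrM ler_nat ltnW// ltn_ceil.
have th := theta_le N.
rewrite -(ler_pM2l N0').
apply: (@le_trans _ _ (N%:R * lnn N + N%:R * ln 4)); first by lra.
by rewrite -mulrDr ler_wpM2l ?lerD2l// ltW.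
Qed.

Lemma sum_geom_le (x : R) (m : nat) : 0 <= x < 1 ->
  \sum_(1 <= k < m) x ^+ k <= x / (1 - x).
Proof.
move=> /andP[x0 x1]; have x1' : 0 < 1 - x by rewrite subr_gt0.
rewrite ler_pdivlMr// mulr_suml.
have [m1|m1] := leqP m 1; first by rewrite big_geq.
have E : \sum_(1 <= k < m) x ^+ k * (1 - x) = x - x ^+ m.
  rewrite (eq_bigr (fun k => - (x ^+ k.+1 - x ^+ k))); last by move=> k _; rewrite exprS; ring.
  by rewrite sumrN telescope_sumr ?expr1 ?opprB// ltnW.
by rewrite E lerBlDr lerDl exprn_ge0.
Qed.

(** The function [(ln n + 2) / n] decreases by at least the general term. *)
Lemma sum_lnn_le N : \sum_(2 <= n < N.+1) lnn n / (n%:R * (n%:R - 1)) <= 2.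
Proof.
pose phi (n : nat) : R := (lnn n + 2) / n%:R.
have step n : (1 < n)%N -> lnn n / (n%:R * (n%:R - 1)) <= phi n.-1 - phi n.
  case: n => [|[|n]]// _; rewrite /phi/=.
  set a : R := n.+1%:R; have -> : n.+2%:R = a + 1 :> R by rewrite /a natr1.
  have a0 : 0 < a by rewrite ltr0n.
  have a1 : 0 < a + 1 by rewrite addr_gt0.
  have a1' : 1 <= a by rewrite ler1n.
  rewrite addrK.
  have h : ln (a + 1) - ln a <= a^-1.
    rewrite -ln_div ?posrE// mulrDl mulfV ?lt0r_neq0// mul1r.
    by apply: le_ln1Dx; rewrite (lt_trans _ (_ : 0 < a^-1)) ?invr_gt0// ltrN10.
  rewrite -subr_ge0 (_ : _ - _ = (2 - (a + 1) * (ln (a + 1) - ln a)) / ((a + 1) * a)).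
    rewrite divr_ge0 ?mulr_ge0 ?(ltW a0) ?(ltW a1)// subr_ge0.
    rewrite (le_trans (ler_wpM2l (ltW a1) h))// ler_pdivrMr//; lra.
  by field; rewrite !lt0r_neq0.
have [N1|N1] := leqP N 1; first by rewrite big_geq.
apply: (@le_trans _ _ (\sum_(2 <= n < N.+1) - (phi n - phi n.-1))).
  rewrite big_nat_cond [leRHS]big_nat_cond; apply: ler_sum => n /andP[/andP[n1 _] _].
  by rewrite opprB; exact: step.
rewrite sumrN big_add1/= telescope_sumr; last exact: ltnW.
have p1 : phi 1%N = 2 by rewrite /phi ln1 add0r divr1.
have pN : 0 <= phi N by rewrite divr_ge0 ?addr_ge0 ?lnn_ge0.
by rewrite opprB p1 lerBlDr lerDl.
Qed.

(** The lower half: the exponent of [p] in [N!] is at most [N / (p - 1)], and [N!] is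
  at least [(N / e) ^ N]. *)
Lemma mert_ge N : lnn N - 3 <= mert N.
Proof.
have [->|N0] := posnP N.
  rewrite ln0// /mert big1_seq; first by lra.
  by move=> p; rewrite mem_index_iota => /and3P[pp _]; have := prime_gt1 pp; lia.
have N0' : 0 < N%:R :> R by rewrite ltr0n.
have fl n : n%:R * lnn n - n%:R <= lnn n`!.
  elim: n => [|n IH]; first by rewrite mul0r subr0 lnn_ge0.
  have [->|n0] := posnP n; first by rewrite ln1 mulr0 sub0r; lra.
  have n0' : 0 < n%:R :> R by rewrite ltr0n.
  rewrite factS natrM lnM ?posrE ?ltr0n ?fact_gt0//.
  have h : ln (n.+1%:R : R) - lnn n <= n%:R^-1.
    rewrite -ln_div ?posrE ?ltr0n// -[n.+1%:R]natr1 mulrDl mulfV ?lt0r_neq0// mul1r.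
    by apply: le_ln1Dx; rewrite (lt_trans _ (_ : 0 < n%:R^-1)) ?invr_gt0// ltrN10.
  have h2 := ler_wpM2l (ltW n0') h; rewrite mulfV ?lt0r_neq0// in h2.
  set x := lnn n.+1 in h2 *; set v := lnn n`! in IH *.
  by rewrite -[n.+1%:R]natr1; lra.
have up : lnn N`! <= N%:R * (mert N + \sum_(2 <= n < N.+1) lnn n / (n%:R * (n%:R - 1))).
  rewrite lnn_fact.
  apply: (@le_trans _ _ (N%:R * \sum_(0 <= p < N.+1 | prime p) lnn p / (p%:R - 1))).
    rewrite mulr_sumr; apply: ler_sum => p pp; have p1 := prime_gt1 pp.
    have p0 := prime_gt0 pp.
    have p1' : 1 < p%:R :> R by rewrite ltr1n.
    have p0' : 0 < p%:R :> R by rewrite ltr0n.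
    rewrite mulrCA mulrC ler_wpM2l ?lnn_ge0// logn_fact// natr_sum.
    apply: (@le_trans _ _ (N%:R * \sum_(1 <= k < N.+1) p%:R^-1 ^+ k)).
      rewrite mulr_sumr; apply: ler_sum => k _.
      rewrite exprVn -natrX ler_pdivlMr; last by rewrite ltr0n expn_gt0 p0.
      by rewrite -natrM ler_nat leq_divM.
    rewrite ler_wpM2l//; apply: le_trans (sum_geom_le _ _) _.
      by rewrite invr_ge0 ler0n/= invf_lt1.
    rewrite le_eqVlt; apply/orP; left; apply/eqP.
    by field; rewrite subr_eq0 gt_eqF ?lt0r_neq0.
  rewrite ler_wpM2l//.
  have -> : \sum_(0 <= p < N.+1 | prime p) lnn p / (p%:R - 1) =
     mert N + \sum_(0 <= p < N.+1 | prime p) lnn p / (p%:R * (p%:R - 1)).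
    rewrite -big_split; apply: eq_bigr => p pp /=.
    have p0 := prime_gt0 pp; have p1 := prime_gt1 pp.
    have p1' : 1 < p%:R :> R by rewrite ltr1n.
    have p0' : 0 < p%:R :> R by rewrite ltr0n.
    by field; rewrite subr_eq0 gt_eqF ?lt0r_neq0.
  rewrite lerD2l big_mkcond/= (big_cat_nat (n := 2))//=.
  rewrite [X in X + _]big_nat_cond big1 ?add0r; last first.
    by move=> p /andP[/andP[_ p2] _]; case: ifP => // /prime_gt1; lia.
  rewrite big_nat_cond [leRHS]big_nat_cond; apply: ler_sum => n /andP[/andP[n1 _] _].
  case: ifP => // _; rewrite divr_ge0 ?lnn_ge0// mulr_ge0// subr_ge0 ler1n; lia.
have s2 := sum_lnn_le N.
have := le_trans (fl N) up.
rewrite (_ : N%:R * lnn N - N%:R = N%:R * (lnn N - 1)); last by ring.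
rewrite ler_pM2l//; lra.
Qed.

Definition recip N : R := \sum_(0 <= p < N.+1 | prime p) p%:R^-1.

Lemma lnn_gt0 N : (1 < N)%N -> 0 < lnn N.
Proof. by move=> N1; rewrite ln_gt0// ltr1n. Qed.

Lemma ln_le_sub1 (x : R) : 0 < x -> ln x <= x - 1.
Proof. by move=> x0; rewrite -[in ln x](subrKC 1 x) le_ln1Dx; lra. Qed.

(** The second theorem of Mertens, by Abel summation: the increments of [D] below are
  those of [ln (ln N)] up to a telescoping error. *)
Lemma recip_lnln : exists2 c : R, 0 <= c & forall N, (1 < N)%N ->
  `|recip N - ln (lnn N)| <= c.
Proof.
pose D N := recip N - mert N / lnn N.
have DS N : (1 < N)%N -> D N.+1 - D N = mert N * ((lnn N)^-1 - (lnn N.+1)^-1).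
  move=> N1; have a0 := lnn_gt0 N1; have b0 := lnn_gt0 (leqW N1).
  have recr F : \sum_(0 <= p < N.+2 | prime p) F p =
      \sum_(0 <= p < N.+1 | prime p) F p + (if prime N.+1 then F N.+1 else 0) :> R.
    by rewrite big_mkcond big_nat_recr//= -big_mkcond.
  rewrite /D /recip /mert !recr; set A := \sum_(0 <= p < N.+1 | _) p%:R^-1.
  set M := \sum_(0 <= p < N.+1 | _) _; set b := lnn N.+1 in b0 *; set a := lnn N in a0 *.
  have q0 : 0 < N.+1%:R :> R by rewrite ltr0n.
  by case: ifP => _; field; rewrite ?lt0r_neq0.
have step N : (1 < N)%N ->
  D N.+1 - D N <= ln (lnn N.+1) - ln (lnn N) + 3 * ((lnn N)^-1 - (lnn N.+1)^-1) /\
  ln (lnn N.+1) - ln (lnn N) - 4 * ((lnn N)^-1 - (lnn N.+1)^-1) <= D N.+1 - D N.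
  move=> N1; rewrite DS//.
  have N0' : 0 < N%:R :> R by rewrite ltr0n ltnW.
  have ml := mert_le N; have mg := mert_ge N.
  have ba : lnn N.+1 - lnn N <= 1.
    rewrite -ln_div ?posrE ?ltr0n// -?[N.+1%:R]natr1; last exact: ltnW.
    rewrite mulrDl mulfV ?lt0r_neq0// mul1r.
    apply: le_trans (le_ln1Dx _) _; last by rewrite invf_le1// ler1n ltnW.
    by rewrite (lt_trans _ (_ : 0 < N%:R^-1)) ?invr_gt0// ltrN10.
  have ab : lnn N <= lnn N.+1 by apply: lnn_le; rewrite leqnSn.
  set a := lnn N in ml mg ba ab *; set b := lnn N.+1 in ba ab *.
  have a0 : 0 < a by exact: lnn_gt0.
  have b0 : 0 < b by exact: lt_le_trans ab.
  set t := a^-1 - b^-1.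
  have t0 : 0 <= t by rewrite subr_ge0 lef_pV2 ?posrE.
  have l1 : 1 - a / b <= ln b - ln a.
    by rewrite -ln_div ?posrE// -[b / a]invf_div lnV ?posrE ?divr_gt0// lerNr opprB
      ln_le_sub1// divr_gt0.
  have l2 : ln b - ln a <= b / a - 1.
    by rewrite -ln_div ?posrE// ln_le_sub1// divr_gt0.
  have l3 : b / a - 1 - (1 - a / b) <= t.
    rewrite (_ : _ - _ = (b - a) * t); last by rewrite /t; field; rewrite !lt0r_neq0.
    by rewrite ler_piMl.
  have at1 : a * t = 1 - a / b by rewrite /t; field; rewrite !lt0r_neq0.
  have u1 : mert N * t <= (a + 3) * t by rewrite ler_wpM2r.
  have u2 : (a - 3) * t <= mert N * t by rewrite ler_wpM2r.
  by split; lra.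
pose i2 := (lnn 2)^-1; have i20 : 0 < i2 by rewrite invr_gt0 lnn_gt0.
have tele N : (1 < N)%N ->
    D N - D 2 <= ln (lnn N) - ln (lnn 2) + 3 * (i2 - (lnn N)^-1) /\
    ln (lnn N) - ln (lnn 2) - 4 * (i2 - (lnn N)^-1) <= D N - D 2.
  elim: N => [//|[//|[_ _|N IH _]]]; first by rewrite /i2 !subrr; split; lra.
  have [h1 h2] := IH isT; have [h3 h4] := step N.+2 isT; split; lra.
exists (`|D 2 - ln (lnn 2)| + 1 + 8 * i2) => [|N N1].
  by rewrite !addr_ge0 ?mulr_ge0// ltW.
have [h1 h2] := tele N N1; have a0 := lnn_gt0 N1.
have v0 : 0 < (lnn N)^-1 by rewrite invr_gt0.
have v1 : (lnn N)^-1 <= i2 by rewrite lef_pV2 ?posrE ?lnn_gt0// lnn_le.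
have m1 : mert N / lnn N <= 1 + 3 * (lnn N)^-1.
  by rewrite ler_pdivrMr// mulrDl -mulrA mulVf ?lt0r_neq0// mul1r mulr1 mert_le.
have m2 : 1 - 3 * (lnn N)^-1 <= mert N / lnn N.
  by rewrite ler_pdivlMr// mulrBl -mulrA mulVf ?lt0r_neq0// mul1r mulr1 mert_ge.
have -> : recip N = D N + mert N / lnn N by rewrite /D subrK.
have := ler_norm (D 2 - ln (lnn 2)); have := lerNnormlW (lexx `|D 2 - ln (lnn 2)|).
by rewrite ler_norml; lra.
Qed.

Lemma prod_le_expR (I : Type) (r : seq I) (P : pred I) (h : I -> R) :
  (forall i, P i -> h i <= 1) ->
  \prod_(i <- r | P i) (1 - h i) <= expR (- \sum_(i <- r | P i) h i).
Proof.
move=> h1; rewrite -sumrN expR_sum; apply: ler_prod => i Pi.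
by rewrite subr_ge0 h1//= expR_ge1Dx.
Qed.

(** [1 - 1 / p] is at least [exp (- 1 / (p - 1))], and [1 / (p - 1) - 1 / p]
  telescopes. *)
Lemma prod_recip_ge (P : pred nat) m N : (1 < m)%N -> (forall p, P p -> (m <= p)%N) ->
  expR (- (\sum_(0 <= p < N | P p) p%:R^-1 + (m%:R - 1)^-1))
    <= \prod_(0 <= p < N | P p) (1 - p%:R^-1) :> R.
Proof.
move=> m1 Pm; have m1' : 1 < m%:R :> R by rewrite ltr1n.
have tail : \sum_(0 <= p < N | P p) ((p%:R - 1)^-1 - p%:R^-1) <= (m%:R - 1)^-1 :> R.
  have pos p : (m <= p)%N -> 0 <= (p%:R - 1)^-1 - p%:R^-1 :> R.
    move=> mp; have p1 : 1 < p%:R :> R by rewrite (lt_le_trans m1')// ler_nat.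
    by rewrite subr_ge0 lef_pV2 ?posrE ?subr_gt0 ?(lt_trans ltr01)// lerBlDr lerDl.
  have [Nm|mN] := leqP N m.
    rewrite big1_seq ?invr_ge0 ?subr_ge0 ?(ltW m1')// => p.
    by rewrite mem_index_iota => /and3P[/Pm]; lia.
  rewrite big_mkcond (big_cat_nat (n := m)) ?(ltnW mN)//=.
  rewrite [X in X + _]big_nat_cond big1 ?add0r => [|p /andP[/andP[_ pm] _]]; last first.
    by case: ifP => // /Pm; lia.
  pose g (p : nat) : R := (p%:R - 1)^-1.
  apply: (@le_trans _ _ (\sum_(m <= p < N) - (g p.+1 - g p))).
    rewrite big_nat_cond [leRHS]big_nat_cond; apply: ler_sum => p /andP[/andP[mp _] _].
    have -> : - (g p.+1 - g p) = (p%:R - 1)^-1 - p%:R^-1.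
      by rewrite opprB /g -[p.+1%:R]natr1 addrK.
    by case: ifP => // _; rewrite pos.
  rewrite sumrN telescope_sumr ?(ltnW mN)// opprB lerBlDr lerDl invr_ge0 subr_ge0.
  by rewrite ler1n; lia.
apply: (@le_trans _ _ (expR (- \sum_(0 <= p < N | P p) (p%:R - 1)^-1))).
  by rewrite ler_expR lerN2 -lerBlDl -sumrB.
rewrite -sumrN expR_sum; apply: ler_prod => p Pp; rewrite expR_ge0/=.
have p1 : 1 < p%:R :> R by rewrite (lt_le_trans m1')// ler_nat Pm.
have p1' : 0 < p%:R - 1 :> R by rewrite subr_gt0.
rewrite expRN -[leRHS]invrK lef_pV2 ?posrE ?expR_gt0//; last first.
  by rewrite invr_gt0 subr_gt0 invf_lt1 ?(lt_trans ltr01).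
rewrite (_ : (1 - _)^-1 = 1 + (p%:R - 1)^-1) ?expR_ge1Dx//.
by field; rewrite !lt0r_neq0// ?mulr1 ?(lt_trans ltr01)//.
Qed.

Lemma ler_sum_support (F : nat -> R) M N : (forall p, 0 <= F p) ->
  (forall p, (M <= p)%N -> F p = 0) ->
  \sum_(0 <= p < N) F p <= \sum_(0 <= p < M) F p.
Proof.
move=> F0 FM; apply: le_trans (sumr_nat_widen (leq_maxl N M) F0) _.
rewrite (big_cat_nat (n := M)) ?leq_maxr//= [X in _ + X]big_nat_cond.
by rewrite [X in _ + X]big1 ?addr0// => p /andP[/andP[/FM->]].
Qed.

(** On this range [1 / p <= (ln p / p) / ln y], and by the first theorem of Mertens
  the weights [ln p / p] add up to [ln y + 7] at most; the threshold makes
  [7 / ln y] at most [1 / 20]. *)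
Lemma recip_range (y : R) N : expR 140 <= y ->
  \sum_(0 <= p < N | prime p && (y <= p%:R < y ^+ 2)) p%:R^-1 <= 21 / 20 :> R.
Proof.
move=> y140.
have y0 : 0 < y by exact: lt_le_trans (expR_gt0 _) y140.
have ly : 140 <= ln y by rewrite -[leLHS]expRK ler_ln ?posrE ?expR_gt0.
have y141 : 141 <= y.
  by apply: le_trans y140; rewrite (_ : 141 = 1 + 140 :> R) ?expR_ge1Dx//; lra.
set K := Num.truncn y; set M := Num.truncn (y ^+ 2).
have /andP[K1 K2] := truncn_itv (ltW y0); rewrite -/K in K1 K2.
have /andP[M1 M2] := truncn_itv (exprn_ge0 2 (ltW y0)); rewrite -/M in M1 M2.
have K3 : y <= K%:R + 1 by rewrite natr1 ltW.
have K4 : (140 <= K)%N by rewrite -(ler_nat R); lra.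
have KM : (K <= M)%N by rewrite /K /M le_truncn// expr2 ler_peMl ?(ltW y0)//; lra.
clearbody K M; have K5 : (0 < K.-1)%N by case: K K4 {K1 K2 K3 KM} => [|[]].
have K6 : (0 < K)%N by exact: leq_trans K4.
rewrite -(ler_pM2r (_ : 0 < ln y)); last by lra.
apply: (@le_trans _ _ (mert M - mert K.-1)); last first.
  have m1 := mert_le M; have m2 := mert_ge K.-1.
  have l1 : lnn M <= 2 * ln y.
    have [->|M0] := posnP M; first by rewrite ln0//; lra.
    by rewrite mulr_natl -lnXn// ler_ln ?posrE ?ltr0n ?exprn_gt0.
  have l2 : ln y - 1 <= lnn K.-1.
    have e2 : 2 <= expR 1 :> R by rewrite (_ : 2 = 1 + 1)// expR_ge1Dx.
    rewrite -[X in _ - X]expRK -ln_div ?posrE ?expR_gt0//.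
    have kd : 0 < K.-1%:R :> R by rewrite ltr0n.
    have yd : 0 < y / expR 1 by rewrite divr_gt0 ?expR_gt0.
    rewrite ler_ln ?posrE// ler_pdivrMr ?expR_gt0//.
    apply: (@le_trans _ _ (K.-1%:R * 2)); last by rewrite ler_wpM2l.
    have -> : K.-1%:R = K%:R - 1 :> R by rewrite -subn1 natrB.
    lra.
  lra.
have -> : mert M - mert K.-1 = \sum_(K <= p < M.+1 | prime p) lnn p / p%:R.
  rewrite /mert prednK// (big_cat_nat (n := K) (p := M.+1))//=; last exact: leqW.
  by rewrite addrAC subrr add0r.
rewrite mulr_suml big_mkcond; apply: le_trans (@ler_sum_support _ M.+1 _ _ _) _.
- by move=> p; case: ifP => // _; rewrite mulr_ge0//; lra.
- move=> p Mp; case: ifP => // /andP[_ /andP[_ py]]; exfalso.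
  by have := lt_trans py M2; rewrite ltr_nat ltnNge Mp.
rewrite (big_cat_nat (n := K))//=; last exact: leqW.
rewrite [X in X + _]big_nat_cond big1 ?add0r => [|p /andP[/andP[_ pK] _]]; last first.
  case: ifP => // /andP[_ /andP[yp _]]; exfalso.
  have : K%:R <= p%:R :> R by exact: le_trans K1 yp.
  by rewrite ler_nat leqNgt pK.
rewrite [leRHS]big_mkcond/=; apply: ler_sum => p _.
have p0 : 0 <= p%:R^-1 :> R by [].
case: ifP => [/andP[-> /andP[yp _]]|_].
  by rewrite mulrC ler_wpM2r// ler_ln ?posrE// (lt_le_trans y0).
by case: ifP => // _; rewrite mulr_ge0// lnn_ge0.
Qed.

Lemma prod_range (y : R) N : expR 140 <= y ->
  expR (- (11 / 10)) <=
    \prod_(0 <= p < N | prime p && (y <= p%:R < y ^+ 2)) (1 - p%:R^-1) :> R.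
Proof.
move=> y140; have r := recip_range N y140.
have y141 : 141 <= y.
  by apply: le_trans y140; rewrite (_ : 141 = 1 + 140 :> R) ?expR_ge1Dx//; lra.
apply: le_trans (@prod_recip_ge _ 22 N isT _) => [|p /andP[_ /andP[yp _]]].
  have e : (22%:R - 1)^-1 <= 20^-1 :> R by rewrite lef_pV2 ?posrE; lra.
  rewrite ler_expR lerN2; lra.
by rewrite -(ler_nat R); lra.
Qed.

Definition vprod (z : R) : R :=
  \prod_(0 <= p < (Num.truncn z).+1 | prime p && (p%:R < z)) (1 - p%:R^-1).

(** The third theorem of Mertens up to constants, from the second one: the logarithm
  of [1 - 1 / p] differs from [- 1 / p] by the term of a convergent series. *)
Lemma vprod_bounds : exists c1 c2 : R, [/\ 0 < c1, 0 < c2 &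
  forall z, 4 <= z -> c1 / ln z <= vprod z <= c2 / ln z].
Proof.
have [c c0 Hc] := recip_lnln.
exists (expR (- (c + 1))), (2 * expR (c + 1)).
split; rewrite ?mulr_gt0 ?expR_gt0// => z z4.
set N := Num.truncn z.
have z0 : 0 < z by lra.
have /andP[N1 N2] := truncn_itv (ltW z0); rewrite -/N in N1 N2.
have N3 : z <= N%:R + 1 by rewrite natr1 ltW.
have N4 : (1 < N)%N by rewrite -(ltr_nat R); lra.
have lN := lnn_gt0 N4.
have lNz : lnn N <= ln z by rewrite ler_ln// posrE ltr0n ltnW.
have lz : ln z <= 2 * lnn N.
  rewrite mulr_natl -lnXn ?ler_ln ?posrE ?exprn_gt0 ?ltr0n//; try exact: ltnW.
  by rewrite expr2; nra.
have := Hc N N4; rewrite ler_norml => /andP[h1 h2].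
set S := \sum_(0 <= p < N.+1 | prime p && (p%:R < z)) p%:R^-1 : R.
have S1 : S <= recip N.
  rewrite /S /recip big_mkcond [leRHS]big_mkcond; apply: ler_sum => p _ /=.
  by case: (prime p) => //=; case: ifP.
have S2 : recip N - 1 <= S.
  rewrite /S /recip big_mkcond [\sum_(0 <= p < N.+1 | _ && _) _]big_mkcond.
  rewrite !big_nat_recr//= lerBlDr -addrA lerD//.
    rewrite big_nat_cond [leRHS]big_nat_cond; apply: ler_sum => p /andP[/andP[_ pN] _].
    by rewrite (lt_le_trans _ N1) ?ltr_nat// andbT.
  rewrite (@le_trans _ _ 1)//; last by rewrite lerDr; case: ifP.
  by case: ifP => // _; rewrite invf_le1 ?ler1n ?ltr0n// ltnW.
have lnlz : ln z > 0 by exact: lt_le_trans lNz.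
apply/andP; split.
  apply: le_trans (@prod_recip_ge _ 2 _ isT _); last first.
    by move=> p /andP[/prime_gt1].
  rewrite -/S (@le_trans _ _ (expR (- (c + 1) - ln (lnn N))))//.
    by rewrite expRD ler_wpM2l ?expR_ge0// expRN lnK ?posrE// lef_pV2 ?posrE.
  rewrite ler_expR (_ : (2%:R - 1)^-1 = 1 :> R); last by rewrite -(natrB _ (isT : 1 <= 2)%N) invr1.
  lra.
apply: le_trans (prod_le_expR _ _) _ => [p /andP[pp _]|].
  by rewrite invf_le1 ?ler1n ?ltr0n prime_gt0.
rewrite -/S (@le_trans _ _ (expR (c + 1 - ln (lnn N))))//.
  by rewrite ler_expR; lra.
rewrite expRD expRN lnK ?posrE// [2 * _]mulrC -mulrA ler_wpM2l ?expR_ge0//.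
by rewrite ler_pdivlMr// mulrC ler_pdivrMr.
Qed.

End Mertens.

(** * Bonferroni's inequalities *)

Section Bonferroni.
Import mathcomp.boot.finset.
Variables (R : realFieldType) (Q : finType).
Implicit Types (E W : {set Q}) (h : Q -> R).

Lemma sum_subset_setU1 (F : {set Q} -> R) p W : p \notin W ->
  \sum_(E : {set Q} | E \subset p |: W) F E =
  \sum_(E : {set Q} | E \subset W) F E + \sum_(E : {set Q} | E \subset W) F (p |: E).
Proof.
move=> pW; rewrite (bigID (fun E : {set Q} => p \in E))/= addrC; congr (_ + _).
  apply: eq_bigl => E; apply/andP/idP => [[sE pE]|sE].
    apply/fintype.subsetP => x xE; have := fintype.subsetP sE x xE.
    by rewrite !inE => /orP[/eqP xp|//]; rewrite -xp xE in pE.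
  by split; [rewrite (fintype.subset_trans sE)// finset.subsetUr|apply: contra pW; apply/fintype.subsetP].
rewrite (reindex_onto (fun E => p |: E) (fun E => E :\ p)) => [|E /andP[_ pE]]; last by rewrite setD1K.
apply: eq_bigl => E; rewrite setU11 andbT; apply/andP/idP => [[sE /eqP EE]|sE].
  rewrite -EE; apply/fintype.subsetP => x; rewrite in_setD1 => /andP[xp xE].
  by have := fintype.subsetP sE x xE; rewrite !inE (negbTE xp).
split; first by rewrite finset.setUS.
by rewrite setU1K//; apply: contra pW; apply/fintype.subsetP.
Qed.

Definition elem_sym W r h : R :=
  \sum_(E : {set Q} | E \subset W) (#|E| == r)%:R * \prod_(p in E) h p.

Definition bonf W r h : R :=
  \sum_(E : {set Q} | E \subset W) (#|E| <= r)%:R * (-1) ^+ #|E| * \prod_(p in E) h p.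

Lemma elem_sym0 W h : elem_sym W 0 h = 1.
Proof.
rewrite /elem_sym (bigD1 finset.set0)/= ?finset.sub0set// cards0 eqxx big_set0 mulr1 big1 ?addr0//.
by move=> E /andP[_]; rewrite -cards_eq0 => /negbTE->; rewrite mul0r.
Qed.

Lemma elem_symU1 W r h p : p \notin W ->
  elem_sym (p |: W) r.+1 h = elem_sym W r.+1 h + h p * elem_sym W r h.
Proof.
move=> pW; rewrite /elem_sym sum_subset_setU1//; congr (_ + _); rewrite mulr_sumr.
apply: eq_bigr => E sE; have pE : p \notin E by apply: contra pW; apply/fintype.subsetP.
by rewrite cardsU1 pE eqSS big_setU1//= mulrCA.
Qed.

Lemma bonfU1 W r h p : p \notin W ->
  bonf (p |: W) r.+1 h = bonf W r.+1 h - h p * bonf W r h.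
Proof.
move=> pW; rewrite /bonf sum_subset_setU1//; congr (_ + _); rewrite mulr_sumr -sumrN.
apply: eq_bigr => E sE; have pE : p \notin E by apply: contra pW; apply/fintype.subsetP.
rewrite cardsU1 pE ltnS big_setU1//= exprS; ring.
Qed.

Lemma bonf_set0 r h : bonf finset.set0 r h = 1.
Proof.
rewrite /bonf (bigD1 finset.set0)/= ?finset.sub0set// cards0 big_set0 expr0 !mulr1 big1 ?addr0//.
by move=> E /andP[]; rewrite finset.subset0 => ->.
Qed.

Lemma bonf0 W h : bonf W 0 h = 1.
Proof.
rewrite /bonf (bigD1 finset.set0)/= ?finset.sub0set// cards0 big_set0 expr0 !mulr1 big1 ?addr0//.
by move=> E /andP[_]; rewrite -cards_eq0 leqn0 => /negbTE->; rewrite !mul0r.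
Qed.

Lemma elem_sym_ge0 W r h : (forall p, 0 <= h p) -> 0 <= elem_sym W r h.
Proof. by move=> h0; apply: sumr_ge0 => E _; rewrite mulr_ge0// prodr_ge0. Qed.

Lemma set_ind (P : {set Q} -> Prop) :
  P finset.set0 -> (forall p W, p \notin W -> P W -> P (p |: W)) -> forall W, P W.
Proof.
move=> P0 PU W; move: {2}#|W| (erefl #|W|) => k; elim: k W => [|k IH] W.
  by move/eqP; rewrite cards_eq0 => /eqP->.
move=> Wk; have /card_gt0P[p pW] : (0 < #|W|)%N by rewrite Wk.
rewrite -(setD1K pW); apply: PU; first by rewrite setD11.
by apply: IH; move: Wk; rewrite (cardsD1 p) pW => -[].
Qed.

(** When an element [p] is added, the truncation error at length [r] becomes the sum
  of itself and of [h p] times the error at length [r - 1]; signs and bounds are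
  preserved. *)
Lemma bonf_sign W r h : (forall p, 0 <= h p <= 1) ->
  0 <= (-1) ^+ r * (bonf W r h - \prod_(p in W) (1 - h p)) <= elem_sym W r.+1 h.
Proof.
move=> h01; have h0 p : 0 <= h p by case/andP: (h01 p).
elim/set_ind: W r => [|p W pW IH] r.
  by rewrite bonf_set0 big_set0 subrr mulr0 lexx elem_sym_ge0.
rewrite big_setU1//=; set V := \prod_(_ in W) _ in IH *.
have V1 : V <= 1 by rewrite prodr_ile1// => q _; have := h01 q; lra.
have V0 : 0 <= V by apply: prodr_ge0 => q _; have := h01 q; lra.
have /andP[hp0 hp1] := h01 p; case: r => [|r].
  have := IH 0%N; rewrite elem_symU1// bonf0 !expr0 !mul1r bonf0 elem_sym0.
  by move=> /andP[i1 i2]; apply/andP; split; nra.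
have := IH r.+1; have := IH r; rewrite elem_symU1// bonfU1//.
set A := bonf W r h; set B := bonf W r.+1 h; set a := elem_sym _ _ _; set b := elem_sym _ _ _.
rewrite exprS; set s := (-1) ^+ r.
have -> : -1 * s * (B - h p * A - (1 - h p) * V) =
   -1 * s * (B - V) + h p * (s * (A - V)) by ring.
set x := s * (A - V); set y := _ * (B - V) => /andP[x0 xa] /andP[y0 yb].
have i1 : 0 <= h p * x by rewrite mulr_ge0.
have i2 : h p * x <= h p * a by rewrite ler_wpM2l.
by apply/andP; split; lra.
Qed.

Lemma bonferroni W r h : ~~ odd r -> (forall p, 0 <= h p <= 1) ->
  bonf W r h - elem_sym W r.+1 h <= \prod_(p in W) (1 - h p) <= bonf W r h.
Proof.
move=> r2 h01; have := bonf_sign W r h01.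
by rewrite -signr_odd (negbTE r2) expr0 mul1r; lra.
Qed.

(** Bernoulli's inequality in the form [(S + a) ^ r >= S ^ r + r * a * S ^ (r - 1)]. *)
Lemma elem_sym_le W r h : (forall p, 0 <= h p) ->
  elem_sym W r h <= (\sum_(p in W) h p) ^+ r / r`!%:R.
Proof.
move=> h0; elim/set_ind: W r => [|p W pW IH] [|r]; rewrite ?elem_sym0 ?expr0 ?fact0 ?divr1//.
  rewrite /elem_sym big1 ?divr_ge0 ?exprn_ge0 ?sumr_ge0//.
  by move=> E; rewrite finset.subset0 => /eqP->; rewrite cards0 mul0r.
rewrite elem_symU1// big_setU1//=; set S := \sum_(_ in W) _.
have S0 : 0 <= S by apply: sumr_ge0.
have f0 k : 0 < k`!%:R :> R by rewrite ltr0n fact_gt0.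
apply: (@le_trans _ _ (S ^+ r.+1 / r.+1`!%:R + h p * (S ^+ r / r`!%:R))).
  by rewrite lerD// ler_wpM2l.
rewrite ler_pdivlMr// mulrDl divfK ?lt0r_neq0//.
rewrite (_ : _ * _ * r.+1`!%:R = r.+1%:R * h p * S ^+ r); last first.
  by rewrite factS natrM; field; rewrite lt0r_neq0.
elim: r => [|r IHr]; first by rewrite !expr1 expr0; lra.
rewrite [leRHS]exprS (le_trans _ (ler_wpM2l (addr_ge0 (h0 p) S0) IHr))//.
rewrite -subr_ge0 (_ : _ - _ = r.+1%:R * h p * h p * S ^+ r).
  by rewrite !mulr_ge0// exprn_ge0.
by rewrite [S ^+ r.+2]exprS [S ^+ r.+1]exprS -[r.+2%:R]natr1; ring.
Qed.

Lemma elem_sym_small W r h : (#|W| < r)%N -> elem_sym W r h = 0.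
Proof.
move=> Wr; rewrite /elem_sym big1// => E /subset_leq_card EW.
by rewrite ltn_eqF ?mul0r//; exact: leq_ltn_trans Wr.
Qed.

Lemma card_subsets_le W r :
  \sum_(E : {set Q} | E \subset W) (#|E| <= r)%N%:R <= #|W|.+1%:R ^+ r :> R.
Proof.
elim/set_ind: W r => [|p W pW IH] [|r].
- rewrite (big_pred1 finset.set0) ?cards0// => E; exact: subset0.
- rewrite (big_pred1 finset.set0) ?cards0 ?expr1n// => E; exact: subset0.
- rewrite expr0 (bigD1 finset.set0)/= ?sub0set// cards0 big1 ?addr0// => E /andP[_].
  by rewrite -cards_eq0 leqn0 => /negbTE->.
rewrite sum_subset_setU1// cardsU1 pW/=.
rewrite [X in _ + X](eq_bigr (fun E : {set Q} => (#|E| <= r)%N%:R)); last first.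
  move=> E sE; have pE : p \notin E by apply: contra pW; apply/fintype.subsetP.
  by rewrite cardsU1 pE.
apply: le_trans (lerD (IH r.+1) (IH r)) _.
set w : R := #|W|.+1%:R; have -> : (1 + #|W|).+1%:R = w + 1 :> R by rewrite /w natr1.
have w0 : 0 <= w by [].
rewrite !exprS -[X in _ + X]mul1r -mulrDl ler_wpM2l ?addr_ge0//.
by rewrite lerXn2r ?nnegrE ?addr_ge0// lerDl.
Qed.

(** A product of lower bounds is of no use, as they may be negative. Following
  Hooley, the product of the upper bounds is corrected by one factor at a time. *)
Lemma prod_perturb_le (C : finType) (y v g : C -> R) :
  (forall c, 0 <= v c) -> (forall c, y c - g c <= v c <= y c) ->
  \prod_c y c - \sum_c g c * \prod_(c' | c' != c) y c' <= \prod_c v c.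
Proof.
move=> v0 yv; have := index_enum_uniq C; elim: (index_enum C) => [|x s IH].
  by rewrite !big_nil subr0.
rewrite cons_uniq => /andP[xs us]; rewrite !big_cons eqxx/=.
have -> : \prod_(c' <- s | c' != x) y c' = \prod_(c' <- s) y c'.
  by rewrite big_seq_cond [RHS]big_seq; apply: eq_bigl => c; case: eqP => [->|]; rewrite ?andbT// (negbTE xs).
rewrite (_ : \sum_(c <- s) _ = y x * \sum_(c <- s) g c * \prod_(c' <- s | c' != c) y c'); last first.
  rewrite mulr_sumr big_seq [RHS]big_seq; apply: eq_bigr => c cs.
  have xc : x != c by apply: contra xs => /eqP->.
  by rewrite big_cons xc mulrCA.
have := IH us; set A := \prod_(c <- s) y c; set B := \sum_(c <- s) _.
have AV : \prod_(c <- s) v c <= A by apply: ler_prod => c _; rewrite v0; case/andP: (yv c).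
have V0 : 0 <= \prod_(c <- s) v c by apply: prodr_ge0.
set V := \prod_(c <- s) v c in AV V0 * => ABV; have /andP[yv1 yv2] := yv x; have vx := v0 x.
have g0 : 0 <= g x by lra.
apply: (@le_trans _ _ (y x * V - g x * V)); last by rewrite -mulrBl ler_wpM2r.
have -> : y x * A - (g x * A + y x * B) = y x * (A - B) - g x * A by ring.
by rewrite lerB// ler_wpM2l//; apply: le_trans yv2.
Qed.

End Bonferroni.

(** * Expanding a product of local sieves *)

Lemma dvdn_prod_coprime (I : eqType) (s : seq I) (P : pred I) (F : I -> nat) m :
  uniq s -> {in s &, forall i j, P i -> P j -> i != j -> coprime (F i) (F j)} ->
  {in s, forall i, P i -> (F i %| m)%N} -> (\prod_(i <- s | P i) F i %| m)%N.
Proof.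
elim: s => [|i s IH]; first by rewrite big_nil dvd1n.
rewrite cons_uniq => /andP[iS us] co dv; rewrite big_cons.
have IH' : (\prod_(i <- s | P i) F i %| m)%N.
  apply: IH => // [a b aS bS|a aS]; first by apply: co; rewrite inE ?aS ?bS orbT.
  by apply: dv; rewrite inE aS orbT.
case: ifP => // Pi; rewrite Gauss_dvd ?dv ?inE ?eqxx//.
rewrite big_seq_cond; apply: (big_ind (coprime (F i))) => [|a b|j /andP[jS Pj]].
- exact: coprimen1.
- by rewrite coprimeMr => -> ->.
- apply: co; rewrite ?inE ?eqxx ?jS ?orbT//.
  by apply: contra iS => /eqP->.
Qed.

Section Families.
Import mathcomp.boot.finset.
Variables (R : realType) (d J Z : nat) (W : 'I_J -> {set 'I_Z}).
(* a coordinate, and a range of primes by which it is sieved *)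
Notation cell := ('I_d * 'I_J)%type.
Hypothesis primeW : forall j (p : 'I_Z), p \in W j -> prime p.
Hypothesis disjW : forall j j' (p : 'I_Z), p \in W j -> p \in W j' -> j = j'.

Variables (K : finType) (x : K -> 'I_d -> nat) (f : K -> R) (X E1 E2 : R).
Hypotheses (E10 : 0 <= E1) (E20 : 0 <= E2).
Hypothesis level : forall q : 'I_d -> nat, (forall i, (0 < q i)%N) ->
  `|\sum_(k | [forall i, (q i %| x k i)%N]) f k - X * \prod_i (q i)%:R^-1|
    <= E1 + E2 * \prod_i (q i)%:R^-1.

Definition cellsum (w : {set 'I_Z} -> R) (h : 'I_Z -> R) : R :=
  \sum_(E : {set 'I_Z}) w E * \prod_(p in E) h p.

Definition dvd_at (k : K) (i : 'I_d) (p : 'I_Z) : R := (p %| x k i)%N%:R.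

Definition inv_at (p : 'I_Z) : R := p%:R^-1.

Lemma prod_dvd_at (phi : cell -> {set 'I_Z}) k :
  (forall c, phi c \subset W c.2) ->
  \prod_c \prod_(p in phi c) dvd_at k c.1 p =
  [forall i, (\prod_j \prod_(p in phi (i, j)) p %| x k i)%N]%:R.
Proof.
move=> sW; have pr c (p : 'I_Z) : p \in phi c -> prime p /\ p \in W c.2.
  by move=> pc; have pW := fintype.subsetP (sW c) p pc; rewrite (primeW pW).
case: forallP => [dv|ndv].
  rewrite big1// => -[i j] _; rewrite big1// => p pE.
  rewrite /dvd_at/=; have -> // : (p %| x k i)%N.
  apply: dvdn_trans (dv i).
  by rewrite (bigD1 j)//= (bigD1 p)//= -!mulnA dvdn_mulr.
have [//|nz] := eqVneq (\prod_c \prod_(p in phi c) dvd_at k c.1 p) 0.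
exfalso; apply: ndv => i.
have dvp j (p : 'I_Z) : p \in phi (i, j) -> (p %| x k i)%N.
  move=> pE; apply: contraNT nz => np; apply/prodf_eq0; exists (i, j) => //.
  by apply/prodf_eq0; exists p => //; rewrite /dvd_at/= (negbTE np).
have cop c c' (p p' : 'I_Z) : p \in phi c -> p' \in phi c' -> p != p' -> coprime p p'.
  move=> /pr[pp _] /pr[pp' _] np; rewrite prime_coprime// dvdn_prime2//.
apply: dvdn_prod_coprime; rewrite ?index_enum_uniq//.
  move=> j j' _ _ _ _ jj'.
  apply: (big_ind (fun a => coprime a _)) => [|a b|p pE].
  - exact: coprime1n.
  - by rewrite coprimeMl => -> ->.
  apply: (big_ind (coprime p)) => [|a b|p' pE'].
  - exact: coprimen1.
  - by rewrite coprimeMr => -> ->.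
  apply: (cop _ _ _ _ pE pE'); apply/eqP => pp'; subst p'.
  have [_ h1] := pr _ _ pE; have [_ h2] := pr _ _ pE'.
  by move/eqP: jj'; apply; exact: disjW h1 h2.
move=> j _ _; apply: dvdn_prod_coprime; rewrite ?index_enum_uniq//.
- by move=> p p' _ _ pE pE'; apply: (cop _ _ _ _ pE pE').
- by move=> p _; apply: dvp.
Qed.

Lemma sum_subset_prod (V : {set 'I_Z}) (h : 'I_Z -> R) :
  \sum_(E : {set 'I_Z} | E \subset V) \prod_(p in E) h p = \prod_(p in V) (1 + h p).
Proof.
elim/set_ind: V => [|p V pV IH].
  by rewrite big_set0 (big_pred1 set0) ?big_set0// => E; rewrite subset0.
rewrite sum_subset_setU1// big_setU1//= -IH mulrDl mul1r; congr (_ + _).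
rewrite mulr_sumr; apply: eq_bigr => E sE; rewrite big_setU1//.
by apply: contra pV; apply/fintype.subsetP.
Qed.

(** The product over the cells of sums over subsets is a sum over families of
  subsets, one for each cell. A family selects in each coordinate a squarefree
  modulus, because the primes of different ranges differ. The number of families
  weighs the uniform part of the error, and an Euler product the other part. *)
Lemma sieve_weights (w : cell -> {set 'I_Z} -> R) :
  (forall c (E : {set 'I_Z}), ~~ (E \subset W c.2) -> w c E = 0) -> (forall c E, `|w c E| <= 1) ->
  `|\sum_k f k * \prod_c cellsum (w c) (dvd_at k c.1) - X * \prod_c cellsum (w c) inv_at|
    <= E1 * \prod_c \sum_E `|w c E| + E2 * \prod_(c : cell) \prod_(p in W c.2) (1 + inv_at p).
Proof.
move=> w0 w1; rewrite /cellsum.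
rewrite (eq_bigr (fun k => \sum_(phi : {ffun cell -> {set 'I_Z}})
   (\prod_c w c (phi c)) * (f k * \prod_c \prod_(p in phi c) dvd_at k c.1 p))); last first.
  move=> k _; rewrite bigA_distr_bigA mulr_sumr; apply: eq_bigr => phi _.
  by rewrite big_split/= mulrCA.
rewrite exchange_big/= bigA_distr_bigA mulr_sumr -sumrB.
apply: (@le_trans _ _ (\sum_(phi : {ffun cell -> {set 'I_Z}})
   (\prod_c `|w c (phi c)|) * (E1 + E2 * \prod_c \prod_(p in phi c) inv_at p))).
  apply: le_trans (ler_norm_sum _ _ _) _; apply: ler_sum => phi _.
  rewrite big_split/= -mulr_sumr mulrCA -mulrBr normrM normr_prod.
  have [->|nz] := eqVneq (\prod_c `|w c (phi c)|) 0; first by rewrite !mul0r.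
  rewrite ler_wpM2l ?prodr_ge0//.
  have sW c : phi c \subset W c.2.
    by apply: contraNT nz => nE; apply/prodf_eq0; exists c => //; rewrite w0 ?normr0.
  pose q i := (\prod_j \prod_(p in phi (i, j)) p)%N.
  have q0 i : (0 < q i)%N.
    rewrite prodn_gt0// => j; rewrite prodn_cond_gt0// => p pE.
    exact: prime_gt0 (primeW (fintype.subsetP (sW _) _ pE)).
  have -> : \prod_c \prod_(p in phi c) inv_at p = \prod_i (q i)%:R^-1.
    transitivity (\prod_(c : cell) \prod_(p in phi (c.1, c.2)) inv_at p).
      by apply: eq_bigr => -[].
    rewrite -(pair_bigA _ (fun i j => \prod_(p in phi (i, j)) inv_at p))/=.
    apply: eq_bigr => i _; rewrite /q natr_prod -prodfV; apply: eq_bigr => j _.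
    by rewrite natr_prod -prodfV.
  apply: le_trans (level q0); rewrite le_eqVlt; apply/orP; left; apply/eqP.
  congr `|_ - _|; rewrite [RHS]big_mkcond; apply: eq_bigr => k _.
  by rewrite (prod_dvd_at _ sW); case: ifP; rewrite ?mulr1 ?mulr0.
rewrite (eq_bigr (fun phi : {ffun cell -> {set 'I_Z}} => E1 * (\prod_c `|w c (phi c)|) +
  E2 * \prod_c (`|w c (phi c)| * \prod_(p in phi c) inv_at p))); last first.
  by move=> phi _; rewrite big_split/= mulrDr mulrC; congr (_ + _); rewrite mulrCA.
rewrite big_split/= -!mulr_sumr -(bigA_distr_bigA (fun c (E : {set 'I_Z}) => `|w c E|)).
rewrite -(bigA_distr_bigA (fun c (E : {set 'I_Z}) => `|w c E| * \prod_(p in E) inv_at p)).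
rewrite lerD2l.
rewrite ler_wpM2l//; apply: ler_prod => c _; apply/andP; split.
  by apply: sumr_ge0 => E _; rewrite mulr_ge0// prodr_ge0// => p _; rewrite invr_ge0.
rewrite -sum_subset_prod [leRHS]big_mkcond/=; apply: ler_sum => E _.
have p0 : 0 <= \prod_(p in E) inv_at p by apply: prodr_ge0 => p _; rewrite invr_ge0.
case: ifPn => sE; first by rewrite ler_piMl.
by rewrite w0// normr0 mul0r.
Qed.

Variable r : 'I_J -> nat.
Hypothesis r_even : forall j, ~~ odd (r j).
Hypotheses (f0 : forall k, 0 <= f k) (X0 : 0 <= X).

Let bw (c : cell) (E : {set 'I_Z}) : R :=
  (E \subset W c.2)%:R * ((#|E| <= r c.2)%N%:R * (-1) ^+ #|E|).
Let ew (c : cell) (E : {set 'I_Z}) : R :=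
  (E \subset W c.2)%:R * (#|E| == (r c.2).+1)%:R.

Let cellsum_bw c h : cellsum (bw c) h = bonf (W c.2) (r c.2) h.
Proof.
rewrite /cellsum /bonf [RHS]big_mkcond/=; apply: eq_bigr => E _.
by rewrite /bw; case: ifP; rewrite ?mul1r ?mul0r.
Qed.

Let cellsum_ew c h : cellsum (ew c) h = elem_sym (W c.2) (r c.2).+1 h.
Proof.
rewrite /cellsum /elem_sym [RHS]big_mkcond/=; apply: eq_bigr => E _.
by rewrite /ew; case: ifP; rewrite ?mul1r ?mul0r.
Qed.

Let normb (b : bool) : `|b%:R| = b%:R :> R.
Proof. by rewrite ger0_norm. Qed.

Let leb1 (b : bool) : b%:R <= 1 :> R.
Proof. by case: b. Qed.

Let bw_le1 c E : `|bw c E| <= 1.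
Proof.
by rewrite /bw !normrM !normb normrX normrN normr1 expr1n mulr1 mulr_ile1.
Qed.

Let ew_le1 c E : `|ew c E| <= 1.
Proof. by rewrite /ew !normrM !normb mulr_ile1. Qed.

Let sum_bw c : \sum_E `|bw c E| <= #|W c.2|.+1%:R ^+ r c.2.
Proof.
apply: le_trans (card_subsets_le R (W c.2) (r c.2)).
rewrite [leRHS]big_mkcond; apply: ler_sum => E _.
rewrite /bw !normrM !normb normrX normrN normr1 expr1n mulr1.
by case: ifP; rewrite ?mul1r ?mul0r.
Qed.

Let sum_ew c : \sum_E `|ew c E| <= #|W c.2|.+1%:R ^+ (r c.2).+1.
Proof.
apply: le_trans (card_subsets_le R (W c.2) (r c.2).+1).
rewrite [leRHS]big_mkcond; apply: ler_sum => E _.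
rewrite /ew !normrM !normb; case: ifP; rewrite ?mul1r ?mul0r// ler_nat.
by case: eqP => // ->; rewrite leqnn.
Qed.

Let inv_at01 (p : 'I_Z) : 0 <= inv_at p <= 1.
Proof.
rewrite /inv_at invr_ge0 ler0n/=; have [->|p0] := posnP p; first by rewrite invr0.
by rewrite invf_le1 ?ler1n ?ltr0n.
Qed.

Definition euler j : R := \prod_(p in W j) (1 - inv_at p).
Definition excess j : R := elem_sym (W j) (r j).+1 inv_at.

Let inv_at_lt1 j (p : 'I_Z) : p \in W j -> inv_at p < 1.
Proof.
by move=> /primeW pp; rewrite /inv_at invf_lt1 ?ltr1n ?ltr0n ?prime_gt1// prime_gt0.
Qed.

Lemma euler_gt0 j : 0 < euler j.
Proof. by apply: prodr_gt0 => p /inv_at_lt1; rewrite subr_gt0. Qed.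

Definition euler_all := \prod_(c : cell) euler c.2.
(** The losses from truncation in all the cells, relative to the main term. *)
Definition rel_loss := \sum_(c : cell) excess c.2 / euler c.2.

Variables (N z : R).
Hypothesis NP : \prod_(c : cell) #|W c.2|.+1%:R ^+ r c.2 <= N.
Hypothesis zP : forall j, #|W j|.+1%:R <= z.
Hypothesis z1 : 1 <= z.

Definition sieve_err := E1 * (N * z) + E2 / euler_all.

Let sum_mix (w : cell -> {set 'I_Z} -> R) :
  (forall c (E : {set 'I_Z}), ~~ (E \subset W c.2) -> w c E = 0) ->
  (forall c E, `|w c E| <= 1) ->
  \prod_c \sum_E `|w c E| <= N * z ->
  `|\sum_k f k * \prod_c cellsum (w c) (dvd_at k c.1) - X * \prod_c cellsum (w c) inv_at|
    <= sieve_err.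
Proof.
move=> w0 w1 wN; apply: le_trans (sieve_weights w0 w1) _.
rewrite /sieve_err lerD ?ler_wpM2l// /euler_all -prodfV; apply: ler_prod => c _.
have V1 : \prod_(p in W c.2) (1 + inv_at p) * euler c.2 <= 1.
  rewrite -big_split/=; apply: prodr_ile1 => p _; have := inv_at01 p.
  by move=> /andP[a0 a1]; apply/andP; split; nra.
rewrite prodr_ge0/= => [|p _]; last by rewrite addr_ge0//; case/andP: (inv_at01 p).
by rewrite -[leRHS]mul1r ler_pdivlMr ?euler_gt0.
Qed.

Let N_ge0 : 0 <= N.
Proof. by apply: le_trans NP; apply: prodr_ge0 => c _; rewrite exprn_ge0. Qed.


Let err_main :
  `|\sum_k f k * \prod_(c : cell) bonf (W c.2) (r c.2) (dvd_at k c.1)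
    - X * \prod_(c : cell) bonf (W c.2) (r c.2) inv_at| <= sieve_err.
Proof.
rewrite (eq_bigr (fun k => f k * \prod_(c : cell) cellsum (bw c) (dvd_at k c.1))); last first.
  by move=> k _; congr (_ * _); apply: eq_bigr => c _; rewrite cellsum_bw.
rewrite (eq_bigr (fun c : cell => cellsum (bw c) inv_at)); last by move=> c _; rewrite cellsum_bw.
apply: sum_mix => [c E /negbTE nE|//|]; first by rewrite /bw nE mul0r.
apply: le_trans (_ : N <= _); last by rewrite ler_peMr.
by apply: le_trans NP; apply: ler_prod => c _; rewrite sum_bw andbT sumr_ge0.
Qed.

Let prod_mix (F : cell -> R) (a : R) (c0 : cell) :
  \prod_c (if c == c0 then a else F c) = a * \prod_(c | c != c0) F c.
Proof.
by rewrite (bigD1 c0)//= eqxx; congr (_ * _); apply: eq_bigr => c /negbTE->.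
Qed.

Let err_excess (c0 : cell) :
  `|\sum_k f k * (elem_sym (W c0.2) (r c0.2).+1 (dvd_at k c0.1)
        * \prod_(c | c != c0) bonf (W c.2) (r c.2) (dvd_at k c.1))
    - X * (excess c0.2 * \prod_(c | c != c0) bonf (W c.2) (r c.2) inv_at)| <= sieve_err.
Proof.
pose w c := if c == c0 then ew c else bw c.
have wE (h : 'I_d -> 'I_Z -> R) : \prod_c cellsum (w c) (h c.1) =
    elem_sym (W c0.2) (r c0.2).+1 (h c0.1) * \prod_(c | c != c0) bonf (W c.2) (r c.2) (h c.1).
  rewrite -prod_mix; apply: eq_bigr => c _; rewrite /w.
  by case: eqP => [->|]; rewrite ?cellsum_ew ?cellsum_bw.
rewrite (eq_bigr (fun k => f k * \prod_(c : cell) cellsum (w c) (dvd_at k c.1))); last first.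
  by move=> k _; rewrite (wE (dvd_at k)).
rewrite -(wE (fun=> inv_at)).
apply: sum_mix => [c E /negbTE nE|c E|].
- by rewrite /w; case: ifP => _; rewrite /bw /ew nE mul0r.
- by rewrite /w; case: ifP.
apply: (@le_trans _ _ (#|W c0.2|.+1%:R * \prod_(c : cell) #|W c.2|.+1%:R ^+ r c.2)).
  rewrite [X in _ * X](bigD1 c0)//= mulrA -exprS -prod_mix; apply: ler_prod => c _.
  rewrite sumr_ge0//=; rewrite /w; case: eqP => [->|_]; [exact: sum_ew|exact: sum_bw].
by rewrite mulrC ler_pM// ?prodr_ge0// => c _; rewrite exprn_ge0.
Qed.

Definition sifted : R :=
  \sum_k f k * \prod_(c : cell) \prod_(p in W c.2) (1 - dvd_at k c.1 p).

Let dvd_at01 k i p : 0 <= dvd_at k i p <= 1.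
Proof. by rewrite /dvd_at; case: (_ %| _)%N; rewrite ?lexx ler01. Qed.

Let bonf_cell (c : cell) : euler c.2 <= bonf (W c.2) (r c.2) inv_at.
Proof. by case/andP: (bonferroni (W c.2) (r_even c.2) inv_at01). Qed.

(** Each upper bound exceeds [euler] by [excess] at most, and [1 + x <= expR x]. *)
Lemma sifted_le : sifted <= X * euler_all * expR rel_loss + sieve_err.
Proof.
have S1 : sifted <= \sum_k f k * \prod_(c : cell) bonf (W c.2) (r c.2) (dvd_at k c.1).
  apply: ler_sum => k _; rewrite ler_wpM2l//; apply: ler_prod => c _.
  have /andP[_ ->] := bonferroni (W c.2) (r_even c.2) (dvd_at01 k c.1).
  by rewrite andbT prodr_ge0// => p _; rewrite subr_ge0; case/andP: (dvd_at01 k c.1 p).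
have S2 := ler_normlW err_main.
suff S3 : X * \prod_(c : cell) bonf (W c.2) (r c.2) inv_at <= X * euler_all * expR rel_loss by lra.
rewrite -mulrA ler_wpM2l// /rel_loss expR_sum -big_split; apply: ler_prod => c _ /=.
rewrite (le_trans (ltW (euler_gt0 c.2)) (bonf_cell c))/=.
apply: (@le_trans _ _ (euler c.2 * (1 + excess c.2 / euler c.2))).
  have V0 := euler_gt0 c.2; rewrite mulrDr mulr1 mulrCA mulfV ?lt0r_neq0// mulr1.
  have /andP[h _] := bonferroni (W c.2) (r_even c.2) inv_at01.
  by rewrite -lerBlDr; exact: h.
by rewrite ler_wpM2l ?expR_ge1Dx ?(ltW (euler_gt0 _)).
Qed.

(** Each correction of [prod_perturb_le] is a sum over families too, at the price of
  one more prime in one cell, hence of a factor [z] in the error. *)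
Lemma sifted_ge : rel_loss <= 1 ->
  X * euler_all * (1 - rel_loss) - (1 + (d * J)%:R) * sieve_err <= sifted.
Proof.
move=> k1.
pose Yk k (c : cell) := bonf (W c.2) (r c.2) (dvd_at k c.1).
pose Gk k (c : cell) := elem_sym (W c.2) (r c.2).+1 (dvd_at k c.1).
pose Y (c : cell) := bonf (W c.2) (r c.2) inv_at.
have S1 : \sum_k f k * \prod_c Yk k c
    - \sum_c0 \sum_k f k * (Gk k c0 * \prod_(c | c != c0) Yk k c) <= sifted.
  rewrite exchange_big/= -sumrB; apply: ler_sum => k _.
  rewrite -mulr_sumr -mulrBr ler_wpM2l//; apply: prod_perturb_le => c.
    by rewrite prodr_ge0// => p _; rewrite subr_ge0; case/andP: (dvd_at01 k c.1 p).
  exact: bonferroni.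
have S2 : X * \prod_c Y c - sieve_err <= \sum_k f k * \prod_c Yk k c.
  by have := lerNnormlW err_main; rewrite -/(Yk _ _) /Y /Yk; lra.
have S3 : \sum_c0 \sum_k f k * (Gk k c0 * \prod_(c | c != c0) Yk k c) <=
    X * (\prod_c Y c * rel_loss) + (d * J)%:R * sieve_err.
  have -> : (d * J)%:R * sieve_err = \sum_(c0 : cell) sieve_err.
    by rewrite sumr_const card_prod !card_ord mulr_natl.
  rewrite mulr_sumr mulr_sumr -big_split; apply: ler_sum => c0 _ /=.
  have h := ler_normlW (err_excess c0).
  apply: (@le_trans _ _ (X * (excess c0.2 * \prod_(c | c != c0) Y c) + sieve_err)).
    by move: h; rewrite /Gk /Yk /Y; lra.
  rewrite lerD2r ler_wpM2l// [X in _ <= X * _](bigD1 c0)//= [leRHS]mulrAC.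
  have V0 := euler_gt0 c0.2.
  rewrite ler_wpM2r ?prodr_ge0// => [c _|]; first exact: le_trans (ltW (euler_gt0 _)) (bonf_cell c).
  rewrite mulrCA ler_peMr ?ler_pdivlMr ?mul1r ?bonf_cell//.
  by apply: elem_sym_ge0 => p; case/andP: (inv_at01 p).
have S4 : X * euler_all * (1 - rel_loss) <= X * (\prod_c Y c * (1 - rel_loss)).
  rewrite -mulrA ler_wpM2l// ler_wpM2r ?subr_ge0//; apply: ler_prod => c _.
  by rewrite (ltW (euler_gt0 _)) bonf_cell.
lra.
Qed.

End Families.

(** * Choice of the ranges *)

Section Ranges.
Import mathcomp.boot.finset.
Variable R : realType.

Lemma expR_11_10 : expR (11 / 10) <= 33 / 10 :> R.
Proof.
have h : 89 / 100 <= expR (- (11 / 100)) :> R.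
  by apply: le_trans (expR_ge1Dx _); lra.
have h2 : (89 / 100) ^+ 10 <= expR (- (11 / 10)) :> R.
  rewrite (_ : - (11 / 10) = 10%:R * - (11 / 100) :> R); last by field.
  by rewrite expRM_natl lerXn2r ?nnegrE ?expR_ge0.
rewrite -[expR _]invrK -expRN invf_ple ?posrE ?expR_gt0//; lra.
Qed.

(** With [21 / 20] the bound of [recip_range]: two more primes gain a factor [16]. *)
Lemma excess_term_le a : (21 / 20) ^+ (2 * a.+1).+1 / ((2 * a.+1).+1)`!%:R
  <= (1933 / 10000) * (1 / 16) ^+ a :> R.
Proof.
elim: a => [|a IH].
  by rewrite muln1 expr0 mulr1 (_ : 3`! = 6%N)// ler_pdivrMr//; lra.
have -> : (2 * a.+2).+1 = (2 * a.+1).+3 by lia.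
set m := (2 * a.+1).+1 in IH *; have m3 : (3 <= m)%N by rewrite /m; lia.
clearbody m; rewrite factS mulnC factS.
have m0 : 0 < m`!%:R :> R by rewrite ltr0n fact_gt0.
have E : (21 / 20) ^+ m.+2 / (m.+1 * m`! * m.+2)%:R =
    (21 / 20) ^+ m / m`!%:R * ((21 / 20) ^+ 2 / (m.+1 * m.+2)%:R) :> R.
  have a0 : 0 < m.+1%:R :> R by rewrite ltr0n.
  have b0 : 0 < m.+2%:R :> R by rewrite ltr0n.
  rewrite !natrM !exprS; set v := m`!%:R in m0 *; set A := m.+1%:R in a0 *.
  set B := m.+2%:R in b0 *; clearbody v A B.
  by field; rewrite (lt0r_neq0 m0) (lt0r_neq0 a0) (lt0r_neq0 b0).
rewrite E (exprSr (1 / 16) a) [leRHS]mulrA; apply: ler_pM => //.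
rewrite ler_pdivrMr; last by rewrite ltr0n.
have : (20 <= m.+1 * m.+2)%N by rewrite (@leq_mul 4 5)//; lia.
rewrite -(ler_nat R); lra.
Qed.

(** The truncation length [2 * d + 2 * j] is long enough for the losses in all ranges
  and coordinates to stay below 1, which the lower bound sieve requires; the factor
  [expR (11 / 10)] is the inverse of the bound of [prod_range]. *)
Lemma loss_sum_le d J : (0 < d)%N ->
  d%:R * \sum_(j < J) (21 / 20) ^+ (2 * d + 2 * j).+1 / ((2 * d + 2 * j).+1)`!%:R
    * expR (11 / 10) <= 9 / 10 :> R.
Proof.
case: d => // d _.
have d1 : d.+1%:R * (1 / 16) ^+ d <= 1 :> R.
  elim: d => [|d IH]; first by rewrite expr0 mulr1.
  rewrite exprS; apply: le_trans IH; rewrite mulrA ler_wpM2r//.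
  rewrite -[d.+2%:R]natr1 -[d.+1%:R]natr1; have : 0 <= d%:R :> R by []; lra.
have s : \sum_(j < J) (1 / 16) ^+ j <= 16 / 15 :> R.
  suff : 15 / 16 * \sum_(j < J) (1 / 16) ^+ j <= 1 :> R by lra.
  have := subrX1 (1 / 16 : R) J; have : 0 <= (1 / 16) ^+ J :> R by exact: exprn_ge0.
  lra.
rewrite mulr_sumr.
apply: (@le_trans _ _ (\sum_(j < J) 638 / 1000 * (1 / 16) ^+ j)); last first.
  by rewrite -mulr_sumr; lra.
apply: ler_sum => j _.
have -> : (2 * d.+1 + 2 * j).+1 = (2 * (d + j).+1).+1 by lia.
have h := excess_term_le (d + j); have h2 := expR_11_10; have h3 := expR_gt0 (11 / 10 : R).
set u := _ / _ in h *; have u0 : 0 <= u by rewrite divr_ge0.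
have p0 : 0 <= (1 / 16) ^+ j :> R by exact: exprn_ge0.
apply: (@le_trans _ _ (d.+1%:R * (1933 / 10000 * (1 / 16) ^+ (d + j) * (33 / 10)))).
  by rewrite ler_wpM2l// ler_pM// ltW.
rewrite exprD; have := ler_wpM2r p0 d1.
have : 0 <= (1 / 16) ^+ d :> R by exact: exprn_ge0.
clear h u u0; set A := d.+1%:R; set B := _ ^+ d; set C := _ ^+ j in p0 *.
have A0 : 0 <= A by [].
clearbody A B C => B0 hC; have hM : 0 <= A * B * C by rewrite !mulr_ge0.
lra.
Qed.

Definition cut (z : R) j := iter j Num.sqrt z.

Lemma cut_ge1 z j : 1 <= z -> 1 <= cut z j.
Proof. by move=> z1; elim: j => //= j IH; rewrite -sqrtr1 ler_wsqrtr. Qed.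

Lemma cutS z j : 1 <= z -> cut z j.+1 ^+ 2 = cut z j.
Proof. by move=> z1; rewrite sqr_sqrtr// (le_trans ler01)// cut_ge1. Qed.

Lemma cut_le z i j : 1 <= z -> (i <= j)%N -> cut z j <= cut z i.
Proof.
move=> z1 /subnK <-; elim: (j - i)%N => // k IH; apply: le_trans IH.
by rewrite -[leRHS](cutS _ z1) expr2 ler_peMl ?cut_ge1// (le_trans ler01)// cut_ge1.
Qed.

Lemma cut_pow z j : 1 <= z -> cut z j ^+ (2 ^ j) = z.
Proof. by move=> z1; elim: j => [|j IH]; rewrite ?expr1// expnS exprM cutS. Qed.

Lemma cut_exists z w : 1 < w -> w <= z -> exists J, w <= cut z J < w ^+ 2.
Proof.
move=> w1 wz; have z1 : 1 <= z by exact: le_trans (ltW w1) wz.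
have ex : exists J, cut z J < w ^+ 2.
  pose m := Num.truncn (z / (w - 1)); exists m.
  rewrite ltNge; apply/negP => h.
  have w0 : 0 < w - 1 by rewrite subr_gt0.
  have ww : w <= w ^+ 2 by rewrite expr2 ler_peMl ?ltW// (lt_trans ltr01).
  have h2 : w ^+ (2 ^ m) <= z.
    rewrite -[leRHS](cut_pow m z1) lerXn2r ?nnegrE//; first by rewrite ltW// (lt_trans ltr01).
      by rewrite (le_trans ler01) ?cut_ge1.
    exact: le_trans h.
  have bern k : 1 + k%:R * (w - 1) <= w ^+ k.
    elim: k => [|k IH]; first by rewrite mul0r addr0 expr0.
    rewrite exprS -natr1; have k0 : 0 <= k%:R :> R by [].
    apply: le_trans (ler_wpM2l (le_trans ler01 (ltW w1)) IH).
    rewrite -subr_ge0 (_ : _ - _ = k%:R * (w - 1) ^+ 2); last by ring.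
    by rewrite mulr_ge0// sqr_ge0.
  have := le_trans (bern _) h2; rewrite leNgt => /negP; apply.
  have /andP[_] := truncn_itv (divr_ge0 (le_trans ler01 z1) (ltW w0)).
  rewrite -/m ltr_pdivrMr// => h3.
  have h4 : m.+1%:R <= (2 ^ m)%:R :> R by rewrite ler_nat ltn_expl.
  have := ler_wpM2r (ltW w0) h4; lra.
have [J JP Jmin] := ex_minnP ex; exists J; rewrite JP andbT.
case: J JP Jmin => [|J] JP Jmin; first by [].
rewrite leNgt; apply/negP => h; have := Jmin J; rewrite ltnn => /(_ _)/negP; apply => //.
by rewrite -(cutS _ z1) ltrXn2r// ?nnegrE ?(le_trans ler01) ?cut_ge1// ltW.
Qed.

(** The exponents of [cut z j] decay geometrically while the truncation lengths grow
  linearly; the product telescopes with [cut z J ^+ (4 * d + 4 + 4 * J)]. *)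
Lemma cut_level z d J : 1 <= z ->
  \prod_(j < J) cut z j ^+ (2 * d + 2 * j) <= z ^+ (4 * d + 4).
Proof.
move=> z1.
have E : \prod_(j < J) cut z j ^+ (2 * d + 2 * j) * cut z J ^+ (4 * d + 4 + 4 * J)
    = z ^+ (4 * d + 4).
  elim: J => [|J <-]; first by rewrite big_ord0 mul1r addn0.
  rewrite big_ord_recr/= -mulrA; congr (_ * _).
  rewrite (_ : (4 * d + 4 + 4 * J.+1 = 2 * (2 * d + 2 * J + 4))%N); last by lia.
  by rewrite exprM cutS// -exprD; congr (_ ^+ _); lia.
rewrite -E ler_peMr ?exprn_ege1 ?cut_ge1// prodr_ge0// => j _.
by rewrite exprn_ge0// (le_trans ler01)// cut_ge1.
Qed.

End Ranges.

Section Hooley.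
Import mathcomp.boot.finset.
Variable R : realType.
Implicit Types (z : R) (J : nat).

(* the threshold from which [recip_range] holds *)
Notation base := (expR 140 : R).

Lemma base_gt1 : 141 <= base.
Proof. by rewrite (_ : 141 = 1 + 140 :> R) ?expR_ge1Dx//; lra. Qed.

(** The primes below [z] are cut at the iterated square roots of [z]; the last range
  takes all the primes that remain. *)
Definition primes_in z J (j : 'I_J.+1) : {set 'I_(Num.truncn z).+1} :=
  [set p : 'I_(Num.truncn z).+1 |
    prime p && ((if j == J :> nat then 0 else cut z j.+1) <= p%:R < cut z j)]%SET.

Lemma prod_primes_in z J (F : nat -> R) : 1 <= z ->
  \prod_(j < J.+1) \prod_(p in primes_in z j) F p =
  \prod_(p < (Num.truncn z).+1 | prime p && (p%:R < z)) F p.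
Proof.
move=> z1; rewrite big_ord_recr/=.
rewrite [X in _ * X](eq_bigl (fun p : 'I_(Num.truncn z).+1 => prime p && (p%:R < cut z J))); last first.
  by move=> p; rewrite inE/= eqxx ler0n.
rewrite (eq_bigr (fun j : 'I_J => \prod_(p < (Num.truncn z).+1 |
    prime p && (cut z j.+1 <= p%:R < cut z j)) F p)); last first.
  by move=> j _; apply: eq_bigl => p; rewrite inE/= ltn_eqF.
elim: J => [|J IH]; first by rewrite big_ord0 mul1r.
rewrite -IH big_ord_recr/= -mulrA; congr (_ * _).
rewrite [RHS](bigID (fun p : 'I_(Num.truncn z).+1 => cut z J.+1 <= p%:R))/=.
congr (_ * _); apply: eq_bigl => p; first by rewrite -andbA [(_ < _) && _]andbC.
rewrite -ltNge -andbA; congr (_ && _); apply/idP/andP => [h|[]//].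
by split=> //; apply: lt_le_trans h _; exact: cut_le z1 (leqnSn J).
Qed.

Lemma primes_in_prime z J (j : 'I_J.+1) (p : 'I_(Num.truncn z).+1) :
  p \in primes_in z j -> prime p.
Proof. by rewrite inE => /andP[]. Qed.

Lemma primes_in_disj z J (j j' : 'I_J.+1) (p : 'I_(Num.truncn z).+1) : 1 <= z ->
  p \in primes_in z j -> p \in primes_in z j' -> j = j'.
Proof.
move=> z1; wlog jj' : j j' / (j <= j')%N => [H h1 h2|].
  by case/orP: (leq_total j j') => h; [exact: H|apply/esym; exact: H].
rewrite !inE => /and3P[_ h1 _] /and3P[_ _ h2]; apply/val_inj/eqP => /=.
rewrite eqn_leq jj' leqNgt; apply/negP => lt.
have jJ : (j < J)%N by apply: leq_trans lt _; rewrite -ltnS.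
move: h1; rewrite ltn_eqF// => h1.
by have := lt_le_trans (le_lt_trans h1 h2) (cut_le z1 lt); rewrite ltxx.
Qed.

Lemma card_primes_in z J (j : 'I_J.+1) : 1 <= z -> #|primes_in z j|.+1%:R <= cut z j.
Proof.
move=> z1; have c1 := cut_ge1 j z1; have c0 : 0 <= cut z j by exact: le_trans c1.
have /andP[t1 t2] := truncn_itv c0; apply: le_trans t1; rewrite ler_nat.
have t0 : (0 < Num.truncn (cut z j))%N by rewrite truncn_gt0.
rewrite -(prednK t0) ltnS cardE -(size_map val).
rewrite -[leqRHS](size_iota 2) uniq_leq_size ?(map_inj_uniq val_inj) ?enum_uniq//.
move=> p /mapP[q]; rewrite mem_enum inE => /and3P[pq _ qc] ->.
rewrite mem_iota prime_gt1//=; have : (q < (Num.truncn (cut z j)).+1)%N.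
  by rewrite -(ltr_nat R); exact: lt_trans t2.
lia.
Qed.

Let last_trunc := (Num.truncn (base ^+ 2)).*2.

(** The last range has less than [base ^+ 2] primes, so that its inclusion-exclusion is
  complete. *)
Definition truncation d J (j : nat) := if j == J then last_trunc else (2 * d + 2 * j)%N.

Lemma truncation_even d J j : ~~ odd (truncation d J j).
Proof.
by rewrite /truncation; case: ifP => _; rewrite ?odd_double// -mulnDr oddM.
Qed.

Lemma truncation_level z d J : base <= z -> base <= cut z J < base ^+ 2 ->
  \prod_(c : 'I_d * 'I_J.+1) #|primes_in z c.2|.+1%:R ^+ truncation d J c.2
    <= z ^+ (d * (4 * d + 4)) * (base ^+ 2) ^+ (d * last_trunc).
Proof.
move=> zb /andP[cb1 cb2]; have b1 := base_gt1; have z1 : 1 <= z by lra.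
rewrite -(pair_bigA _ (fun (i : 'I_d) (j : 'I_J.+1) => #|primes_in z j|.+1%:R ^+ truncation d J j))/=.
rewrite prodr_const card_ord [(d * _)%N]mulnC [(d * last_trunc)%N]mulnC !exprM -exprMn.
have l0 : 0 <= \prod_(j < J.+1) #|primes_in z j|.+1%:R ^+ truncation d J j :> R.
  by apply: prodr_ge0 => j _; rewrite exprn_ge0.
have z0 : 0 <= z by lra.
have r0 : 0 <= z ^+ (4 * d + 4) * (base ^+ 2) ^+ last_trunc by rewrite mulr_ge0 ?exprn_ge0.
rewrite lerXn2r ?nnegrE// big_ord_recr/= {2}/truncation eqxx; apply: ler_pM.
- by apply: prodr_ge0 => j _; rewrite exprn_ge0.
- exact: exprn_ge0.
- apply: le_trans (cut_level d J z1); apply: ler_prod => j _.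
  rewrite exprn_ge0//= /truncation ltn_eqF// lerXn2r ?nnegrE//.
    by rewrite (le_trans ler01)// cut_ge1.
  exact: card_primes_in.
- rewrite lerXn2r ?nnegrE ?exprn_ge0 ?(ltW (expR_gt0 _))//.
  by apply: le_trans (ltW cb2); exact: card_primes_in.
Qed.

Lemma rel_loss_le z d J : (0 < d)%N -> base <= z -> base <= cut z J < base ^+ 2 ->
  rel_loss R d (@primes_in z J) (truncation d J) <= 9 / 10.
Proof.
move=> d0 zb /andP[cb1 cb2]; have b1 := base_gt1; have z1 : 1 <= z by lra.
rewrite /rel_loss -(pair_bigA _ (fun (i : 'I_d) (j : 'I_J.+1) =>
  excess R (@primes_in z J) (truncation d J) j / euler R (@primes_in z J) j))/=.
rewrite sumr_const card_ord -[leLHS]mulr_natl; apply: le_trans (loss_sum_le R J d0).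
rewrite ler_wpM2l//big_ord_recr/= {2}/excess elem_sym_small; last first.
  rewrite {1}/truncation eqxx ltnS -(leq_add2r 1) !addn1.
  have h := le_lt_trans (card_primes_in (@ord_max J) z1) cb2.
  have h2 : (#|primes_in z (@ord_max J)|.+1 <= Num.truncn (base ^+ 2))%N.
    by rewrite truncn_ge_nat ?exprn_ge0 ?(ltW h)// (ltW (expR_gt0 _)).
  apply: leq_trans h2 _; rewrite /last_trunc -addnn; lia.
rewrite mul0r addr0; apply: ler_sum => j _.
set y := cut z j.+1.
have yb : base <= y by apply: le_trans cb1 _; exact: cut_le z1 (ltn_ord j).
have yy : cut z j = y ^+ 2 by rewrite /y cutS.
have mem (p : 'I_(Num.truncn z).+1) : (p \in primes_in z (widen_ord (leqnSn J) j)) =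
    prime p && (y <= p%:R < y ^+ 2) by rewrite inE/= ltn_eqF// -yy.
have rr := recip_range (Num.truncn z).+1 yb.
have pr := prod_range (Num.truncn z).+1 yb.
rewrite big_mkord in rr; rewrite big_mkord in pr.
rewrite /excess /euler (eq_bigl _ _ mem).
rewrite /truncation ltn_eqF; last exact: ltn_ord j.
have p0 : 0 < expR (- (11 / 10)) :> R by exact: expR_gt0.
rewrite -[expR (11 / 10)]invrK -expRN; apply: ler_pM.
- by apply: elem_sym_ge0 => p; rewrite invr_ge0.
- by rewrite invr_ge0 (le_trans (ltW p0)).
- apply: le_trans (elem_sym_le _ _ _) _ => [p|]; first by rewrite invr_ge0.
  rewrite ler_wpM2r// lerXn2r ?nnegrE ?sumr_ge0// => [p _|]; first by rewrite invr_ge0.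
  by rewrite (eq_bigl _ _ mem).
- by rewrite lef_pV2 ?posrE// (lt_le_trans p0).
Qed.

(** Up to a constant, [truncation_level] bounds the number of families by
  [z ^ (d * (4 * d + 4))]; the corrections need one more factor [z], and there are at
  most [(1 + d) * ln z] terms since the number of ranges is doubly logarithmic. *)
Lemma brun_hooley d : (0 < d)%N -> exists2 A : R, 0 < A &
  forall z (K : finType) (x : K -> 'I_d -> nat) (f : K -> R) (X E1 E2 : R),
    base <= z -> 0 <= X -> 0 <= E1 -> 0 <= E2 -> (forall k, 0 <= f k) ->
    (forall q : 'I_d -> nat, (forall i, (0 < q i)%N) ->
      `|\sum_(k | [forall i, (q i %| x k i)%N]) f k - X * \prod_i (q i)%:R^-1|
        <= E1 + E2 * \prod_i (q i)%:R^-1) ->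
    forall S err : R,
      S = \sum_(k | [forall i, [forall p : 'I_(Num.truncn z).+1,
        (prime p && (p%:R < z)) ==> ~~ (p %| x k i)%N]]) f k ->
      err = A * ln z * (E1 * z ^+ (d * (4 * d + 4)).+1 + E2 / vprod z ^+ d) ->
    X * vprod z ^+ d / 10 - err <= S <= 4 * (X * vprod z ^+ d) + err.
Proof.
move=> d0; have b1 := base_gt1.
pose B := (base ^+ 2) ^+ (d * last_trunc).
have B1 : 1 <= B by rewrite !exprn_ege1//; lra.
exists ((1 + d)%:R * B) => [|z K x f X E1 E2 zb X0 E10 E20 f0 level S err SD errD].
  by rewrite mulr_gt0 ?ltr0n// (lt_le_trans ltr01).
have z1 : 1 <= z by lra.
have [|J cb] := @cut_exists R z base _ zb; first by lra.
have lnz : J.+1%:R <= ln z.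
  have h : base ^+ (2 ^ J) <= z.
    rewrite -[leRHS](cut_pow J z1) lerXn2r ?nnegrE ?(ltW (expR_gt0 _))//.
      by rewrite (le_trans ler01)// cut_ge1.
    by case/andP: cb.
  have h2 : 140 * (2 ^ J)%:R <= ln z.
    rewrite mulr_natr -[leLHS]expRK ler_ln ?posrE ?expR_gt0//; last by lra.
    by rewrite -mulr_natl expRM_natl.
  have h3 : J.+1%:R <= (2 ^ J)%:R :> R by rewrite ler_nat ltn_expl.
  have h4 : 0 <= (2 ^ J)%:R :> R by [].
  lra.
have lnz1 : 1 <= ln z by apply: le_trans lnz; rewrite ler1n.
have W1 := @primes_in_prime z J.
have W2 : forall j j' (p : 'I_(Num.truncn z).+1),
  p \in @primes_in z J j -> p \in primes_in z j' -> j = j'.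
  by move=> j j' p; exact: primes_in_disj.
have zP (j : 'I_J.+1) : #|primes_in z j|.+1%:R <= z.
  by apply: le_trans (card_primes_in j z1) _; exact: cut_le z1 (leq0n j).
have ev (j : 'I_J.+1) := truncation_even d J j.
have NP := truncation_level d zb cb.
have kl := rel_loss_le d0 zb cb.
have vE : vprod z ^+ d = euler_all R d (@primes_in z J).
  rewrite /euler_all -(pair_bigA _ (fun (i : 'I_d) (j : 'I_J.+1) => euler R (@primes_in z J) j))/=.
  rewrite prodr_const card_ord; congr (_ ^+ _).
  by rewrite /vprod big_mkord -(prod_primes_in J (fun p => 1 - p%:R^-1) z1).
have v0 : 0 < vprod z ^+ d.
  by rewrite vE; apply: prodr_gt0 => c _; apply: euler_gt0; exact: W1.
have SE : S = sifted (@primes_in z J) x f.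
  rewrite SD /sifted big_mkcond; apply: eq_bigr => k _.
  rewrite -(pair_bigA _ (fun (i : 'I_d) (j : 'I_J.+1) => \prod_(p in primes_in z j) (1 - dvd_at R x k i p)))/=.
  rewrite (eq_bigr (fun i => \prod_(p < (Num.truncn z).+1 | prime p && (p%:R < z)) (1 - (p %| x k i)%N%:R))); last first.
    by move=> i _; rewrite -(prod_primes_in J (fun p => 1 - (p %| x k i)%N%:R) z1).
  case: ifP => [/forallP h|/negbT].
    rewrite big1 ?mulr1// => i _; rewrite big1// => p pz.
    by have /forallP/(_ p) := h i; rewrite pz => /negbTE->; rewrite subr0.
  rewrite negb_forall => /existsP[i]; rewrite negb_forall => /existsP[p].
  rewrite negb_imply negbK => /andP[pz pk].
  by rewrite (bigD1 i)//= (bigD1 p)//= pk subrr !mul0r mulr0.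
have lo := sifted_ge W1 W2 E10 E20 level ev f0 X0 NP zP z1.
have up := sifted_le W1 W2 E10 E20 level ev f0 X0 NP z1.
rewrite -SE -vE in lo up.
set se := sieve_err _ _ _ _ _ _ in lo up.
have seE : se <= B * (E1 * z ^+ (d * (4 * d + 4)).+1 + E2 / vprod z ^+ d).
  rewrite /se /sieve_err -vE mulrDr lerD//.
    rewrite (exprSr z) -/B; move: (z ^+ _) (B) => u b; rewrite le_eqVlt.
    by rewrite (_ : E1 * _ = b * (E1 * (u * z))) ?eqxx//; ring.
  by rewrite ler_peMl// divr_ge0// ltW.
set T := _ + _ in seE; have T0 : 0 <= T.
  by rewrite addr_ge0 ?divr_ge0 ?(ltW v0)// mulr_ge0// exprn_ge0// (le_trans ler01).
set a := vprod z ^+ d in v0 lo up *; set k := rel_loss _ _ _ _ in kl lo up.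
have BT0 : 0 <= B * T by rewrite mulr_ge0// (le_trans ler01).
have errE : err = (1 + d)%:R * ln z * (B * T) by rewrite errD -/T; ring.
have dlnz : 1 + (d * J.+1)%:R <= (1 + d)%:R * ln z.
  by rewrite natrD natrM mulrDl mul1r lerD// ler_wpM2l.
have err1 : (1 + (d * J.+1)%:R) * se <= err.
  rewrite errE; apply: (@le_trans _ _ ((1 + (d * J.+1)%:R) * (B * T))).
    by rewrite ler_wpM2l ?addr_ge0.
  by rewrite ler_wpM2r.
have err2 : se <= err.
  apply: le_trans seE _; rewrite errE ler_peMl//; apply: le_trans dlnz.
  by rewrite lerDl.
have Xv : 0 <= X * a by rewrite mulr_ge0// ltW.
clear - lo up kl Xv err1 err2; apply/andP; split.
  have k1 : k <= 1 by lra.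
  have := lo k1; have := ler_wpM2l Xv kl; lra.
have e1 : expR k <= 4.
  apply: (@le_trans _ _ (expR (11 / 10))); first by rewrite ler_expR; lra.
  by have := expR_11_10 R; lra.
have := ler_wpM2l Xv e1; lra.
Qed.

End Hooley.

(** * The sifted sum along the horospherical orbit *)

Section ErrorTerm.
Variable R : realType.

(** Half of the room left by the strict inequality [9 * d ^ 2 * alpha < b] is spent on
  the precision [H], a small power of [T]; every error term then gains at least that
  power of [T], which beats the powers of [ln T]. *)
Lemma error_negligible d (alpha b A Cf c1 eps : R) : (0 < d)%N ->
  0 < alpha -> (9 * d ^ 2)%:R * alpha < b -> b < 1 ->
  0 < A -> 0 < Cf -> 0 < c1 -> 0 < eps ->
  exists2 L0 : R, 1 <= L0 & forall L v T : R, L0 <= L -> T = expR L ->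
    c1 / (alpha * L) <= v ->
  exists2 H : nat, (0 < H)%N &
    A * (alpha * L) *
      (Cf * (H%:R ^+ d * (T ^+ d * T `^ (- b)) + T ^+ d / T)
         * expR (alpha * L) ^+ (d * (4 * d + 4)).+1
       + Cf * (T ^+ d / H%:R) / v ^+ d) <= eps * (T / L) ^+ d.
Proof.
move=> d0 al0 lev b1 A0 Cf0 c10 eps0.
have dR : 1 <= d%:R :> R by rewrite ler1n.
pose eta : R := (b - (9 * d ^ 2)%:R * alpha) / (2 * d%:R).
have d1 : 0 < d%:R :> R by lra.
have eta0 : 0 < eta by rewrite divr_gt0 ?mulr_gt0// subr_gt0.
have etaE : 2 * (d%:R * eta) = b - (9 * d ^ 2)%:R * alpha.
  by rewrite /eta; field; rewrite lt0r_neq0.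
have etad : eta <= d%:R * eta by rewrite ler_peMl// ltW.
clearbody eta.
pose D := (d * (4 * d + 4)).+1.
have Dle : D%:R * alpha <= (9 * d ^ 2)%:R * alpha.
  have Dle' : (D <= 9 * d ^ 2)%N by rewrite /D -mulnn; clear -d0; nia.
  by rewrite ler_wpM2r ?(ltW al0)// ler_nat.
pose m := (2 * d).+2.
pose g := (eta / m%:R) ^+ m.
have m0 : 0 < m%:R :> R by rewrite ltr0n.
have g0 : 0 < g by rewrite exprn_gt0// divr_gt0.
pose M := A * alpha * Cf * (2 ^+ d + 1 + (alpha / c1) ^+ d).
have M0 : 0 < M.
  by rewrite !mulr_gt0// !addr_gt0 ?exprn_gt0// divr_gt0.
exists (Num.max 1 (M / (eps * g))) => [|L v T]; first by rewrite le_max lexx.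
have eg0 : 0 < eps * g by exact: mulr_gt0.
rewrite ge_max ler_pdivrMr// => /andP[L1 LM] TE vL.
have L0 : 0 < L by lra.
pose E := expR (eta * L); have E0 : 0 < E by exact: expR_gt0.
have E1 : 1 <= E by rewrite -expR0 ler_expR mulr_ge0 ?ltW.
have /andP[H1 H2] := truncn_itv (ltW E0).
exists (Num.truncn E).+1 => //; set H := (Num.truncn E).+1 in H2 *.
have HE : H%:R <= 2 * E by rewrite /H -natr1; lra.
have Hpos : 0 < H%:R :> R by rewrite ltr0n.
have Td : 0 < T ^+ d by rewrite TE exprn_gt0 ?expR_gt0.
have t1 : H%:R ^+ d * (T ^+ d * T `^ (- b)) * expR (alpha * L) ^+ D <= T ^+ d / E * 2 ^+ d.
  have -> : H%:R ^+ d * (T ^+ d * T `^ (- b)) * expR (alpha * L) ^+ D =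
      T ^+ d * (H%:R ^+ d * (T `^ (- b) * expR (alpha * L) ^+ D)) by ring.
  rewrite -[leRHS]mulrA ler_wpM2l ?(ltW Td)//.
  apply: (@le_trans _ _ ((2 * E) ^+ d * (T `^ (- b) * expR (alpha * L) ^+ D))).
    rewrite ler_wpM2r ?mulr_ge0 ?powR_ge0 ?exprn_ge0 ?expR_ge0//.
    by rewrite lerXn2r ?nnegrE ?mulr_ge0 ?(ltW E0).
  rewrite exprMn -mulrA mulrC ler_wpM2r ?exprn_ge0//.
  rewrite TE /powR gt_eqF ?expR_gt0// expRK -!expRM_natl -!expRD -expRN ler_expR.
  rewrite (_ : _ + _ = (d%:R * eta - b + D%:R * alpha) * L); last by ring.
  by rewrite -mulNr ler_wpM2r ?(ltW L0)//; lra.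
have t2 : T ^+ d / T * expR (alpha * L) ^+ D <= T ^+ d / E.
  rewrite -mulrA ler_wpM2l ?(ltW Td)// TE -!expRN -expRM_natl -expRD ler_expR.
  rewrite (_ : _ + _ = (- 1 + D%:R * alpha) * L); last by ring.
  by rewrite -mulNr ler_wpM2r ?(ltW L0)//; lra.
have t3 : T ^+ d / H%:R / v ^+ d <= T ^+ d / E * (alpha / c1 * L) ^+ d.
  have v1 : 0 < c1 / (alpha * L) by rewrite divr_gt0// mulr_gt0.
  have v0 : 0 < v by exact: lt_le_trans vL.
  apply: ler_pM.
  - by rewrite divr_ge0// ltW.
  - by rewrite invr_ge0 exprn_ge0// ltW.
  - by rewrite ler_wpM2l ?(ltW Td)// lef_pV2 ?posrE// ltW.
  rewrite -exprVn lerXn2r ?nnegrE ?invr_ge0 ?(ltW v0)//.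
    by rewrite !mulr_ge0 ?invr_ge0 ?ltW.
  rewrite (_ : alpha / c1 * L = (c1 / (alpha * L))^-1) ?lef_pV2 ?posrE//.
  by field; rewrite !lt0r_neq0.
have tot : A * (alpha * L) *
      (Cf * (H%:R ^+ d * (T ^+ d * T `^ (- b)) + T ^+ d / T) * expR (alpha * L) ^+ D
       + Cf * (T ^+ d / H%:R) / v ^+ d) <= T ^+ d / E * (M * L ^+ d.+1).
  set a1 := H%:R ^+ d * _ in t1 *; set a2 := T ^+ d / T in t2 *.
  set a3 := T ^+ d / H%:R in t3 *; set zD := _ ^+ D in t1 t2 *.
  have -> : A * (alpha * L) * (Cf * (a1 + a2) * zD + Cf * a3 / v ^+ d) =
    A * alpha * Cf * L * (a1 * zD + a2 * zD + a3 / v ^+ d) by ring.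
  have TE0 : 0 <= T ^+ d / E by rewrite divr_ge0 ?ltW.
  have Ld : 1 <= L ^+ d by rewrite exprn_ege1.
  apply: (@le_trans _ _ (A * alpha * Cf * L *
      (T ^+ d / E * ((2 ^+ d + 1 + (alpha / c1) ^+ d) * L ^+ d)))).
    have c0 : 0 <= A * alpha * Cf * L by rewrite !mulr_ge0// ltW.
    rewrite ler_wpM2l//; apply: (le_trans (lerD (lerD t1 t2) t3)).
    rewrite -[X in _ + X + _]mulr1 -!mulrDr ler_wpM2l// exprMn !mulrDl lerD2r lerD ?mul1r//.
    by rewrite ler_peMr ?exprn_ge0.
  by rewrite le_eqVlt; apply/orP; left; apply/eqP; rewrite /M exprS; ring.
apply: le_trans tot _.
have EL : g * (L ^+ (2 * d).+1 * L) <= E.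
  rewrite -exprSr /g -exprMn /E (_ : eta * L = m%:R * (eta / m%:R * L)); last first.
    by field; rewrite lt0r_neq0.
  rewrite expRM_natl lerXn2r ?nnegrE ?expR_ge0//.
    by rewrite !mulr_ge0 ?invr_ge0 ?ltW.
  by apply: le_trans (expR_ge1Dx _); rewrite lerDr.
clearbody g M E; have ML : M * L ^+ d.+1 * L ^+ d <= eps * E.
  have -> : M * L ^+ d.+1 * L ^+ d = M * L ^+ (2 * d).+1.
    by rewrite -mulrA -exprD addSn addnn -mul2n.
  apply: (@le_trans _ _ (L * (eps * g) * L ^+ (2 * d).+1)).
    by rewrite ler_wpM2r ?exprn_ge0 ?(ltW L0).
  have -> : L * (eps * g) * L ^+ (2 * d).+1 = eps * (g * (L ^+ (2 * d).+1 * L)).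
    by move: (L ^+ _) => u; ring.
  by rewrite ler_wpM2l// ltW.
have Ld0 : 0 < L ^+ d by rewrite exprn_gt0.
have -> : T ^+ d / E * (M * L ^+ d.+1) = T ^+ d * (M * L ^+ d.+1 / E) by ring.
rewrite expr_div_n [leRHS]mulrCA ler_wpM2l ?(ltW Td)//.
by rewrite ler_pdivrMr// mulrAC ler_pdivlMr.
Qed.

End ErrorTerm.

Lemma coprime_prod_primes (R : realType) (d : nat) (z : R) (k : 'I_d -> nat) :
  (gcdn (\prod_i k i) (prod_primes_lt z) == 1%N) =
  [forall i, [forall p : 'I_(Num.truncn z).+1,
        (prime p && (p%:R < z)) ==> ~~ (p %| k i)%N]].
Proof.
rewrite -/(coprime _ _) /prod_primes_lt.
rewrite (big_morph (coprime _) (id1 := true) (op1 := andb) (coprimeMr _) (coprimen1 _)).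
rewrite big_andE; apply/forallP/forallP => [h i|h p].
  apply/forallP => p; apply/implyP => pz; have := h p; rewrite pz/=.
  rewrite coprime_sym prime_coprime; last by case/andP: pz.
  by apply: contra => dv; rewrite (bigD1 i)//= dvdn_mulr.
apply/implyP => pz; have pp : prime p by case/andP: pz.
rewrite coprime_sym prime_coprime// Euclid_dvd_prod// big_orE.
apply/existsP => -[i /= pk]; have /forallP/(_ p) := h i.
by rewrite pz pk.
Qed.

Theorem theorem5p1 (R : realType) (n d : nat) (Gamma : groupClosed (SL R n))
    (mX : probability (borel_hspace Gamma) R) (B : seq 'M[R]_n) (b alpha : R) :
  (2 <= n)%N ->
  cocompact_lattice Gamma ->
  right_invariant mX ->
  basis_of (sl R n) B ->
  0 < b < 1 ->
  equidistribution_exponent d mX B b ->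
  0 < alpha < b / (9 * d ^ 2)%:R ->
  exists c1 c2 : R, [/\ 0 < c1, 0 < c2 &
    forall f : hspace Gamma -> R, smooth f -> (forall x, 0 <= f x) ->
      exists T0 : R, forall (u : horo_flow n d) (T : R) (x0 : hspace Gamma),
        T0 <= T ->
        c1 * ((T / ln T) ^+ d * space_avg mX f)
          <= sifted_sum u f x0 T (prod_primes_lt (T `^ alpha))
          <= c2 * ((T / ln T) ^+ d * space_avg mX f)].
Proof.
move=> _ [_ _ cX] invX basisB /andP[b0 b1] eqd /andP[al0 alb].
have d0 : (0 < d)%N.
  rewrite lt0n; apply/eqP => d0; move: alb.
  by rewrite d0 exp0n// muln0 invr0 mulr0; lra.
have lev : (9 * d ^ 2)%:R * alpha < b.
  by rewrite mulrC -ltr_pdivlMr// ltr0n muln_gt0 expn_gt0 d0.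
have trB Y : Y \in B -> \tr Y = 0.
  by move=> /(basis_mem basisB); rewrite memv_ker lfunE => /eqP.
have [v1 [v2 [v10 v20 vP]]] := vprod_bounds R.
have [A A0 sieve] := @brun_hooley R d d0.
have k1 : 0 < (v1 / alpha) ^+ d by rewrite exprn_gt0// divr_gt0.
have k2 : 0 < (v2 / alpha) ^+ d by rewrite exprn_gt0// divr_gt0.
(* the sieve gives the factors 1 / 10 and 4; the error is at most half of the former *)
exists ((v1 / alpha) ^+ d / 20), (5 * (v2 / alpha) ^+ d); split.
- by rewrite divr_gt0.
- by rewrite mulr_gt0.
move=> f sf f0.
have [[x fx]|fz] := pselect (exists x, 0 < f x); last first.
  have fE x : f x = 0.
    apply/eqP; rewrite eq_le f0 andbT leNgt; apply/negP => fx.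
    by apply: fz; exists x.
  exists 0 => u T x0 _.
  have -> : space_avg mX f = 0.
    by rewrite /space_avg /Rintegral (eq_integral (cst 0%E)) ?integral0// => y _; rewrite fE.
  by rewrite !mulr0 /sifted_sum big1 ?lexx// => k _; rewrite fE.
have avg0 := space_avg_gt0 cX invX sf f0 fx; set avg := space_avg mX f in avg0 *.
have [Cf [T1 [Cf0 T11 lod]]] := level_of_distribution cX trB eqd sf f0.
have eps0 : 0 < avg * (v1 / alpha) ^+ d / 20 by rewrite divr_gt0 ?mulr_gt0.
have [L0 L01 small] := error_negligible d0 al0 lev b1 A0 Cf0 v10 eps0.
pose L1 := Num.max L0 (140 / alpha).
exists (Num.max T1 (expR L1)) => u T x0; rewrite ge_max => /andP[TT1 TL1].
have T0 : 0 < T by lra.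
set L := ln T; have TE : T = expR L by rewrite lnK ?posrE.
have : L1 <= L by rewrite -(expRK L1) ler_ln ?posrE ?expR_gt0.
rewrite ge_max ler_pdivrMr// => /andP[LL0 Lal].
have Lpos : 0 < L by lra.
set z := T `^ alpha; have zE : z = expR (alpha * L).
  by rewrite /z /powR gt_eqF.
have lnz : ln z = alpha * L by rewrite zE expRK.
have z140 : expR 140 <= z by rewrite zE ler_expR mulrC.
have z4 : 4 <= z by have := base_gt1 R; lra.
have := vP z z4; rewrite lnz => /andP[vlo vup].
have [H H0 Hsmall] := small L (vprod z) T LL0 TE vlo.
have v0 : 0 < vprod z by apply: lt_le_trans vlo; rewrite divr_gt0// mulr_gt0.
have HR0 : 0 < H%:R :> R by rewrite ltr0n.
have Td0 : 0 <= T ^+ d by rewrite exprn_ge0// ltW.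
pose E1 := Cf * (H%:R ^+ d * (T ^+ d * T `^ (- b)) + T ^+ d / T).
pose E2 := Cf * (T ^+ d / H%:R).
have E10 : 0 <= E1.
  have e1 : 0 <= T ^+ d / T by rewrite divr_ge0// ltW.
  have e2 : 0 <= T ^+ d * T `^ (- b) by rewrite mulr_ge0// powR_ge0.
  by rewrite /E1 mulr_ge0 ?(ltW Cf0)// addr_ge0// mulr_ge0// exprn_ge0.
have E20 : 0 <= E2 by rewrite /E2 mulr_ge0 ?(ltW Cf0)// divr_ge0.
pose F (k : {ffun 'I_d -> 'I_(Num.truncn T).+1}) := f (ract x0 (horo u (\row_i (k i)%:R))).
have level (q : 'I_d -> nat) : (forall i, (0 < q i)%N) ->
    `|\sum_(k : {ffun 'I_d -> 'I_(Num.truncn T).+1} | [forall i, (q i %| k i)%N]) F k - avg * T ^+ d * \prod_i (q i)%:R^-1|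
        <= E1 + E2 * \prod_i (q i)%:R^-1.
  move=> q0; have := lod u T x0 q H TT1 q0 H0.
  have -> : \prod_i (T / (q i)%:R) = T ^+ d * \prod_i (q i)%:R^-1.
    by rewrite big_split/= prodr_const card_ord.
  rewrite -/(F _) -/avg mulrA => h; apply: le_trans h _.
  by rewrite le_eqVlt; apply/orP; left; apply/eqP; rewrite /E1 /E2; ring.
have X0 : 0 <= avg * T ^+ d by rewrite mulr_ge0// ltW.
have SE : sifted_sum u f x0 T (prod_primes_lt z) =
    \sum_(k : {ffun 'I_d -> 'I_(Num.truncn T).+1} | [forall i, [forall p : 'I_(Num.truncn z).+1,
        (prime p && (p%:R < z)) ==> ~~ (p %| k i)%N]]) F k.
  by apply: eq_bigl => k; rewrite coprime_prod_primes.
have := sieve z _ (fun (k : {ffun 'I_d -> 'I_(Num.truncn T).+1}) i => k i : nat) F _ E1 E2 z140 X0 E10 E20 (fun k => f0 _) level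
  (sifted_sum u f x0 T (prod_primes_lt z)) _
  SE erefl.
rewrite lnz; set err := A * _ * _.
have errle : err <= avg * (v1 / alpha) ^+ d / 20 * (T / L) ^+ d.
  by apply: le_trans Hsmall; rewrite /err /E1 /E2 -zE.
have mix (v : R) : v / alpha * (T / L) = T * (v / (alpha * L)).
  by rewrite invfM; ring.
have lo : (v1 / alpha) ^+ d * (T / L) ^+ d <= T ^+ d * vprod z ^+ d.
  rewrite -!exprMn lerXn2r ?nnegrE ?mulr_ge0 ?invr_ge0 ?(ltW v10) ?(ltW al0) ?(ltW T0) ?(ltW Lpos) ?(ltW v0)//.
  by rewrite mix ler_wpM2l ?(ltW T0).
have up : T ^+ d * vprod z ^+ d <= (v2 / alpha) ^+ d * (T / L) ^+ d.
  rewrite -!exprMn lerXn2r ?nnegrE ?mulr_ge0 ?invr_ge0 ?(ltW v20) ?(ltW al0) ?(ltW T0) ?(ltW Lpos) ?(ltW v0)//.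
  by rewrite mix ler_wpM2l ?(ltW T0).
have lo' := ler_wpM2l (ltW avg0) lo; have up' := ler_wpM2l (ltW avg0) up.
move: lo' up' errle; set Q := (T / L) ^+ d; set w := vprod z ^+ d.
set a1 := (v1 / alpha) ^+ d; set a2 := (v2 / alpha) ^+ d; set S := sifted_sum _ _ _ _ _.
have Q0 : 0 <= avg * Q by rewrite mulr_ge0 ?(ltW avg0)// exprn_ge0// divr_ge0// ltW.
clear - Q0; clearbody a1 a2 Q w S err avg; move: (T ^+ d) => X lo' up' errle /andP[h1 h2].
apply/andP; split; lra.
Qed.
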